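(* Let $n\ge2$, let $X\subset(\mathbb R^n)^k$ be compact, $f\colon X\to(\mathbb R^n)^m$ a map and $U\subset X$. The following are equivalent: (1) there is a classical linkage in $\mathbb R^n$ which is functional for $f$ with domain $X$ and restricted domain $U$; (2) there are a compact real algebraic set $Y$, polynomial maps $q\colon Y\to X$ and $p\colon Y\to(\mathbb R^n)^m$, a finite set $F$ and an analytic map $\sigma\colon U\times F\to Y$ such that (a) $p=f\circ q$; (b) $q$ is onto; (c) $q(\sigma(x,c))=x$ for all $(x,c)\in U\times F$; (d) $\sigma$ is an analytic isomorphism onto $q^{-1}(U)$.
   Context: A classical linkage in $\mathbb R^n$ is $\mathcal L=(L,\ell,V,\mu)$: $L$ a finite one-dimensional simplicial complex (vertex set $\mathcal V(L)$, edge set $\mathcal E(L)$), $\ell\colon\mathcal E(L)\to(0,\infty)$, $V\subset\mathcal V(L)$ fixed vertices, $\mu\colon V\to\mathbb R^n$. $\mathcal C(\mathcal L)=\{\varphi\colon\mathcal V(L)\to\mathbb R^n\mid\varphi(v)=\mu(v)\ (v\in V),\ |\varphi(v)-\varphi(w)|=\ell(vw)\ (vw\in\mathcal E(L))\}$. $\mathcal L$ is quasifunctional for $f$ with domain $X$ if there are vertices $w_1,\dots,w_k$, $v_1,\dots,v_m$ with input map $q(\varphi)=(\varphi(w_1),\dots,\varphi(w_k))$ and output map $p(\varphi)=(\varphi(v_1),\dots,\varphi(v_m))$ satisfying $q(\mathcal C(\mathcal L))=X$, $p=f\circ q$; it is functional with restricted domain $U\subset X$ if moreover there are a finite set $E$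 and an analytic isomorphism $\sigma\colon U\times E\to q^{-1}(U)$ with $q(\sigma(u,c))=u$. An analytic isomorphism is a homeomorphism $g$ such that $g$ and $g^{-1}$ are restrictions of analytic maps. A real algebraic set is the zero set of finitely many real polynomials. *)

(* Defs.v *)
From HB Require Import structures.
From mathcomp Require Import all_boot all_order all_algebra.
From mathcomp Require Import all_classical all_reals all_analysis.
From mathcomp Require mpoly.
Set Implicit Arguments. Unset Strict Implicit. Unset Printing Implicit Defensive.
Import Order.TTheory GRing.Theory Num.Theory.
Import numFieldNormedType.Exports.
Local Open Scope classical_set_scope.
Local Open Scope ring_scope.

Section Defs.
Variable R : realType.

(* A point of (R^b)^a is a matrix 'M[R]_(a,b) (row i = i-th point);
   its coordinates are indexed by 'I_a * 'I_b.  A multi-index is a map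
   'I_a * 'I_b -> nat. *)

Definition monom (a b : nat) (x x0 : 'M[R]_(a,b)) (al : 'I_a * 'I_b -> nat) : R :=
  \prod_(i : 'I_a * 'I_b) (x i.1 i.2 - x0 i.1 i.2) ^+ al i.

Definition box_psum (a b : nat) (c : ('I_a * 'I_b -> nat) -> R)
  (x x0 : 'M[R]_(a,b)) (d : nat) : R :=
  \sum_(al : {ffun 'I_a * 'I_b -> 'I_d})
     c (fun i => nat_of_ord (al i)) * monom x x0 (fun i => nat_of_ord (al i)).

Definition box_pasum (a b : nat) (c : ('I_a * 'I_b -> nat) -> R)
  (x x0 : 'M[R]_(a,b)) (d : nat) : R :=
  \sum_(al : {ffun 'I_a * 'I_b -> 'I_d})
     `| c (fun i => nat_of_ord (al i)) * monom x x0 (fun i => nat_of_ord (al i)) |.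

Definition analytic_at (a b : nat) (g : 'M[R]_(a,b) -> R) (x0 : 'M[R]_(a,b)) : Prop :=
  exists (c : ('I_a * 'I_b -> nat) -> R) (r : R), 0 < r /\
    forall x : 'M[R]_(a,b), (forall i j, `|x i j - x0 i j| < r) ->
      (exists M : R, forall d, box_pasum c x x0 d <= M) /\
      (box_psum c x x0 @ \oo --> g x).

Definition analytic_restr (a b c d : nat) (A : set 'M[R]_(a,b))
  (g : 'M[R]_(a,b) -> 'M[R]_(c,d)) : Prop :=
  exists (W : set 'M[R]_(a,b)) (h : 'M[R]_(a,b) -> 'M[R]_(c,d)),
    open W /\ A `<=` W /\
    (forall x, W x -> forall i j, analytic_at (fun y => h y i j) x) /\
    (forall x, A x -> g x = h x).

(* sigma : U x 'I_e -> S is an analytic isomorphism (the finite set 'I_e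
   is discrete, embedded in R via c |-> c%:R). *)
Definition analytic_iso_prod (k n e p1 p2 : nat) (U : set 'M[R]_(k,n))
  (sigma : 'M[R]_(k,n) -> 'I_e -> 'M[R]_(p1,p2)) (S : set 'M[R]_(p1,p2)) : Prop :=
  (forall c, analytic_restr U (sigma ^~ c)) /\
  (forall x c, U x -> S (sigma x c)) /\
  exists (t1 : 'M[R]_(p1,p2) -> 'M[R]_(k,n)) (t2 : 'M[R]_(p1,p2) -> 'I_e),
    analytic_restr S t1 /\
    analytic_restr S (fun y => ((nat_of_ord (t2 y))%:R)%:M : 'M[R]_(1,1)) /\
    (forall y, S y -> U (t1 y) /\ sigma (t1 y) (t2 y) = y) /\
    (forall x c, U x -> t1 (sigma x c) = x /\ t2 (sigma x c) = c).

Definition real_algebraic (D : nat) (Y : set 'rV[R]_D) : Prop :=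
  exists (r : nat) (P : 'I_r -> mpoly.mpoly D R),
    Y = [set y | forall i, mpoly.meval (fun t => y 0 t) (P i) = 0].

Definition poly_map_on (D a b : nat) (Y : set 'rV[R]_D)
  (g : 'rV[R]_D -> 'M[R]_(a,b)) : Prop :=
  exists P : 'I_a -> 'I_b -> mpoly.mpoly D R,
    forall y, Y y -> forall i j, g y i j = mpoly.meval (fun t => y 0 t) (P i j).

Definition eucl_norm (n : nat) (x : 'rV[R]_n) : R :=
  Num.sqrt (\sum_(j < n) x 0 j ^+ 2).

Record linkage (n : nat) := Linkage {
  lk_N : nat;
  lk_E : {set {set 'I_lk_N}};
  lk_len : {set 'I_lk_N} -> R;
  lk_fix : {set 'I_lk_N};
  lk_mu : 'I_lk_N -> 'rV[R]_n;
  lk_E2 : forall e, e \in lk_E -> #|e| = 2%N;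
  lk_len_pos : forall e, e \in lk_E -> 0 < lk_len e }.

Arguments lk_N {n} l.
Arguments lk_E {n} l.
Arguments lk_len {n} l _.
Arguments lk_fix {n} l.
Arguments lk_mu {n} l _.

(* a map phi : V(L) -> R^n is a matrix whose row v is phi(v) *)
Definition config (n : nat) (L : linkage n) : set 'M[R]_(lk_N L, n) :=
  [set phi | (forall v, v \in lk_fix L -> row v phi = lk_mu L v) /\
             (forall v w, [set v; w]%SET \in lk_E L -> v != w ->
                eucl_norm (row v phi - row w phi) = lk_len L [set v; w]%SET)].

Arguments config {n} L.

Definition vproj (n N k : nat) (w : 'I_k -> 'I_N) (phi : 'M[R]_(N, n)) : 'M[R]_(k, n) :=
  \matrix_(i, j) phi (w i) j.

Definition functional_for (n k m : nat) (L : linkage n) (X : set 'M[R]_(k,n))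
  (f : 'M[R]_(k,n) -> 'M[R]_(m,n)) (U : set 'M[R]_(k,n)) : Prop :=
  exists (w : 'I_k -> 'I_(lk_N L)) (v : 'I_m -> 'I_(lk_N L)),
    vproj w @` config L = X /\
    (forall phi, config L phi -> vproj v phi = f (vproj w phi)) /\
    exists (e : nat) (sigma : 'M[R]_(k,n) -> 'I_e -> 'M[R]_(lk_N L, n)),
      analytic_iso_prod U sigma (config L `&` vproj w @^-1` U) /\
      (forall x c, U x -> vproj w (sigma x c) = x).

End Defs.

(* Main.v *)
(* From (1) to (2), the configurations of a linkage form a real algebraic set,
   compact once every component without fixed or input vertices is pinned at one
   vertex; over a nonempty U such components do not exist, since the fibres are
   finite.

   From (2) to (1), everything is reduced to linear relations between unit vectors.
   A vertex is a real linear combination of unit vectors attached to the origin;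
   such combinations are built from collinear bars and from parallelograms made
   rigid by joining the midpoints of two opposite sides, and a relation is imposed
   by joining its vertex to two opposite unit vectors. A rhombus of side t
   with opposite vertices x and y, whose two other vertices are at distance L from 0,
   forces x . y = L^2 - t^2. Two rhombi with different arms
   on the same x and y are a Peaucellier cell without degenerate branch: when y runs
   on a circle through 0, x runs on a line, and over the open segment of its
   positions the fibre consists of four analytic sections. One more rhombus gives
   the inversion s t = const on such lines, and inversions and linear equations
   generate all polynomials, 1 - z^2 being 2 / (1 / (1 - z) + 1 / (1 + z)). Lines
   along a diagonal transfer a coordinate from one axis to another. Applied to the
   equations of Y, to q and to p, this gives a linkage whose configuration space is
   the product of Y and a finite set.

   Only sums, products, inverses and square roots occur in the sections, so
   analyticity needs no composition of power series: inverses and square roots come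
   from quadratic fixed point equations, solved by series indexed by trees. The
   discrete coordinate of the inverse isomorphism is locally constant because
   finitely many continuous sections that are pointwise distinct have separated
   images. *)
Require Import Defs.
From HB Require Import structures.
From mathcomp Require Import all_boot all_order all_algebra.
From mathcomp Require Import finmap all_classical all_reals all_analysis.
From mathcomp Require mpoly.
From mathcomp Require Import ring lra zify.
Set Implicit Arguments. Unset Strict Implicit. Unset Printing Implicit Defensive.
Import Order.TTheory GRing.Theory Num.Theory.
Import numFieldNormedType.Exports.
Local Open Scope classical_set_scope.
Local Open Scope ring_scope.

(** * Unconditional sums *)

(** The configuration space of a linkage contains every solution of the length equations, folded and
    singular ones included. Soundness is therefore proved for arbitrary solutions, before anything
    is known to lie over [Y] ([system_sound], [ar_sound]); over [Y], strict inequalities keep the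
    radicands positive and the number of branches constant. Compactness of [Y] provides these
    inequalities: one factor [d] scales all variables to absolute value at most 1.

    Constants: both rhombi of a line have L^2 - t^2 = 5. With arm 3 and leg 2 the reach is 5, so a
    line at distance 4 from 0 is met in a segment of half-length 3. With arm 21/4 and leg 19/4 the
    lengths range from 1/2 to 10, and this rhombus is not critical on that segment. A circle of
    diameter 5/4 through 0 is inverted with power 5 into the line at distance 5 / (5/4) = 4.

    [U] is an arbitrary subset of [X], and analyticity is tested only after composition with the
    given sections; on the way back, the inverse is controlled by [q] and by a locally constant
    index. *)

Section UnconditionalSums.
Variable R : realType.

Definition nsum (I : choiceType) (p : I -> R) (s : R) : Prop :=
  (forall i, 0 <= p i) /\ \esum_(i in [set: I]) (p i)%:E = s%:E.

(** A difference of two summable nonnegative families encodes absolute convergence. Reindexing,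
    regrouping and products then reduce to facts on [esum] for nonnegative families, without any
    order of summation. *)
Definition has_sum (I : choiceType) (a : I -> R) (s : R) : Prop :=
  exists p q P Q, [/\ nsum p P, nsum q Q, forall i, a i = p i - q i & s = P - Q].

Lemma nsum_ge0 (I : choiceType) (p : I -> R) s : nsum p s -> 0 <= s.
Proof.
case=> p0 ps; rewrite -lee_fin -ps; apply: esum_ge0 => i _.
by rewrite lee_fin.
Qed.

Lemma nsum_uniq (I : choiceType) (p : I -> R) s t : nsum p s -> nsum p t -> s = t.
Proof. by case=> _ ps [_ pt]; apply: EFin_inj; rewrite -ps -pt. Qed.

Lemma eq_nsum (I : choiceType) (p q : I -> R) s : p =1 q -> nsum p s -> nsum q s.
Proof. by move=> /funext ->. Qed.

Lemma eq_has_sum (I : choiceType) (p q : I -> R) s : p =1 q -> has_sum p s -> has_sum q s.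
Proof. by move=> /funext ->. Qed.

Lemma nsum_esum_le (I : choiceType) (p : I -> R) M : (forall i, 0 <= p i) ->
  (\esum_(i in [set: I]) (p i)%:E <= M%:E)%E -> exists2 s, s <= M & nsum p s.
Proof.
move=> p0 pM; have e0 : (0 <= \esum_(i in [set: I]) (p i)%:E)%E.
  by apply: esum_ge0 => i _; rewrite lee_fin.
have fe : \esum_(i in [set: I]) (p i)%:E \is a fin_num.
  by rewrite ge0_fin_numE //; apply: le_lt_trans pM _; rewrite ltry.
exists (fine (\esum_(i in [set: I]) (p i)%:E)); first by rewrite -lee_fin fineK.
by split=> //; rewrite fineK.
Qed.

Lemma nsum_le (I : choiceType) (p q : I -> R) M : (forall i, 0 <= p i <= q i) ->
  nsum q M -> exists2 s, s <= M & nsum p s.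
Proof.
move=> pq [q0 qM]; apply: nsum_esum_le => [i|]; first by case/andP: (pq i).
rewrite -qM; apply: le_esum => i _; rewrite lee_fin; by case/andP: (pq i).
Qed.

Lemma nsumD (I : choiceType) (p q : I -> R) s t :
  nsum p s -> nsum q t -> nsum (fun i => p i + q i) (s + t).
Proof.
move=> [p0 ps] [q0 qt]; split=> [i|]; first exact: addr_ge0.
under eq_esum do rewrite EFinD.
by rewrite esumD ?ps ?qt // => i _; rewrite lee_fin.
Qed.

Lemma nsum_ge_fset (I : choiceType) (p : I -> R) s (J : {fset I}) :
  nsum p s -> \sum_(i <- J) p i <= s.
Proof.
move=> [p0 ps]; rewrite -lee_fin -ps -sumEFin; apply: esum_ge.
exists [set` J]; first by split.
by rewrite -fsbig_seq.
Qed.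

Lemma nsum_bound (I : choiceType) (p : I -> R) M : (forall i, 0 <= p i) ->
  (forall J : {fset I}, \sum_(i <- J) p i <= M) -> exists2 s, s <= M & nsum p s.
Proof.
move=> p0 pM; apply: nsum_esum_le => //; apply: ge_ereal_sup => _ [X [fX _] <-].
by rewrite fsbig_finite //= sumEFin lee_fin; exact: pM.
Qed.

Lemma nsumZ (I : choiceType) (p : I -> R) s c : 0 <= c ->
  nsum p s -> nsum (fun i => c * p i) (c * s).
Proof.
move=> c0 ps; have p0 : forall i, 0 <= p i by case: ps.
(* Finite subsums only give an upper bound for the scaled sum; using it for [c] and for [c^-1] makes
   it an equality. *)
have h d (q : I -> R) t : 0 <= d -> nsum q t ->
    exists2 t', t' <= d * t & nsum (fun i => d * q i) t'.
  move=> d0 qt; apply: nsum_bound => [i|J].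
    by case: qt => q0 _; exact: mulr_ge0.
  by rewrite -mulr_sumr; apply: ler_wpM2l => //; exact: nsum_ge_fset qt.
have [t' t'le nt] := h _ _ _ c0 ps.
move: c0; rewrite le_eqVlt => /orP[/eqP c0|c0].
  move: t'le (nsum_ge0 nt); rewrite -c0 mul0r => t1 t2.
  have t'0 : t' = 0 by lra.
  by move: nt; rewrite -c0 t'0.
have ci : 0 <= c^-1 by rewrite invr_ge0 ltW.
have [t2 t2le nt2] := h _ _ _ ci nt.
have : s = t2.
  apply: nsum_uniq ps _; apply: eq_nsum nt2 => i /=.
  by rewrite mulrA mulVf ?mul1r // gt_eqF.
move=> st2; suff -> : c * s = t' by [].
apply/eqP; rewrite eq_le t'le andbT st2 -ler_pdivlMl // .
Qed.

Lemma nsum_reindex (I J : choiceType) (e : I -> J) (p : J -> R) s :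
  bijective e -> nsum p s -> nsum (p \o e) s.
Proof.
move=> be [p0 ps]; split=> [i|]; first exact: p0.
rewrite -ps [RHS](@reindex_esum _ _ _ setT setT e) //.
by rewrite setTT_bijective.
Qed.

Lemma nsum_pair (I J : choiceType) (p : I -> J -> R) (P : I -> R) s :
  (forall i, nsum (p i) (P i)) -> nsum P s -> nsum (fun k : I * J => p k.1 k.2) s.
Proof.
move=> pP [P0 Ps]; split=> [[i j]|]; first by case: (pP i).
have -> : [set: I * J] = [set: I] `*`` (fun=> [set: J]).
  by apply/seteqP; split => // -[].
rewrite -(@esum_esum _ _ _ _ _ (fun i j => (p i j)%:E)) => [|i j _ _]; last first.
  by rewrite lee_fin; case: (pP i).
by rewrite -Ps; apply: eq_esum => i _; case: (pP i).
Qed.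

Lemma nsum_prod (I J : choiceType) (p : I -> R) (q : J -> R) s t :
  nsum p s -> nsum q t -> nsum (fun k : I * J => p k.1 * q k.2) (s * t).
Proof.
move=> ps qt; apply: (@nsum_pair _ _ (fun i j => p i * q j) (fun i => p i * t)).
  by move=> i; apply: nsumZ => //; case: ps.
apply: (@eq_nsum _ (fun i => t * p i)) => [i|]; first by rewrite mulrC.
by rewrite mulrC; apply: nsumZ => //; exact: nsum_ge0 qt.
Qed.

Lemma nsum_sumtype (I J : choiceType) (p : I + J -> R) s t :
  nsum (p \o inl) s -> nsum (p \o inr) t -> nsum p (s + t).
Proof.
move=> [p0 ps] [q0 qt]; split; first by case=> i; [exact: p0|exact: q0].
rewrite (esumID (range inl)) => [|k _]; last first.
  by rewrite lee_fin; case: k => i; [exact: p0|exact: q0].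
rewrite !setTI (_ : ~` range inl = range inr); last first.
  apply/seteqP; split=> [[i|j] /= h|_ [j _ <-] [i _]] //.
  - by case: h; exists i.
  - by exists j.
rewrite !esum_image; [|by move=> ? ? _ _ []..].
by rewrite EFinD -ps -qt.
Qed.

Lemma nsum0 (I : choiceType) : nsum (fun _ : I => 0) 0.
Proof. by split=> //; rewrite esum1. Qed.

Lemma nsum1 (I : choiceType) (i0 : I) x : 0 <= x ->
  nsum (fun i => if i == i0 then x else 0) x.
Proof.
move=> x0; split=> [i|]; first by case: ifP.
rewrite (esumID [set i0]); last by move=> i _; rewrite lee_fin; case: ifP.
rewrite setTI esum_set1 ?eqxx ?lee_fin // esum1 ?adde0 // => i [_ /= /eqP].
by case: eqP.
Qed.

(** Both sums are the sum over the graph of [m], the pairs [(m i, i)], taken fibre by fibre on one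
    side. *)
Lemma nsum_group (I T : choiceType) (m : I -> T) (p : I -> R) s (c : T -> R) :
  nsum p s -> (forall t, nsum (fun i => if m i == t then p i else 0) (c t)) ->
  nsum c s.
Proof.
move=> [p0 ps] fc; split=> [t|]; first exact: nsum_ge0 (fc t).
transitivity (\esum_(t in [set: T]) \esum_(i in [set i | m i = t]) (p i)%:E).
  apply: eq_esum => t _; case: (fc t) => _ <-.
  rewrite [RHS]esum_mkcond; apply: eq_esum => i _.
  case: eqP => mt; first by rewrite mem_set.
  by rewrite memNset.
rewrite (@esum_esum _ _ _ _ _ (fun t i => (p i)%:E)) => [|t i _ _]; last first.
  by rewrite lee_fin.
rewrite -ps (@reindex_esum _ _ _ [set: I] _ (fun i => (m i, i))) //.
split=> //.
- by move=> i j _ _ [].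
- by move=> [t i] [_ /= <-]; exists i.
Qed.

Lemma nsum_fiber (I T : choiceType) (m : I -> T) (p : I -> R) s t :
  nsum p s -> exists c, nsum (fun i => if m i == t then p i else 0) c.
Proof.
move=> ps; have p0 : forall i, 0 <= p i by case: ps.
have [|c _ h] := nsum_le (p := fun i => if m i == t then p i else 0) _ ps.
  by move=> i; case: ifP => _; rewrite ?lexx p0.
by exists c.
Qed.

Lemma has_sum_nsum (I : choiceType) (p : I -> R) s : nsum p s -> has_sum p s.
Proof.
move=> ps; exists p, (fun=> 0), s, 0.
by split=> // [|i|]; rewrite ?subr0 //; exact: nsum0.
Qed.

Lemma has_sum_uniq (I : choiceType) (a : I -> R) s t : has_sum a s -> has_sum a t -> s = t.
Proof.
move=> [p [q [P [Q [pP qQ apq ->]]]]] [p' [q' [P' [Q' [pP' qQ' apq' ->]]]]].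
have h1 := nsumD pP qQ'; have h2 := nsumD pP' qQ.
suff : P + Q' = P' + Q by move=> h; lra.
apply: nsum_uniq h1 _; apply: eq_nsum h2 => i.
by have := apq i; have := apq' i; lra.
Qed.

Lemma has_sumD (I : choiceType) (a b : I -> R) s t :
  has_sum a s -> has_sum b t -> has_sum (fun i => a i + b i) (s + t).
Proof.
move=> [p [q [P [Q [pP qQ apq ->]]]]] [p' [q' [P' [Q' [pP' qQ' apq' ->]]]]].
exists (fun i => p i + p' i), (fun i => q i + q' i), (P + P'), (Q + Q').
split; [exact: nsumD|exact: nsumD| |by lra].
by move=> i; rewrite apq apq'; lra.
Qed.

Lemma has_sumN (I : choiceType) (a : I -> R) s : has_sum a s -> has_sum (fun i => - a i) (- s).
Proof.
move=> [p [q [P [Q [pP qQ apq ->]]]]]; exists q, p, Q, P.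
by split=> // [i|]; rewrite ?apq opprB.
Qed.

Lemma has_sumZ (I : choiceType) (a : I -> R) s c : has_sum a s -> has_sum (fun i => c * a i) (c * s).
Proof.
wlog c0 : c / 0 <= c => [hw|].
  have [|c0 h] := leP 0 c; first exact: hw.
  have := has_sumN (hw (- c) _ h); rewrite oppr_ge0 (ltW c0) mulNr opprK => /(_ isT).
  by apply: eq_has_sum => i; rewrite mulNr opprK.
move=> [p [q [P [Q [pP qQ apq ->]]]]].
exists (fun i => c * p i), (fun i => c * q i), (c * P), (c * Q).
split; [exact: nsumZ|exact: nsumZ| |by rewrite mulrBr].
by move=> i; rewrite apq mulrBr.
Qed.

Lemma has_sum_prod (I J : choiceType) (a : I -> R) (b : J -> R) s t :
  has_sum a s -> has_sum b t -> has_sum (fun k : I * J => a k.1 * b k.2) (s * t).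
Proof.
move=> [p [q [P [Q [pP qQ apq ->]]]]] [p' [q' [P' [Q' [pP' qQ' apq' ->]]]]].
exists (fun k => p k.1 * p' k.2 + q k.1 * q' k.2),
  (fun k => p k.1 * q' k.2 + q k.1 * p' k.2), (P * P' + Q * Q'), (P * Q' + Q * P').
split; [by apply: nsumD; exact: nsum_prod..| |by ring].
by move=> [i j]; rewrite apq apq' /=; ring.
Qed.

Lemma has_sum_sumtype (I J : choiceType) (a : I + J -> R) s t :
  has_sum (a \o inl) s -> has_sum (a \o inr) t -> has_sum a (s + t).
Proof.
move=> [p [q [P [Q [pP qQ apq ->]]]]] [p' [q' [P' [Q' [pP' qQ' apq' ->]]]]].
exists (fun k => match k with inl i => p i | inr j => p' j end),
  (fun k => match k with inl i => q i | inr j => q' j end), (P + P'), (Q + Q').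
by split; [exact: nsum_sumtype|exact: nsum_sumtype|case=> i; [exact: apq|exact: apq']|lra].
Qed.

Lemma has_sum_reindex (I J : choiceType) (e : I -> J) (a : J -> R) s :
  bijective e -> has_sum a s -> has_sum (a \o e) s.
Proof.
move=> be [p [q [P [Q [pP qQ apq ->]]]]].
exists (p \o e), (q \o e), P, Q.
by split=> // [||i]; [exact: nsum_reindex|exact: nsum_reindex|exact: apq].
Qed.

Lemma has_sum_abs (I : choiceType) (a : I -> R) N : nsum (fun i => `|a i|) N ->
  exists2 s, `|s| <= N & has_sum a s.
Proof.
move=> aN.
have [|P PN pP] := nsum_le (p := fun i => Num.max (a i) 0) _ aN.
  by move=> i; rewrite le_max lexx orbT /= ge_max ler_norm normr_ge0.
have [|Q QN qQ] := nsum_le (p := fun i => Num.max (- a i) 0) _ aN.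
  by move=> i; rewrite le_max lexx orbT /= ge_max -normrN ler_norm normr_ge0.
exists (P - Q); last first.
  exists (fun i => Num.max (a i) 0), (fun i => Num.max (- a i) 0), P, Q.
  split=> // i; have [h|h] := leP 0 (a i).
    by rewrite max_r ?subr0 // oppr_le0.
  by rewrite max_l ?opprK ?add0r // oppr_ge0 ltW.
by have := nsum_ge0 pP; have := nsum_ge0 qQ; rewrite ler_norml; lra.
Qed.

Lemma has_sum_le (I : choiceType) (a p : I -> R) s N : (forall i, `|a i| <= p i) ->
  nsum p N -> has_sum a s -> `|s| <= N.
Proof.
move=> ap pN as_.
have [|M MN aM] := nsum_le (p := fun i => `|a i|) _ pN.
  by move=> i; rewrite normr_ge0 ap.
have [t tM at_] := has_sum_abs aM.
by rewrite (has_sum_uniq as_ at_) (le_trans tM).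
Qed.

Lemma has_sum_group (I T : choiceType) (m : I -> T) (a : I -> R) s (c : T -> R) :
  has_sum a s -> (forall t, has_sum (fun i => if m i == t then a i else 0) (c t)) ->
  has_sum c s.
Proof.
move=> [p [q [P [Q [pP qQ apq ->]]]]] fc.
have [p' hp'] := choice (fun t => nsum_fiber m t pP).
have [q' hq'] := choice (fun t => nsum_fiber m t qQ).
exists p', q', P, Q; split=> //; [exact: nsum_group hp'|exact: nsum_group hq'|].
move=> t; apply: has_sum_uniq (fc t) _.
have := has_sumD (has_sum_nsum (hp' t)) (has_sumN (has_sum_nsum (hq' t))).
by apply: eq_has_sum => i; case: ifP; rewrite ?apq ?subr0.
Qed.

Lemma has_sum1 (I : choiceType) (i0 : I) x : has_sum (fun i => if i == i0 then x else 0) x.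
Proof.
have := has_sumZ x (has_sum_nsum (nsum1 i0 ler01)); rewrite mulr1.
by apply: eq_has_sum => i; case: ifP; rewrite ?mulr1 ?mulr0.
Qed.

End UnconditionalSums.

(** * Power series *)

(** Iterating w = u + p w + q w^2 expands w into a sum over these trees: a leaf picks a term of u, a
    unary node a term of p, a binary node a term of q. *)
Inductive qtree (T : Type) : Type :=
  | QLeaf of T
  | QUn of T & qtree T
  | QBin of T & qtree T & qtree T.

Fixpoint qtree_code (T : Type) (t : qtree T) : GenTree.tree T :=
  match t with
  | QLeaf i => GenTree.Node 0 [:: GenTree.Leaf i]
  | QUn i s => GenTree.Node 1 [:: GenTree.Leaf i; qtree_code s]
  | QBin i s1 s2 => GenTree.Node 2 [:: GenTree.Leaf i; qtree_code s1; qtree_code s2]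
  end.

Fixpoint qtree_decode (T : Type) (t : GenTree.tree T) : option (qtree T) :=
  match t with
  | GenTree.Node 0 [:: GenTree.Leaf i] => Some (QLeaf i)
  | GenTree.Node 1 [:: GenTree.Leaf i; s] => omap (QUn i) (qtree_decode s)
  | GenTree.Node 2 [:: GenTree.Leaf i; s1; s2] =>
      if (qtree_decode s1, qtree_decode s2) is (Some t1, Some t2)
      then Some (QBin i t1 t2) else None
  | _ => None
  end.

Lemma qtree_codeK (T : Type) : pcancel (@qtree_code T) (@qtree_decode T).
Proof. by elim=> [i|i s /= ->|i s1 /= -> s2 ->]. Qed.

HB.instance Definition _ (T : choiceType) :=
  Choice.copy (qtree T) (pcan_type (@qtree_codeK T)).

Section PowerSeries.
Variables (R : realType) (A : finType).
Local Notation T := {ffun A -> nat}.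
Implicit Types (v : A -> R) (al be : T) (G : (A -> R) -> R).

Definition mon v al : R := \prod_k v k ^+ al k.
Definition mdeg al : nat := (\sum_k al k)%N.
Definition maddn al be : T := [ffun k => (al k + be k)%N].
Definition mzero : T := [ffun=> 0%N].
Definition inbox (r : R) v := forall k, `|v k| < r.

Lemma monD v al be : mon v (maddn al be) = mon v al * mon v be.
Proof. by rewrite -big_split; apply: eq_bigr => k _; rewrite ffunE exprD. Qed.

Lemma mdegD al be : mdeg (maddn al be) = (mdeg al + mdeg be)%N.
Proof. by rewrite -big_split; apply: eq_bigr => k _; rewrite ffunE. Qed.

Lemma mon0 v : mon v mzero = 1.
Proof. by rewrite /mon big1 // => k _; rewrite ffunE. Qed.

Lemma mdeg0 : mdeg mzero = 0%N.
Proof. by rewrite /mdeg big1 // => k _; rewrite ffunE. Qed.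

Lemma mdeg_gt0 al : al != mzero -> (0 < mdeg al)%N.
Proof.
apply: contraR; rewrite -eqn0Ngt /mdeg sum_nat_eq0 => /forallP h.
by apply/eqP/ffunP => k; rewrite ffunE; exact/eqP/(h k).
Qed.

Lemma mon_le v al r : 0 < r -> inbox r v -> `|mon v al| <= r ^+ mdeg al.
Proof.
move=> r0 vr; rewrite /mon normr_prod /mdeg (big_morph _ (exprD r) (expr0 r)).
apply: ler_prod => k _; rewrite normr_ge0 normrX /=.
by apply: lerXn2r; rewrite ?nnegrE ?(ltW r0) ?(ltW (vr k)).
Qed.

Lemma mon_const r al : mon (fun=> r) al = r ^+ mdeg al.
Proof. by rewrite /mon /mdeg (big_morph _ (exprD r) (expr0 r)). Qed.

Definition pseries_on G r (c : T -> R) N : Prop :=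
  nsum (fun al => `|c al| * r ^+ mdeg al) N /\
  forall v, inbox r v -> has_sum (fun al => c al * mon v al) (G v).

Definition germ G : Prop := exists r c N, 0 < r /\ pseries_on G r c N.

Lemma inbox0 r : 0 < r -> inbox r (fun=> 0).
Proof. by move=> r0 k; rewrite normr0. Qed.

Lemma inbox_le r r' v : r <= r' -> inbox r v -> inbox r' v.
Proof. by move=> rr vr k; exact: lt_le_trans (vr k) rr. Qed.

Lemma pseries_le G r c N v : 0 < r -> pseries_on G r c N -> inbox r v -> `|G v| <= N.
Proof.
move=> r0 [cN h] vr; apply: has_sum_le cN (h v vr) => al.
by rewrite normrM ler_wpM2l // mon_le.
Qed.

Lemma pseries_shrink G r r' c N : 0 < r' <= r -> pseries_on G r c N ->
  exists2 N', N' <= N & pseries_on G r' c N'.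
Proof.
case/andP=> r0 rr [cN h].
have [|N' N'N nN'] := nsum_le (p := fun al => `|c al| * r' ^+ mdeg al) _ cN.
  move=> al; rewrite mulr_ge0 ?exprn_ge0 ?(ltW r0) //=.
  by rewrite ler_wpM2l // lerXn2r // nnegrE ltW // (lt_le_trans r0).
by exists N' => //; split=> // v vr; apply: h; exact: inbox_le vr.
Qed.

Lemma pseries_eq G G' r c N : (forall v, inbox r v -> G v = G' v) ->
  pseries_on G r c N -> pseries_on G' r c N.
Proof. by move=> e [cN h]; split=> // v vr; rewrite -e //; exact: h. Qed.

Lemma germ_eq G G' r : 0 < r -> (forall v, inbox r v -> G v = G' v) -> germ G -> germ G'.
Proof.
move=> r0 e [r1 [c [N [r10 h]]]].
have m0 : 0 < Num.min r r1 by rewrite lt_min r0.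
have [|N' _ h'] := @pseries_shrink _ _ (Num.min r r1) _ _ _ h.
  by rewrite m0 ge_min lexx orbT.
exists (Num.min r r1), c, N'; split=> //; apply: pseries_eq h' => v vr.
by apply: e; apply: inbox_le vr; rewrite ge_min lexx.
Qed.

(* A series indexed by an arbitrary set can be regrouped by monomials. *)
Lemma pseries_group (I : choiceType) (a : I -> R) (m : I -> T) G r N : 0 < r ->
  nsum (fun i => `|a i| * r ^+ mdeg (m i)) N ->
  (forall v, inbox r v -> has_sum (fun i => a i * mon v (m i)) (G v)) -> germ G.
Proof.
move=> r0 aN h.
have rn al : 0 < r ^+ mdeg al by rewrite exprn_gt0.
have fC al : exists C, nsum (fun i => if m i == al then `|a i| else 0) C.
  have [C hC] := nsum_fiber m al aN.
  exists ((r ^+ mdeg al)^-1 * C).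
  have := nsumZ (ltW (_ : 0 < (r ^+ mdeg al)^-1)) hC.
  rewrite invr_gt0 => /(_ (rn _)); apply: eq_nsum => i.
  case: eqP => [->|_]; last by rewrite mulr0.
  by rewrite mulrCA mulVf ?mulr1 // gt_eqF.
have [C hC] := choice fC.
have fc al : exists c, `|c| <= C al /\ has_sum (fun i => if m i == al then a i else 0) c.
  have [|c cC hc] := @has_sum_abs _ _ (fun i => if m i == al then a i else 0) (C al).
    by apply: eq_nsum (hC al) => i; case: ifP; rewrite ?normr0.
  by exists c.
have [c hc] := choice fc.
have CN : nsum (fun al => C al * r ^+ mdeg al) N.
  apply: (nsum_group aN (m := m)) => al.
  rewrite mulrC; have := nsumZ (ltW (rn al)) (hC al); apply: eq_nsum => i.
  by case: eqP => [->|_]; rewrite ?mulr0 // mulrC.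
have [|N' _ cN] := nsum_le (p := fun al => `|c al| * r ^+ mdeg al) _ CN.
  move=> al; rewrite mulr_ge0 ?(ltW (rn _)) //= ler_wpM2r ?(ltW (rn _)) //.
  by case: (hc al).
exists r, c, N'; split=> //; split=> // v vr.
have hg al : has_sum (fun i => if m i == al then a i * mon v (m i) else 0) (c al * mon v al).
  rewrite mulrC; have := has_sumZ (mon v al) (proj2 (hc al)); apply: eq_has_sum => i.
  by case: eqP => [->|_]; rewrite ?mulr0 // mulrC.
exact: has_sum_group (h v vr) hg.
Qed.

Lemma germ_cst k : germ (fun=> k).
Proof.
apply: (@pseries_group unit (fun=> k) (fun=> mzero) _ 1 `|k|) => // [|v _].
  by apply: eq_nsum (nsum1 tt (normr_ge0 k)) => -[]; rewrite eqxx expr1n mulr1.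
by apply: eq_has_sum (has_sum1 tt k) => -[]; rewrite eqxx mon0 mulr1.
Qed.

Lemma germ_coord k : germ (fun v => v k).
Proof.
pose m : T := [ffun i => nat_of_bool (i == k)].
have monm v : mon v m = v k.
  rewrite /mon (bigD1 k) //= big1 ?mulr1 ?ffunE ?eqxx // => i ik.
  by rewrite ffunE (negPf ik).
apply: (@pseries_group unit (fun=> 1) (fun=> m) _ 1 1) => // [|v _].
  by apply: eq_nsum (nsum1 tt ler01) => -[]; rewrite eqxx normr1 expr1n mulr1.
by apply: eq_has_sum (has_sum1 tt (v k)) => -[]; rewrite eqxx monm mul1r.
Qed.

Lemma germ_common G G' : germ G -> germ G' ->
  exists r c N c' N', [/\ 0 < r, pseries_on G r c N & pseries_on G' r c' N'].
Proof.
move=> [r [c [N [r0 h]]]] [r' [c' [N' [r'0 h']]]].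
have m0 : 0 < Num.min r r' by rewrite lt_min r0.
have [|N1 _ h1] := @pseries_shrink _ _ (Num.min r r') _ _ _ h.
  by rewrite m0 ge_min lexx.
have [|N2 _ h2] := @pseries_shrink _ _ (Num.min r r') _ _ _ h'.
  by rewrite m0 ge_min lexx orbT.
by exists (Num.min r r'), c, N1, c', N2.
Qed.

Lemma germD G G' : germ G -> germ G' -> germ (fun v => G v + G' v).
Proof.
move=> /germ_common h /h [r [c [N [c' [N' [r0 [cN h1] [cN' h2]]]]]]].
apply: (@pseries_group (T + T)%type
  (fun k => match k with inl i => c i | inr i => c' i end)
  (fun k => match k with inl i => i | inr i => i end) _ r (N + N')) => // [|v vr].
  by apply: nsum_sumtype; [exact: eq_nsum cN|exact: eq_nsum cN'].
by apply: has_sum_sumtype; [exact: eq_has_sum (h1 v vr)|exact: eq_has_sum (h2 v vr)].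
Qed.

Lemma germM G G' : germ G -> germ G' -> germ (fun v => G v * G' v).
Proof.
move=> /germ_common h /h [r [c [N [c' [N' [r0 [cN h1] [cN' h2]]]]]]].
apply: (@pseries_group (T * T)%type (fun k => c k.1 * c' k.2)
  (fun k => maddn k.1 k.2) _ r (N * N')) => // [|v vr].
  apply: eq_nsum (nsum_prod cN cN') => k /=.
  by rewrite mdegD exprD normrM mulrACA.
apply: eq_has_sum (has_sum_prod (h1 v vr) (h2 v vr)) => k /=.
by rewrite monD mulrACA.
Qed.

Lemma germ_scale k G : germ G -> germ (fun v => k * G v).
Proof. exact/germM/germ_cst. Qed.

Lemma pseries_at0 G r c N : 0 < r -> pseries_on G r c N -> c mzero = G (fun=> 0).
Proof.
move=> r0 [_ /(_ _ (inbox0 r0)) h]; apply: has_sum_uniq h.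
apply: eq_has_sum (has_sum1 mzero (c mzero)) => al; case: eqP => [->|/eqP al0].
  by rewrite mon0 mulr1.
have /existsP[k ak] : [exists k, (0 < al k)%N].
  apply: contraR al0 => /existsPn h; apply/eqP/ffunP => k.
  by rewrite ffunE; apply/eqP; move: (h k); rewrite -eqn0Ngt.
by rewrite /mon (bigD1 k) //= expr0n gtn_eqF // mul0r mulr0.
Qed.

Lemma germ_small G e : germ G -> G (fun=> 0) = 0 -> 0 < e ->
  exists r c N, [/\ 0 < r, N <= e & pseries_on G r c N].
Proof.
move=> [r [c [N [r0 h]]]] G0 e0.
have c0 : c mzero = 0 by rewrite (pseries_at0 r0 h).
have N0 : 0 <= N by apply: nsum_ge0; case: h => cN _; exact: cN.
(* All monomials that occur have degree at least 1, so shrinking the radius by [l] shrinks the norm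
   at least by the factor [l]. The [+ 1] avoids a division by 0. *)
pose l := Num.min 1 (e / (N + 1)).
have l0 : 0 < l by rewrite lt_min ltr01 divr_gt0 // ltr_wpDl.
have l1 : l <= 1 by rewrite ge_min lexx.
have lr : 0 < l * r <= r by rewrite mulr_gt0 //= ger_pMl.
have [|N' N'N hN'] := nsum_le (p := fun al => `|c al| * (l * r) ^+ mdeg al) _
    (nsumZ (ltW l0) (proj1 h)).
  move=> al; case/andP: lr => lr0 _; rewrite mulr_ge0 ?exprn_ge0 ?(ltW lr0) //=.
  have [->|al0] := eqVneq al mzero; first by rewrite c0 normr0 !mul0r mulr0.
  rewrite exprMn mulrCA ler_wpM2r ?mulr_ge0 ?exprn_ge0 ?(ltW r0) //.
  by rewrite -[leRHS]expr1 ler_wiXn2l ?(ltW l0) // mdeg_gt0.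
exists (l * r), c, N'; split; first by case/andP: lr.
  apply: le_trans N'N _; apply: (@le_trans _ _ (e / (N + 1) * N)).
    by rewrite ler_wpM2r // ge_min lexx orbT.
  by rewrite mulrAC ler_pdivrMr ?ltr_wpDl // ler_wpM2l ?(ltW e0) // lerDl.
split=> // v vr; apply: (proj2 h); apply: inbox_le vr; by case/andP: lr.
Qed.

Lemma germ_continuous0 G e : germ G -> 0 < e ->
  exists2 r, 0 < r & forall v, inbox r v -> `|G v - G (fun=> 0)| <= e.
Proof.
move=> pG e0.
have [||r [c [N [r0 Ne h]]]] := @germ_small (fun v => G v + - G (fun=> 0)) e _ _ e0.
- by apply: germD => //; exact: germ_cst.
- by rewrite subrr.
by exists r => // v vr; apply: le_trans Ne; exact: pseries_le h vr.
Qed.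

Section QuadraticFixpoint.
Variables (u p q : (A -> R) -> R) (cu cp cq : T -> R) (r U P Q W : R).
Hypotheses (r0 : 0 < r) (hu : pseries_on u r cu U) (hp : pseries_on p r cp P)
  (hq : pseries_on q r cq Q) (W0 : 0 <= W) (small : U + P * W + Q * W ^+ 2 <= W).

Fixpoint qcoef (t : qtree T) : R :=
  match t with
  | QLeaf i => cu i
  | QUn i s => cp i * qcoef s
  | QBin i s1 s2 => cq i * (qcoef s1 * qcoef s2)
  end.

Fixpoint qmon (t : qtree T) : T :=
  match t with
  | QLeaf i => i
  | QUn i s => maddn i (qmon s)
  | QBin i s1 s2 => maddn i (maddn (qmon s1) (qmon s2))
  end.

Fixpoint qdepth (t : qtree T) : nat :=
  match t with
  | QLeaf i => 0
  | QUn i s => (qdepth s).+1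
  | QBin i s1 s2 => (maxn (qdepth s1) (qdepth s2)).+1
  end.

Let node : Type := (T + (T * qtree T + T * (qtree T * qtree T)))%type.

Let split (t : qtree T) : node :=
  match t with
  | QLeaf i => inl i
  | QUn i s => inr (inl (i, s))
  | QBin i s1 s2 => inr (inr (i, (s1, s2)))
  end.

Let join (x : node) : qtree T :=
  match x with
  | inl i => QLeaf i
  | inr (inl (i, s)) => QUn i s
  | inr (inr (i, (s1, s2))) => QBin i s1 s2
  end.

Let split_bij : bijective split.
Proof. by exists join => [[]|[|[[]|[i []]]]]. Qed.

Let wt (t : qtree T) : R := `|qcoef t| * r ^+ mdeg (qmon t).

Let wt_ge0 t : 0 <= wt t.
Proof. by rewrite mulr_ge0 ?exprn_ge0 ?(ltW r0). Qed.

(** Splitting off the root, the weight of the trees of depth below [K.+1] is exactly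
    [U + P * w + Q * w ^+ 2], where [w] is the weight for [K]. The hypothesis [small] says that this
    recursion, started at 0, never passes [W]. *)
Let wt_depth K : exists2 w, w <= W &
  nsum (fun t => if (qdepth t < K)%N then wt t else 0) w.
Proof.
elim: K => [|K [w wW hw]].
  by exists 0 => //; apply: eq_nsum (nsum0 _ _) => t; rewrite ltn0.
have w0 := nsum_ge0 hw.
have [U0 P0 Q0] : [/\ 0 <= U, 0 <= P & 0 <= Q].
  by split; [exact: nsum_ge0 (proj1 hu)|exact: nsum_ge0 (proj1 hp)
            |exact: nsum_ge0 (proj1 hq)].
pose F (x : node) := let t := join x in if (qdepth t < K.+1)%N then wt t else 0.
have hF : nsum F (U + (P * w + Q * (w * w))).
  apply: nsum_sumtype; first by apply: eq_nsum (proj1 hu) => i.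
  apply: nsum_sumtype.
    apply: eq_nsum (nsum_prod (proj1 hp) hw) => -[i s]; rewrite /F /= ltnS.
    case: ifP; rewrite ?mulr0 // /wt /= mdegD exprD normrM => _; exact: mulrACA.
  apply: eq_nsum (nsum_prod (proj1 hq) (nsum_prod hw hw)) => -[i [s1 s2]].
  rewrite /F /= ltnS gtn_max.
  case: ifP => _; last by rewrite mul0r mulr0.
  case: ifP => _; last by rewrite !mulr0.
  by rewrite /wt /= !mdegD !exprD !normrM; ring.
exists (U + (P * w + Q * (w * w))).
  apply: le_trans small; rewrite addrA lerD // ?lerD // ?ler_wpM2l //.
  by rewrite -expr2 lerXn2r // nnegrE.
by apply: eq_nsum (nsum_reindex split_bij hF) => -[].
Qed.

Lemma qtree_sum : exists2 N, N <= W & nsum wt N.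
Proof.
apply: nsum_bound => // J.
(* A finite set of trees has bounded depth, so the bounds by depth control all finite subsums. *)
pose K := (\sum_(t <- J) qdepth t).+1.
have [w wW hw] := wt_depth K.
apply: le_trans wW; apply: le_trans (nsum_ge_fset J hw).
rewrite big_seq [leRHS]big_seq; apply: ler_sum => t tJ.
suff -> : (qdepth t < K)%N by [].
by rewrite ltnS (big_rem t) //= leq_addr.
Qed.

Lemma germ_quadratic_fixpoint : exists w, [/\ germ w,
  forall v, inbox r v -> w v = u v + p v * w v + q v * w v ^+ 2 &
  forall v, inbox r v -> `|w v| <= W].
Proof.
have [N NW hN] := qtree_sum.
pose f v t := qcoef t * mon v (qmon t).
have fle v : inbox r v -> forall t, `|f v t| <= wt t.
  by move=> vr t; rewrite normrM ler_wpM2l // mon_le.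
have ex v : exists s, inbox r v -> has_sum (f v) s.
  have [vr|nvr] := pselect (inbox r v); last by exists 0.
  have [|M _ hM] := nsum_le (p := fun t => `|f v t|) _ hN.
    by move=> t; rewrite normr_ge0 fle.
  by have [s _ sumf] := has_sum_abs hM; exists s.
have [w hw] := choice ex.
exists w; split.
- by apply: (@pseries_group _ qcoef qmon _ r N) => // v vr; exact: hw.
- move=> v vr; have hv := hw v vr; apply: (has_sum_uniq hv).
  have hF : has_sum (f v \o join) (u v + (p v * w v + q v * (w v * w v))).
    apply: has_sum_sumtype; first by apply: eq_has_sum (proj2 hu v vr) => i.
    apply: has_sum_sumtype.
      apply: eq_has_sum (has_sum_prod (proj2 hp v vr) hv) => -[i s] /=.
      by rewrite /f /= monD mulrACA.
    apply: eq_has_sum (has_sum_prod (proj2 hq v vr) (has_sum_prod hv hv)) => -[i [s1 s2]] /=.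
    by rewrite /f /= !monD; ring.
  by rewrite -addrA expr2; apply: eq_has_sum (has_sum_reindex split_bij hF) => -[].
- by move=> v vr; apply: le_trans NW; apply: has_sum_le (fle v vr) hN (hw v vr).
Qed.

End QuadraticFixpoint.

Lemma germ_near1 G e : germ G -> G (fun=> 0) != 0 -> 0 < e ->
  exists r c N, [/\ 0 < r, N <= e &
    pseries_on (fun v => 1 - G v / G (fun=> 0)) r c N].
Proof.
move=> pG G0 e0; apply: germ_small e0; last by rewrite divff ?subrr.
apply: germD; first exact: germ_cst.
under eq_fun do rewrite mulrC -mulNr.
by apply: germ_scale.
Qed.

(* The fixpoint w = g + g w is (1 - g)^-1 - 1. *)
Lemma germV G : germ G -> G (fun=> 0) != 0 -> germ (fun v => (G v)^-1).
Proof.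
move=> pG G0; have e0 : 0 < 4^-1 :> R by lra.
have [r [c [N [r0 Ne h]]]] := germ_near1 pG G0 e0.
have N0 := nsum_ge0 (proj1 h).
have hz : pseries_on (fun=> 0) r (fun=> 0) 0.
  by split=> [|v _]; [apply: eq_nsum (nsum0 _ _) => al; rewrite normr0 mul0r
    |apply: eq_has_sum (has_sum_nsum (nsum0 _ _)) => al; rewrite mul0r].
have [|w [pw ew _]] := @germ_quadratic_fixpoint _ _ _ _ _ _ r N N 0 1 r0 h h hz ler01.
  by rewrite mul0r addr0 mulr1; lra.
apply: (@germ_eq (fun v => (G (fun=> 0))^-1 * (1 + w v)) _ r) => // [v vr|].
  have := ew v vr; set g := G v; set g0 := G _ in G0 *; set x := w v => ex.
  have e1 : g / g0 * (1 + x) = 1.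
    by move: ex; rewrite mul0r addr0; set y := g / g0 => ex; lra.
  have gn : g != 0.
    by apply/eqP => g0'; move: e1; rewrite g0' !mul0r => /esym/eqP; rewrite oner_eq0.
  by apply: (mulfI gn); rewrite divff // mulrA.
by apply: germ_scale; apply: germD => //; exact: germ_cst.
Qed.

(* The small fixpoint of w = g / 2 + w^2 / 2 is 1 - sqrt (1 - g). *)
Lemma germ_sqrt G : germ G -> 0 < G (fun=> 0) -> germ (fun v => Num.sqrt (G v)).
Proof.
move=> pG Gp; have G0 : G (fun=> 0) != 0 by rewrite gt_eqF.
have e0 : 0 < 4^-1 :> R by lra.
have [r [c [N [r0 Ne h]]]] := germ_near1 pG G0 e0.
have N0 := nsum_ge0 (proj1 h).
have half : `|2^-1| = 2^-1 :> R by rewrite ger0_norm // invr_ge0.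
have hu : pseries_on (fun v => 2^-1 * (1 - G v / G (fun=> 0))) r
    (fun al => 2^-1 * c al) (2^-1 * N).
  split=> [|v vr].
    apply: eq_nsum (nsumZ (_ : 0 <= 2^-1 :> R) (proj1 h)); last by lra.
    by move=> al; rewrite normrM half mulrA.
  by apply: eq_has_sum (has_sumZ 2^-1 (proj2 h v vr)) => al; rewrite mulrA.
have hp : pseries_on (fun=> 0) r (fun=> 0) 0.
  by split=> [|v _]; [apply: eq_nsum (nsum0 _ _) => al; rewrite normr0 mul0r
    |apply: eq_has_sum (has_sum_nsum (nsum0 _ _)) => al; rewrite mul0r].
have hq : pseries_on (fun=> 2^-1) r (fun al => if al == mzero then 2^-1 else 0) 2^-1.
  split=> [|v _].
    apply: eq_nsum (nsum1 mzero (_ : 0 <= 2^-1 :> R)); last by lra.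
    by move=> al; case: eqP => [->|_]; rewrite ?normr0 ?mul0r // half mdeg0 mulr1.
  apply: eq_has_sum (has_sum1 mzero 2^-1) => al.
  by case: eqP => [->|_]; rewrite ?mul0r // mon0 mulr1.
have [||w [pw ew lw]] := @germ_quadratic_fixpoint _ _ _ _ _ _ r _ _ _ 2^-1 r0 hu hp hq.
- by lra.
- by rewrite mul0r addr0; nra.
apply: (@germ_eq (fun v => Num.sqrt (G (fun=> 0)) * (1 + (-1) * w v)) _ r) => // [v vr|].
  have := ew v vr; have := lw v vr.
  set g := G v; set g0 := G _ in Gp G0 *; set x := w v => lx ex.
  (* The bound 1/2 on the fixed point selects the nonnegative one of the two square roots. *)
  have x1 : 0 <= 1 + (-1) * x by move: lx; rewrite ler_norml; lra.
  have -> : g = g0 * (1 + (-1) * x) ^+ 2.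
    have : g / g0 = (1 + (-1) * x) ^+ 2.
      by move: ex; rewrite mul0r addr0; set y := g / g0 => ex; nra.
    by move=> <-; rewrite mulrCA divff // mulr1.
  by rewrite sqrtrM ?(ltW Gp) // sqrtr_sqr ger0_norm.
by apply: germ_scale; apply: germD; [exact: germ_cst|exact: germ_scale].
Qed.

End PowerSeries.

(** * Analytic functions *)

Section BoxSums.
Variables (R : realType) (A : finType).
Local Notation T := {ffun A -> nat}.

Definition box_idx (d : nat) (al : {ffun A -> 'I_d}) : T := [ffun k => nat_of_ord (al k)].

Definition box_set (d : nat) : {fset T} := [fset box_idx al | al in {ffun A -> 'I_d}]%fset.

Lemma box_idx_inj d : injective (@box_idx d).
Proof.
move=> al be /ffunP e; apply/ffunP => k; apply: val_inj.
by have := e k; rewrite !ffunE.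
Qed.

Lemma box_sumE d (F : T -> R) :
  \sum_(al : {ffun A -> 'I_d}) F (box_idx al) = \sum_(t <- box_set d) F t.
Proof.
rewrite big_imfset /=; last by move=> x y _ _; exact: box_idx_inj.
by rewrite big_enum_cond.
Qed.

Lemma mem_box_set d (t : T) : (forall k, t k < d)%N -> t \in box_set d.
Proof.
move=> td; apply/imfsetP; exists [ffun k => Ordinal (td k)] => //=.
by apply/ffunP => k; rewrite !ffunE.
Qed.

Lemma fset_sub_box (J : {fset T}) : exists d0, forall d, (d0 <= d)%N -> (J `<=` box_set d)%fset.
Proof.
exists (\sum_(t <- J) \sum_k t k).+1 => d d0d; apply/fsubsetP => t tJ.
apply: mem_box_set => k; apply: leq_trans d0d; rewrite ltnS.
by rewrite (big_rem t) //= (bigD1 k) //= -addnA leq_addr.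
Qed.

(** Boxes are cofinal among the finite sets of multi-indices and partial sums of a nonnegative
    family are monotone, so growing boxes compute the unconditional sum. *)
Lemma nsum_box_cvg (p : T -> R) s : nsum p s ->
  (fun d => \sum_(t <- box_set d) p t) @ \oo --> s.
Proof.
move=> ps; have p0 : forall t, 0 <= p t by case: ps.
apply/cvgrPdist_le => e e0.
have [J hJ] : exists J : {fset T}, s - e <= \sum_(t <- J) p t.
  have [//|nJ] := pselect (exists J : {fset T}, s - e <= \sum_(t <- J) p t).
  have [|s' s's ps'] := @nsum_bound _ _ p (s - e) p0.
    move=> J; have [//|h] := leP (\sum_(t <- J) p t) (s - e).
    by case: nJ; exists J; exact: ltW.
  by move: s's; rewrite (nsum_uniq ps' ps); lra.
have [d0 hd] := fset_sub_box J.
exists d0 => // d /= d0d.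
have le1 := nsum_ge_fset (box_set d) ps.
have le2 : \sum_(t <- J) p t <= \sum_(t <- box_set d) p t.
  have -> : \sum_(t <- J) p t = \sum_(t <- J) (if t \in J then p t else 0).
    by rewrite big_seq [RHS]big_seq; apply: eq_bigr => t ->.
  rewrite (big_fset_incl _ (hd _ d0d)) => [|t _ /negPf -> //].
  by apply: ler_sum => t _; case: ifP.
by rewrite ger0_norm ?subr_ge0 //; lra.
Qed.
End BoxSums.

Section Analytic.
Variables (R : realType) (a b : nat).
Local Notation A := ('I_a * 'I_b)%type.
Local Notation T := {ffun A -> nat}.
Implicit Types (x : 'M[R]_(a, b)) (g : 'M[R]_(a, b) -> R).

Definition shift_by x0 (v : A -> R) : 'M[R]_(a, b) := \matrix_(i, j) (x0 i j + v (i, j)).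
Definition offset x0 x (k : A) : R := x k.1 k.2 - x0 k.1 k.2.

Lemma offsetK x0 x : shift_by x0 (offset x0 x) = x.
Proof. by apply/matrixP => i j; rewrite mxE /offset /= addrC subrK. Qed.

Lemma shift_byK x0 v : offset x0 (shift_by x0 v) = v.
Proof. by apply/funext => -[i j]; rewrite /offset mxE /= addrC addKr. Qed.

Lemma shift_by0 x0 : shift_by x0 (fun=> 0) = x0.
Proof. by apply/matrixP => i j; rewrite mxE addr0. Qed.

Lemma monom_mon x x0 d (al : {ffun A -> 'I_d}) :
  monom x x0 (fun i => nat_of_ord (al i)) = mon (offset x0 x) (box_idx al).
Proof. by apply: eq_bigr => k _; rewrite ffunE. Qed.

Lemma germ_analytic g x0 : germ (fun v => g (shift_by x0 v)) -> analytic_at g x0.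
Proof.
move=> [r [c [N [r0 [cN h]]]]].
exists (fun f => c [ffun k => f k]), r; split=> // x xr.
have vr : inbox r (offset x0 x) by case=> i j; exact: xr.
have hx := h _ vr; rewrite offsetK in hx.
split.
  exists N => d; rewrite /box_pasum.
  under eq_bigr do rewrite monom_mon.
  rewrite (box_sumE _ (fun t => `|c t * mon (offset x0 x) t|)).
  apply: le_trans (nsum_ge_fset (box_set _ d) cN); apply: ler_sum => t _.
  by rewrite normrM ler_wpM2l // mon_le.
have -> : box_psum (fun f => c [ffun k => f k]) x x0 =
    fun d => \sum_(t <- box_set A d) c t * mon (offset x0 x) t.
  apply/funext => d; rewrite -box_sumE; apply: eq_bigr => al _.
  by rewrite monom_mon.
case: hx => p [q [P [Q [pP qQ e ->]]]].
under eq_fun do (under eq_bigr do rewrite e; rewrite sumrB).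
by apply: cvgB; exact: nsum_box_cvg.
Qed.

Lemma analytic_germ g x0 : analytic_at g x0 -> germ (fun v => g (shift_by x0 v)).
Proof.
move=> [cc [r [r0 h]]]; pose c (t : T) := cc t.
have r20 : 0 < r / 2 by lra.
(* The absolute sums at the point with all offsets [r / 2] are partial sums of the weighted norm at
   that radius, so boundedness at this single point gives convergence on a whole box. *)
have [M hM] : exists M : R, forall d, box_pasum cc (shift_by x0 (fun=> r / 2)) x0 d <= M.
  apply: (proj1 (h _ _)) => i j; rewrite mxE [x0 i j + _]addrC addrK ger0_norm; lra.
have [||N NM cN] := @nsum_bound _ _ (fun t => `|c t| * (r / 2) ^+ mdeg t) M.
- by move=> t; rewrite mulr_ge0 ?exprn_ge0 ?(ltW r20).
- move=> J; have [d0 /(_ d0 (leqnn _)) Jd] := fset_sub_box J.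
  apply: le_trans (hM d0); rewrite /box_pasum.
  under [leRHS]eq_bigr do rewrite monom_mon shift_byK mon_const.
  have -> : \sum_(al : {ffun A -> 'I_d0})
      `|cc (fun i => nat_of_ord (al i)) * (r / 2) ^+ mdeg (box_idx al)| =
      \sum_(al : {ffun A -> 'I_d0}) `|c (box_idx al) * (r / 2) ^+ mdeg (box_idx al)|.
    apply: eq_bigr => al _; congr (`|_ * _|); rewrite /c; congr cc.
    by apply/funext => k; rewrite ffunE.
  rewrite (box_sumE _ (fun t => `|c t * (r / 2) ^+ mdeg t|)).
  have e t : `|c t * (r / 2) ^+ mdeg t| = `|c t| * (r / 2) ^+ mdeg t.
    by rewrite normrM [X in _ * X]ger0_norm // exprn_ge0 // ltW.
  under [leRHS]eq_bigr do rewrite e.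
  have -> : \sum_(t <- J) `|c t| * (r / 2) ^+ mdeg t =
      \sum_(t <- J) (if t \in J then `|c t| * (r / 2) ^+ mdeg t else 0).
    by rewrite big_seq [RHS]big_seq; apply: eq_bigr => t ->.
  rewrite (big_fset_incl _ Jd) => [|t _ /negPf -> //].
  apply: ler_sum => t _; case: ifP => // _.
  by rewrite mulr_ge0 ?exprn_ge0 ?(ltW r20).
exists (r / 2), c, N; split=> //; split=> // v vr.
have [|M' _ hv] := nsum_le (p := fun t => `|c t * mon v t|) _ cN.
  by move=> t; rewrite normr_ge0 normrM ler_wpM2l // mon_le.
have [s _ sums] := has_sum_abs hv.
have vr' i j : `|shift_by x0 v i j - x0 i j| < r.
  by rewrite mxE [x0 i j + _]addrC addrK (lt_le_trans (vr _)) //; lra.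
have [_ cvg1] := h _ vr'.
suff cvg2 : box_psum cc (shift_by x0 v) x0 @ \oo --> s.
  by rewrite (cvg_unique _ cvg1 cvg2).
have -> : box_psum cc (shift_by x0 v) x0 =
    fun d => \sum_(t <- box_set A d) c t * mon v t.
  apply/funext => d; rewrite -box_sumE; apply: eq_bigr => al _.
  rewrite monom_mon shift_byK /c; congr (cc _ * _).
  by apply/funext => k; rewrite ffunE.
case: sums => p [q [P [Q [pP qQ e ->]]]].
under eq_fun do (under eq_bigr do rewrite e; rewrite sumrB).
by apply: cvgB; exact: nsum_box_cvg.
Qed.

Lemma analytic_cst k x0 : analytic_at (fun=> k) x0.
Proof. exact/germ_analytic/germ_cst. Qed.

Lemma analytic_coord i j x0 : analytic_at (fun x => x i j) x0.
Proof.
apply: germ_analytic; under eq_fun do rewrite mxE.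
by apply: germD; [exact: germ_cst|exact: germ_coord].
Qed.

Lemma analyticD g h x0 : analytic_at g x0 -> analytic_at h x0 ->
  analytic_at (fun x => g x + h x) x0.
Proof. by move=> /analytic_germ pg /analytic_germ ph; exact/germ_analytic/germD. Qed.

Lemma analyticM g h x0 : analytic_at g x0 -> analytic_at h x0 ->
  analytic_at (fun x => g x * h x) x0.
Proof. by move=> /analytic_germ pg /analytic_germ ph; exact/germ_analytic/germM. Qed.

Lemma analyticV g x0 : analytic_at g x0 -> g x0 != 0 -> analytic_at (fun x => (g x)^-1) x0.
Proof.
by move=> /analytic_germ pg g0; apply/germ_analytic/germV => //; rewrite shift_by0.
Qed.

Lemma analytic_sqrt g x0 : analytic_at g x0 -> 0 < g x0 ->
  analytic_at (fun x => Num.sqrt (g x)) x0.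
Proof.
by move=> /analytic_germ pg g0; apply/germ_analytic/germ_sqrt => //; rewrite shift_by0.
Qed.

Lemma nbhs_box x0 (P : set 'M[R]_(a, b)) :
  (exists2 r, 0 < r & forall x, (forall i j, `|x i j - x0 i j| < r) -> P x) <->
  nbhs x0 P.
Proof.
split=> [[r r0 h]|/nbhs_ballP[r /= r0 h]].
  apply/nbhs_ballP; exists r => // x [_ xr]; apply: h => i j.
  by rewrite distrC; exact: xr.
exists r => // x xr; apply: h; split=> // i j; rewrite /ball /= distrC; exact: xr.
Qed.

Lemma analytic_continuous g x0 : analytic_at g x0 -> {for x0, continuous g}.
Proof.
move=> /analytic_germ pg; apply/(@cvgrPdist_le _ _ _ (nbhs x0)) => e e0.
have [r r0 h] := germ_continuous0 pg e0; rewrite shift_by0 in h.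
apply/nbhs_box; exists r => // x xr; rewrite distrC -(offsetK x0 x).
by apply: h; case=> i j; exact: xr.
Qed.

End Analytic.

Section AnalyticRestrictions.
Variables (R : realType) (a b : nat) (U : set 'M[R]_(a, b)).
Implicit Types (x : 'M[R]_(a, b)) (g h : 'M[R]_(a, b) -> R).

Definition analytic_on g : Prop := exists W h, [/\ open W, U `<=` W,
  forall x, W x -> analytic_at h x & forall x, U x -> g x = h x].

Lemma open_forall (I : finType) (W : I -> set 'M[R]_(a, b)) :
  (forall i, open (W i)) -> open [set x | forall i, W i x].
Proof.
move=> oW; rewrite openE => x /= Wx; rewrite /interior.
apply: (@filter_forall _ _ _ (nbhs x)) => i; exact: open_nbhs_nbhs.
Qed.

Lemma analytic_restrP (c d : nat) (g : 'M[R]_(a, b) -> 'M[R]_(c, d)) :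
  analytic_restr U g <-> forall i j, analytic_on (fun x => g x i j).
Proof.
split=> [[W [h [oW [UW [hW gh]]]]] i j|H].
  by exists W, (fun x => h x i j); split=> [||x Wx|x Ux] //; [exact: hW|rewrite gh].
have /choice[Wh hWh] : forall k : 'I_c * 'I_d,
    exists Wh : set 'M[R]_(a, b) * ('M[R]_(a, b) -> R),
    [/\ open Wh.1, U `<=` Wh.1, forall x, Wh.1 x -> analytic_at Wh.2 x &
      forall x, U x -> g x k.1 k.2 = Wh.2 x].
  by move=> [i j]; have [W [h ?]] := H i j; exists (W, h).
exists [set x | forall k, (Wh k).1 x], (fun x => \matrix_(i, j) (Wh (i, j)).2 x).
split; first by apply: open_forall => k; case: (hWh k).
split; first by move=> x Ux k; case: (hWh k) => _ UW _ _; exact: UW.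
split=> [x Wx i j|x Ux].
  under eq_fun do rewrite mxE.
  by case: (hWh (i, j)) => _ _ h _; apply: h; exact: Wx.
by apply/matrixP => i j; rewrite mxE; case: (hWh (i, j)) => _ _ _ ->.
Qed.

Lemma analytic_on_eq g h : (forall x, U x -> g x = h x) -> analytic_on g -> analytic_on h.
Proof.
move=> e [W [k [oW UW kW gk]]]; exists W, k; split=> // x Ux.
by rewrite -e // gk.
Qed.

Lemma analytic_on_cst k : analytic_on (fun=> k).
Proof. by exists setT, (fun=> k); split=> // [|x _]; [exact: openT|exact: analytic_cst]. Qed.

Lemma analytic_on_coord i j : analytic_on (fun x => x i j).
Proof.
by exists setT, (fun x => x i j); split=> // [|x _]; [exact: openT|exact: analytic_coord].
Qed.

Lemma analytic_onD g h : analytic_on g -> analytic_on h -> analytic_on (fun x => g x + h x).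
Proof.
move=> [W [g' [oW UW aW gW]]] [V [h' [oV UV aV hV]]].
exists (W `&` V), (fun x => g' x + h' x); split.
- exact: openI.
- by move=> x Ux; split; [exact: UW|exact: UV].
- by move=> x [Wx Vx]; apply: analyticD; [exact: aW|exact: aV].
- by move=> x Ux; rewrite gW // hV.
Qed.

Lemma analytic_onM g h : analytic_on g -> analytic_on h -> analytic_on (fun x => g x * h x).
Proof.
move=> [W [g' [oW UW aW gW]]] [V [h' [oV UV aV hV]]].
exists (W `&` V), (fun x => g' x * h' x); split.
- exact: openI.
- by move=> x Ux; split; [exact: UW|exact: UV].
- by move=> x [Wx Vx]; apply: analyticM; [exact: aW|exact: aV].
- by move=> x Ux; rewrite gW // hV.
Qed.

Lemma open_analytic_preimage (W : set 'M[R]_(a, b)) h (V : set R) : open W -> open V ->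
  (forall x, W x -> analytic_at h x) -> open (W `&` h @^-1` V).
Proof.
move=> oW oV aW; rewrite openE => x [Wx Vx]; rewrite /interior.
apply: filterI; first exact: open_nbhs_nbhs.
have /(_ V) := analytic_continuous (aW _ Wx); apply.
exact: open_nbhs_nbhs.
Qed.

Lemma analytic_onV g : analytic_on g -> (forall x, U x -> g x != 0) -> analytic_on (fun x => (g x)^-1).
Proof.
move=> [W [h [oW UW aW gh]]] g0.
exists (W `&` h @^-1` [set y | y != 0]), (fun x => (h x)^-1); split.
- apply: open_analytic_preimage => //; exact: open_neq.
- by move=> x Ux; split; [exact: UW|rewrite /= -gh // g0].
- by move=> x [Wx hx]; apply: analyticV => //; exact: aW.
- by move=> x Ux; rewrite gh.
Qed.

Lemma analytic_on_sqrt g : analytic_on g -> (forall x, U x -> 0 < g x) -> analytic_on (fun x => Num.sqrt (g x)).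
Proof.
move=> [W [h [oW UW aW gh]]] g0.
exists (W `&` h @^-1` [set y | 0 < y]), (fun x => Num.sqrt (h x)); split.
- apply: open_analytic_preimage => //; exact: open_gt.
- by move=> x Ux; split; [exact: UW|rewrite /= -gh // g0].
- by move=> x [Wx hx]; apply: analytic_sqrt => //; exact: aW.
- by move=> x Ux; rewrite gh.
Qed.

(* A locally constant function on an arbitrary subset extends to a locally
   constant function on an open neighbourhood: halve the radii. *)
Lemma analytic_on_locally_constant g :
  (forall x0, U x0 -> exists2 r, 0 < r &
     forall x, U x -> (forall i j, `|x i j - x0 i j| < r) -> g x = g x0) -> analytic_on g.
Proof.
move=> H.
have /choice[r hr] : forall x0, exists r, U x0 -> 0 < r /\
     forall x, U x -> (forall i j, `|x i j - x0 i j| < r) -> g x = g x0.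
  move=> x0.
  have [Ux0|nU] := pselect (U x0); last by exists 0.
  by have [r r0 h] := H _ Ux0; exists r.
pose near x0 x := U x0 /\ forall i j, `|x i j - x0 i j| < r x0 / 2.
have near_eq x x0 x1 : near x0 x -> near x1 x -> g x0 = g x1.
  (* Each centre is within half its radius of [x], so the two centres are within the larger radius
     of each other. *)
  wlog le01 : x0 x1 / r x0 <= r x1 => [hw|] n0 n1.
    by have [h|/ltW h] := leP (r x0) (r x1); [|symmetry]; exact: hw.
  case: n0 n1 => [U0 n0] [U1 n1]; have [_ h1] := hr _ U1.
  apply: h1 => // i j; have := n0 i j; have := n1 i j.
  by rewrite !ltr_norml; lra.
have /choice[h hh] : forall x, exists y, forall x0, near x0 x -> y = g x0.
  move=> x.
  have [[x0 n0]|nn] := pselect (exists x0, near x0 x).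
    by exists (g x0) => x1 n1; exact: near_eq n0 n1.
  by exists 0 => x0 n0; case: nn; exists x0.
have nearU x : U x -> near x x.
  move=> Ux; split=> // i j; rewrite subrr normr0 divr_gt0 //.
  by case: (hr _ Ux).
have near_open x x0 : near x0 x -> exists2 d, 0 < d &
    forall y : 'M[R]_(a, b), (forall i j, `|y i j - x i j| < d) -> near x0 y.
  move=> [U0 n0].
  have : nbhs x [set y : 'M[R]_(a, b) | forall k : 'I_a * 'I_b, `|y k.1 k.2 - x0 k.1 k.2| < r x0 / 2].
    apply: (@filter_forall _ _ _ (nbhs x)) => -[i j] /=.
    apply/nbhs_box; exists (r x0 / 2 - `|x i j - x0 i j|); first by rewrite subr_gt0.
    move=> y /(_ i j) yx /=.
    have -> : y i j - x0 i j = (y i j - x i j) + (x i j - x0 i j) by ring.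
    by apply: le_lt_trans (ler_normD _ _) _; rewrite -ltrBrDr.
  move=> /nbhs_box [d d0 hd]; exists d => // y /hd /= hy.
  by split=> // i j; exact: (hy (i, j)).
exists [set x | exists x0, near x0 x], h; split.
- rewrite openE => x [x0 n0]; apply/nbhs_box.
  by have [d d0 hd] := near_open _ _ n0; exists d => // y /hd n; exists x0.
- by move=> x Ux; exists x; exact: nearU.
- move=> x [x0 n0]; have [d d0 hd] := near_open _ _ n0.
  apply: germ_analytic; apply: (@germ_eq _ _ (fun=> g x0) _ d) => //; last exact: germ_cst.
  move=> v vd; symmetry; apply: hh; apply: hd => i j.
  by rewrite mxE [x i j + _]addrC addrK; exact: vd.
- by move=> x Ux; rewrite (hh x x) //; exact: nearU.
Qed.

End AnalyticRestrictions.

(** * Isomorphisms assembled from finitely many sections *)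

Section IsoFromSections.
Variables (R : realType) (k n e p1 p2 : nat) (U : set 'M[R]_(k, n)).
Variables (sigma : 'M[R]_(k, n) -> 'I_e -> 'M[R]_(p1, p2)) (S : set 'M[R]_(p1, p2)).
Variables (q : 'M[R]_(p1, p2) -> 'M[R]_(k, n)).

Lemma analytic_restr_near (a b c d : nat) (V : set 'M[R]_(a, b))
    (g : 'M[R]_(a, b) -> 'M[R]_(c, d)) x0 eps : analytic_restr V g -> V x0 -> 0 < eps ->
  exists2 r, 0 < r & forall x, V x -> (forall i j, `|x i j - x0 i j| < r) ->
    forall i j, `|g x i j - g x0 i j| < eps.
Proof.
move=> [W [h [oW [VW [aW gh]]]]] V0 eps0.
have /nbhs_box [r r0 hr] : nbhs x0 [set x : 'M[R]_(a, b) | forall ij : 'I_c * 'I_d,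
    `|h x ij.1 ij.2 - h x0 ij.1 ij.2| < eps].
  apply: (@filter_forall _ _ _ (nbhs x0)) => -[i j] /=.
  have := analytic_continuous (aW _ (VW _ V0) i j).
  move=> /(@cvgrPdist_lt _ _ _ (nbhs x0)) /(_ _ eps0); apply: filterS => x /=.
  by rewrite distrC.
exists r => // x Vx /hr /= hx i j; rewrite gh // gh //; exact: (hx (i, j)).
Qed.

(** The first component of the inverse is [q], analytic by hypothesis, so only the index of the
    section through a point of [S] needs an argument. Outside [S] this index takes the default value
    [c0]. *)
Lemma iso_from_sections (c0 : 'I_e) :
  (forall c, analytic_restr U (sigma ^~ c)) ->
  (forall x c, U x -> S (sigma x c)) ->
  analytic_restr S q ->
  (forall x c, U x -> q (sigma x c) = x) ->
  (forall x c c', U x -> sigma x c = sigma x c' -> c = c') ->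
  (forall y, S y -> U (q y) /\ exists c, sigma (q y) c = y) ->
  analytic_iso_prod U sigma S.
Proof.
move=> an_sigma sigmaS an_q qsigma sigma_inj cover.
have /choice[t ht] : forall y, exists c, S y -> sigma (q y) c = y.
  move=> y.
  have [Sy|nS] := pselect (S y); last by exists c0.
  by have [_ [c hc]] := cover _ Sy; exists c.
split=> //; split=> //; exists q, t; split=> //; split; last split.
- apply/analytic_restrP => i j.
  rewrite (ord1 i) (ord1 j); apply: (@analytic_on_eq _ _ _ _ (fun y => (nat_of_ord (t y))%:R)).
    by move=> y _; rewrite mxE eqxx mulr1n.
  apply: analytic_on_locally_constant => y0 S0.
  have [U0 _] := cover _ S0.
  suff : nbhs y0 [set y | forall c, c != t y0 -> S y -> t y != c].
    move=> /nbhs_box [r r0 hr]; exists r => // y Sy /hr /(_ (t y)) h.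
    by congr (_%:R); case: eqP h => [-> //|_] /(_ isT Sy); rewrite eqxx.
  apply: (@filter_forall _ _ _ (nbhs y0)) => c.
  have [cE|ct] := eqVneq c (t y0); first by apply: filterS filterT => y _.
  have [i' [j' dij]] : exists i' j', sigma (q y0) c i' j' != y0 i' j'.
    have [//|nex] := pselect (exists i' j', sigma (q y0) c i' j' != y0 i' j').
    case/eqP: ct; apply: (sigma_inj (q y0)) => //; rewrite ht //.
    apply/matrixP => i' j'.
    by have [//|h] := eqVneq (sigma (q y0) c i' j') (y0 i' j'); case: nex; exists i', j'.
  (* If [y] close to [y0] had index [c], then [y = sigma (q y) c] would be within [eta] of both [y0]
     and [sigma (q y0) c] in this coordinate, while these are [2 * eta] apart. *)
  pose eta := `|sigma (q y0) c i' j' - y0 i' j'| / 2.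
  have eta0 : 0 < eta by rewrite divr_gt0 // normr_gt0 subr_eq0.
  have [d d0 hd] := analytic_restr_near (an_sigma c) U0 eta0.
  have [d' d'0 hd'] := analytic_restr_near an_q S0 d0.
  apply/nbhs_box; exists (Num.min d' eta); first by rewrite lt_min d'0.
  move=> y yy0 _ Sy; apply/eqP => tc; have [Uy _] := cover _ Sy.
  have md : Num.min d' eta <= d' by rewrite ge_min lexx.
  have qd := hd' y Sy (fun i j => lt_le_trans (yy0 i j) md).
  have := hd _ Uy qd i' j'; rewrite -tc ht //.
  have := yy0 i' j'; rewrite lt_min => /andP[_].
  rewrite /eta -tc; set s1 := sigma (q y0) _ _ _; move=> h1 h2.
  have := ler_normD (s1 - y i' j') (y i' j' - y0 i' j').
  have -> : s1 - y i' j' + (y i' j' - y0 i' j') = s1 - y0 i' j' by ring.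
  by move: h1 h2; rewrite (distrC s1 (y i' j')); lra.
- by move=> y Sy; split; [case: (cover _ Sy)|exact: ht].
- move=> x c Ux; split; first exact: qsigma.
  apply: (sigma_inj x) => //.
  by have := ht _ (sigmaS _ c Ux); rewrite qsigma.
Qed.

End IsoFromSections.

(** * Linkages given by unit vectors *)

Section Dot.
Variables (R : realType) (n : nat).
Implicit Types x y z : 'rV[R]_n.

Definition dot x y : R := \sum_j x 0 j * y 0 j.
Definition nsq x : R := dot x x.

Lemma dotC x y : dot x y = dot y x.
Proof. by apply: eq_bigr => j _; rewrite mulrC. Qed.

Lemma dotDl x y z : dot (x + y) z = dot x z + dot y z.
Proof. by rewrite -big_split; apply: eq_bigr => j _; rewrite mxE mulrDl. Qed.

Lemma dotZl k x y : dot (k *: x) y = k * dot x y.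
Proof. by rewrite /dot mulr_sumr; apply: eq_bigr => j _; rewrite mxE mulrA. Qed.

Lemma dotDr x y z : dot z (x + y) = dot z x + dot z y.
Proof. by rewrite ![dot z _]dotC dotDl. Qed.

Lemma dotZr k x y : dot y (k *: x) = k * dot y x.
Proof. by rewrite ![dot y _]dotC dotZl. Qed.

Lemma dotNl x y : dot (- x) y = - dot x y.
Proof. by rewrite -scaleN1r dotZl mulN1r. Qed.

Lemma dotNr x y : dot y (- x) = - dot y x.
Proof. by rewrite ![dot y _]dotC dotNl. Qed.

Lemma dot0l x : dot 0 x = 0.
Proof. by rewrite -(scale0r (0 : 'rV_n)) dotZl mul0r. Qed.

Definition dotE := (dotDl, dotDr, dotNl, dotNr, dotZl, dotZr).

Lemma nsq_ge0 x : 0 <= nsq x.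
Proof. by apply: sumr_ge0 => j _; rewrite -expr2 sqr_ge0. Qed.

Lemma nsq_eq0 x : nsq x = 0 -> x = 0.
Proof.
move=> h; apply/rowP => j; rewrite mxE; apply/eqP.
move/eqP: h; rewrite psumr_eq0 => [/allP /(_ j)|i _]; last by rewrite -expr2 sqr_ge0.
by rewrite mem_index_enum => /(_ isT); rewrite -expr2 sqrf_eq0.
Qed.

Lemma nsqZ k x : nsq (k *: x) = k ^+ 2 * nsq x.
Proof. by rewrite /nsq !dotE mulrA expr2. Qed.

Lemma nsqN x : nsq (- x) = nsq x.
Proof. by rewrite /nsq !dotE opprK. Qed.

Lemma nsqB x y : nsq (x - y) = nsq (y - x).
Proof. by rewrite -nsqN opprB. Qed.

Lemma eucl_norm_nsq x : eucl_norm x = Num.sqrt (nsq x).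
Proof. by congr Num.sqrt; apply: eq_bigr => j _; rewrite expr2. Qed.

Lemma eucl_norm_eq x y : eucl_norm x = eucl_norm y <-> nsq x = nsq y.
Proof.
rewrite !eucl_norm_nsq; split=> [h|->] //.
by rewrite -[LHS]sqr_sqrtr ?nsq_ge0 // h sqr_sqrtr ?nsq_ge0.
Qed.

(** The two lengths determine [dot x u], and then [x - k *: u] has length 0. Two bars thus keep a
    third point on the line of two others, at a prescribed place. *)
Lemma collinear_of_dist k x u :
  nsq x = k ^+ 2 * nsq u -> nsq (x - u) = (k - 1) ^+ 2 * nsq u -> x = k *: u.
Proof.
move=> h1 h2; apply/eqP; rewrite -subr_eq0; apply/eqP/nsq_eq0.
move: h1 h2; rewrite /nsq !dotE (dotC u x); set xu := dot x u; set uu := dot u u.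
by set xx := dot x x => h1 h2; nra.
Qed.

(* Equal lengths of two vectors and of their mean force equality: this is what
   rigidifies a parallelogram. *)
Lemma eq_of_mean d x : nsq x = nsq d -> nsq (2^-1 *: (d + x)) = nsq d -> x = d.
Proof.
move=> h1 h2; apply/eqP; rewrite -subr_eq0; apply/eqP/nsq_eq0.
move: h1 h2; rewrite /nsq !dotE (dotC d x); set xd := dot x d; set dd := dot d d.
by set xx := dot x x => h1 h2; lra.
Qed.

End Dot.

Section Forms.
Variables (R : realType) (n : nat) (J : finType).
Local Notation form := {ffun J -> R}.
Implicit Types (w : J -> 'rV[R]_n) (a b d g p : form).

Definition ev w a : 'rV[R]_n := \sum_j a j *: w j.
Definition delta j : form := [ffun i => (i == j)%:R].

Lemma evD w a b : ev w (a + b) = ev w a + ev w b.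
Proof. by rewrite -big_split; apply: eq_bigr => j _; rewrite !ffunE scalerDl. Qed.

Lemma evZ w k a : ev w (k *: a) = k *: ev w a.
Proof. by rewrite /ev scaler_sumr; apply: eq_bigr => j _; rewrite !ffunE scalerA. Qed.

Lemma evN w a : ev w (- a) = - ev w a.
Proof. by rewrite -scaleN1r evZ scaleN1r. Qed.

Lemma ev0 w : ev w 0 = 0.
Proof. by rewrite -(scale0r (0 : form)) evZ scale0r. Qed.

Lemma ev_delta w j : ev w (delta j) = w j.
Proof.
rewrite /ev (bigD1 j) //= big1 ?addr0 ?ffunE ?eqxx ?scale1r // => i ij.
by rewrite ffunE (negPf ij) scale0r.
Qed.

Lemma ev_sum (I : Type) (s : seq I) (P : pred I) (F : I -> form) w :
  ev w (\sum_(i <- s | P i) F i) = \sum_(i <- s | P i) ev w (F i).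
Proof. exact: (big_morph (ev w) (evD w) (ev0 w)). Qed.

Definition evE := (evD, evN, evZ, ev_delta, ev0).

Lemma form_delta a : a = \sum_j a j *: delta j.
Proof.
apply/ffunP => i; rewrite sum_ffunE (bigD1 i) //= big1 ?addr0 => [|j ji].
  by rewrite !ffunE eqxx [RHS]mulr1.
by rewrite !ffunE eq_sym (negPf ji) [LHS]mulr0.
Qed.

Variable w0 : J -> 'rV[R]_n.
Implicit Types (Omega : set (J -> 'rV[R]_n)) (V : seq form) (E : seq (form * form))
  (F : seq form) (phi : form -> 'rV[R]_n).

Definition keeps E phi := forall e, e \in E ->
  nsq (phi e.1 - phi e.2) = nsq (ev w0 e.1 - ev w0 e.2).

(* Vertices are named by the linear forms giving their positions; the edges in
   [E], with their lengths at [w0], and the fixed vertices in [F] pin the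
   configurations on [V] to be the evaluations at the points of [Omega]. *)
Definition rigged Omega V := exists E F, [/\
  forall e, e \in E -> [/\ e.1 \in V, e.2 \in V & nsq (ev w0 e.1 - ev w0 e.2) != 0],
  {subset F <= V},
  forall w, Omega w -> keeps E (ev w) /\ forall a, a \in F -> ev w a = ev w0 a &
  forall phi, keeps E phi -> (forall a, a \in F -> phi a = ev w0 a) ->
    exists2 w, Omega w & forall a, a \in V -> phi a = ev w a].

Definition const_len Omega a := nsq (ev w0 a) != 0 /\
  forall w, Omega w -> nsq (ev w a) = nsq (ev w0 a).

(** The new bars only position new vertices and leave [Omega] unchanged, so gadgets can be added one
    after the other. *)
Lemma rigged_extend Omega V V' E : rigged Omega V -> {subset V <= V'} ->
  (forall e, e \in E -> [/\ e.1 \in V', e.2 \in V' & nsq (ev w0 e.1 - ev w0 e.2) != 0]) ->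
  (forall w, Omega w -> keeps E (ev w)) ->
  (forall w phi, Omega w -> (forall a, a \in V -> phi a = ev w a) -> keeps E phi ->
    forall a, a \in V' -> phi a = ev w a) -> rigged Omega V'.
Proof.
move=> [E0 [F0 [h1 h2 h3 h4]]] VV' hE hw hphi; exists (E0 ++ E), F0; split.
- move=> e; rewrite mem_cat => /orP[/h1[e1 e2 e3]|/hE //].
  by split=> //; exact: VV'.
- by move=> a /h2 /VV'.
- move=> w Ow; have [k0 f0] := h3 _ Ow; split=> // e.
  by rewrite mem_cat => /orP[/k0 //|]; exact: hw.
- move=> phi kphi fphi; have [|w Ow hV] := h4 phi _ fphi.
    by move=> e eE; apply: kphi; rewrite mem_cat eE.
  exists w => //; apply: hphi => // e eE.
  by apply: kphi; rewrite mem_cat eE orbT.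
Qed.

Definition riggable Omega V a := exists V', [/\ {subset V <= V'}, rigged Omega V' & a \in V'].

Lemma rig_scale Omega V p a k : rigged Omega V -> p \in V -> p + a \in V ->
  const_len Omega a -> riggable Omega V (p + k *: a).
Proof.
move=> rV pV paV [a0 ca].
(* For [k] equal to 0 or 1 the vertex is already present, and one of the two bars would have length
   0. *)
have [->|k0] := eqVneq k 0; first by exists V; rewrite scale0r addr0; split.
have [->|k1] := eqVneq k 1; first by exists V; rewrite scale1r; split.
have e1 w : ev w (p + k *: a) - ev w p = k *: ev w a by rewrite !evE addrC addKr.
have e2 w : ev w (p + k *: a) - ev w (p + a) = (k - 1) *: ev w a.
  by rewrite !evE [ev w p + k *: _]addrC addrKA scalerBl scale1r.
have sub : {subset V <= p + k *: a :: V} by move=> b bV; rewrite inE bV orbT.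
exists (p + k *: a :: V); split=> //; last exact: mem_head.
apply: (@rigged_extend _ V _ [:: (p + k *: a, p); (p + k *: a, p + a)]) => //.
- move=> e; rewrite !inE => /orP[]/eqP-> /=; rewrite ?eqxx ?pV ?paV ?orbT; split=> //.
    by rewrite e1 nsqZ mulf_neq0 // sqrf_eq0.
  by rewrite e2 nsqZ mulf_neq0 // sqrf_eq0 subr_eq0.
- move=> w Ow e; rewrite !inE => /orP[]/eqP-> /=; first by rewrite !e1 !nsqZ ca.
  by rewrite !e2 !nsqZ ca.
- move=> w phi Ow phiV kphi b; rewrite inE => /orP[/eqP->|]; last exact: phiV.
  have := kphi _ (mem_head _ _); have := kphi (p + k *: a, p + a).
  rewrite !inE eqxx orbT => /(_ isT) /=; rewrite e1 e2 !nsqZ -(ca w) //.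
  rewrite (phiV _ pV) (phiV _ paV) => h2 h1.
  apply/eqP; rewrite -subr_eq0; apply/eqP.
  have -> : phi (p + k *: a) - ev w (p + k *: a) = phi (p + k *: a) - ev w p - k *: ev w a.
    by rewrite !evE opprD addrA.
  rewrite (collinear_of_dist h1) ?subrr // -h2; congr nsq.
  by rewrite !evE opprD addrA.
Qed.

Lemma rig_parallelogram Omega V p d g : rigged Omega V ->
  p \in V -> p + d \in V -> p + g \in V ->
  const_len Omega d -> const_len Omega g -> riggable Omega V (p + d + g).
Proof.
move=> rV pV pdV pgV cd cg.
have [V1 [VV1 rV1 mV1]] := rig_scale 2^-1 rV pV pgV cg.
case: cd cg => [d0 cd] [g0 cg].
set m := p + 2^-1 *: g in mV1; set b' := p + d + g; set m' := p + d + 2^-1 *: g.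
have h4 : 2^-1 ^+ 2 != 0 :> R by rewrite sqrf_eq0 invr_eq0 pnatr_eq0.
have e1 w : ev w b' - ev w (p + g) = ev w d.
  by rewrite /b' !evE; apply/rowP => j; rewrite !mxE; ring.
have e2 w : ev w b' - ev w (p + d) = ev w g.
  by rewrite /b' !evE; apply/rowP => j; rewrite !mxE; ring.
have e3 w : ev w m' - ev w (p + d) = 2^-1 *: ev w g.
  by rewrite /m' !evE; apply/rowP => j; rewrite !mxE; ring.
have e4 w : ev w b' - ev w m' = 2^-1 *: ev w g.
  by rewrite /b' /m' !evE; apply/rowP => j; rewrite !mxE; lra.
have e5 w : ev w m' - ev w m = ev w d.
  by rewrite /m' /m !evE; apply/rowP => j; rewrite !mxE; ring.
have pV1 := VV1 _ pV; have pdV1 := VV1 _ pdV; have pgV1 := VV1 _ pgV.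
have sub : {subset V1 <= b' :: m' :: V1} by move=> b bV; rewrite !inE bV !orbT.
exists (b' :: m' :: V1); split; [by move=> b /VV1 /sub| |exact: mem_head].
apply: (@rigged_extend _ V1 _
  [:: (b', p + g); (b', p + d); (m', p + d); (b', m'); (m', m)]) => //.
- move=> e; rewrite !inE => /or4P[| | |/orP[]] /eqP -> /=;
    rewrite ?e1 ?e2 ?e3 ?e4 ?e5 ?nsqZ ?inE ?eqxx ?pgV1 ?pdV1 ?mV1 ?orbT //;
    by split=> //; rewrite mulf_neq0.
- move=> w Ow e; rewrite !inE => /or4P[| | |/orP[]] /eqP -> /=;
    by rewrite ?e1 ?e2 ?e3 ?e4 ?e5 ?nsqZ ?cd ?cg.
- move=> w phi Ow phiV kphi.
  have k1 := kphi (b', p + g); have k2 := kphi (b', p + d).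
  have k3 := kphi (m', p + d); have k4 := kphi (b', m'); have k5 := kphi (m', m).
  move: k1 k2 k3 k4 k5; rewrite !inE !eqxx ?orbT /= => /(_ isT) k1 /(_ isT) k2.
  move=> /(_ isT) k3 /(_ isT) k4 /(_ isT) k5.
  rewrite e1 -(cd w) // (phiV _ pgV1) in k1; rewrite e2 -(cg w) // (phiV _ pdV1) in k2.
  rewrite e3 nsqZ -(cg w) // (phiV _ pdV1) in k3; rewrite e4 nsqZ -(cg w) // in k4.
  rewrite e5 -(cd w) // (phiV _ mV1) in k5.
  (* Wherever [b'] is, its bars force [m'] to be the midpoint of the side from [p + d] to [b']. *)
  have mE : phi m' = ev w (p + d) + 2^-1 *: (phi b' - ev w (p + d)).
    apply/eqP; rewrite addrC -subr_eq; apply/eqP.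
    apply: collinear_of_dist; first by rewrite k3 k2.
    have -> : phi m' - ev w (p + d) - (phi b' - ev w (p + d)) = phi m' - phi b'.
      by apply/rowP => j; rewrite !mxE; ring.
    by rewrite nsqB k4 k2 (_ : (2^-1 - 1) ^+ 2 = 2^-1 ^+ 2 :> R) //; lra.
  (* The bar between the midpoints gives the mean of [d] and of the opposite side the length of [d];
     this excludes the folded antiparallelogram. *)
  have bE : phi b' - ev w (p + g) = ev w d.
    apply: eq_of_mean => //; rewrite -k5; congr nsq; rewrite mE /m !evE.
    apply/rowP => j; rewrite !mxE; lra.
  have bE' : phi b' = ev w b'.
    by apply/eqP; rewrite -subr_eq0 -(subrr (ev w d)) -{1}bE -(e1 w) opprB addrA addrNK.
  move=> b; rewrite !inE => /or3P[/eqP ->|/eqP->|] //; last exact: phiV.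
  by rewrite mE bE' e2 /m' [in RHS]evD evZ.
Qed.

(** The vector [g] is carried from [p] along the path [s] by one rigid parallelogram per step. *)
Lemma rig_transport Omega g (s : seq form) p V : rigged Omega V ->
  (forall k, p + \sum_(d <- take k s) d \in V) -> (forall d, d \in s -> const_len Omega d) ->
  const_len Omega g -> p + g \in V -> riggable Omega V (p + \sum_(d <- s) d + g).
Proof.
elim: s p V => [|d s IH] p V rV hV cs cg pgV.
  by exists V; rewrite big_nil addr0; split.
have pV : p \in V by have := hV 0%N; rewrite take0 big_nil addr0.
have pdV : p + d \in V by have := hV 1%N; rewrite /= take0 big_seq1.
have [V1 [VV1 rV1 h1]] := rig_parallelogram rV pV pdV pgV (cs _ (mem_head _ _)) cg.
have [||V2 [VV2 rV2 h2]] := IH (p + d) V1 rV1 _ _ cg h1.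
- by move=> k; apply: VV1; have := hV k.+1; rewrite /= big_cons addrA.
- by move=> d' d's; apply: cs; rewrite inE d's orbT.
exists V2; split=> //; first by move=> b /VV1 /VV2.
by rewrite big_cons addrA.
Qed.

Section Building.
Variable (Omega : set (J -> 'rV[R]_n)).
Hypothesis unit_delta : forall j, const_len Omega (delta j).

(** The last summand is built at the origin as a multiple of a unit vector and then transported
    along the partial sums of the others, which is why all partial sums are kept as vertices. Zero
    coefficients would give bars of length 0. *)
Lemma rig_chain (s : seq (R * J)) V : rigged Omega V ->
  0 \in V -> (forall j, delta j \in V) -> (forall x, x \in s -> x.1 != 0) ->
  exists V', [/\ {subset V <= V'}, rigged Omega V' &
    forall k, \sum_(x <- take k s) x.1 *: delta x.2 \in V'].
Proof.
elim/last_ind: s V => [|s x IH] V rV V0 Vd s0; first by exists V; split=> // k; rewrite big_nil.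
have [|V1 [VV1 rV1 h1]] := IH V rV V0 Vd.
  by move=> y ys; apply: s0; rewrite mem_rcons inE ys orbT.
have x0 : x.1 != 0 by apply: s0; rewrite mem_rcons mem_head.
have cl y : y.1 != 0 -> const_len Omega (y.1 *: delta y.2).
  move=> y0; have [d0 cd] := unit_delta y.2; split=> [|w Ow].
    by rewrite evZ nsqZ mulf_neq0 // sqrf_eq0.
  by rewrite !evZ !nsqZ cd.
have [|V2 [VV2 rV2 h2]] := @rig_scale Omega V1 0 (delta x.2) x.1 rV1 (VV1 _ V0) _ (unit_delta _).
  by rewrite add0r; apply: VV1.
have [||||V3 [VV3 rV3 h3]] := @rig_transport Omega (x.1 *: delta x.2)
    [seq y.1 *: delta y.2 | y <- s] 0 V2 rV2.
- by move=> k; rewrite add0r -map_take big_map; apply: VV2.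
- move=> d /mapP[y ys ->]; apply: cl; apply: s0.
  by rewrite mem_rcons inE ys orbT.
- exact: cl.
- exact: h2.
exists V3; split=> //; first by move=> b /VV1 /VV2 /VV3.
move=> k; have [ks|ks] := leqP k (size s).
  rewrite -cats1 takel_cat //; exact/VV3/VV2.
rewrite take_oversize ?size_rcons // -cats1 big_cat big_seq1 /=.
by move: h3; rewrite add0r big_map.
Qed.

Lemma rig_form a V : rigged Omega V -> 0 \in V -> (forall j, delta j \in V) ->
  riggable Omega V a.
Proof.
move=> rV V0 Vd; pose s := [seq (a j, j) | j <- enum J & a j != 0].
have [|V' [VV' rV' h]] := @rig_chain s V rV V0 Vd.
  by move=> x /mapP[j]; rewrite mem_filter => /andP[aj _] ->.
exists V'; split=> //; have := h (size s); rewrite take_size big_map big_filter /=.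
suff -> : \sum_(j <- enum J | a j != 0) a j *: delta j = a by [].
rewrite [RHS]form_delta big_enum_cond /= [RHS](bigID (fun j => a j != 0)) /=.
by rewrite [X in _ + X]big1 ?addr0 // => j /negPn /eqP ->; rewrite scale0r.
Qed.

Lemma rig_forms (s : seq form) V : rigged Omega V -> 0 \in V -> (forall j, delta j \in V) ->
  exists V', [/\ {subset V <= V'}, rigged Omega V' & {subset s <= V'}].
Proof.
move=> rV V0 Vd; elim: s => [|a s [V1 [VV1 rV1 sV1]]]; first by exists V; split.
have [|j|V2 [VV2 rV2 aV2]] := @rig_form a V1 rV1.
- exact: VV1.
- exact: VV1.
exists V2; split=> //; first by move=> b /VV1 /VV2.
by move=> b; rewrite inE => /orP[/eqP->|/sV1 /VV2].
Qed.

End Building.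

(* A form is forced to vanish by joining it with unit bars to a unit vector and to its opposite. *)
Lemma rig_relation Omega V a u : Omega w0 -> rigged Omega V -> a \in V -> u \in V -> - u \in V ->
  ev w0 a = 0 -> (forall w, Omega w -> nsq (ev w u) = 1) ->
  rigged [set w | Omega w /\ ev w a = 0] V.
Proof.
move=> O0 [E [F [h1 h2 h3 h4]]] aV uV NuV a0 u1.
exists ((a, u) :: (a, - u) :: E), F; split=> //.
- move=> e; rewrite !inE => /or3P[/eqP->|/eqP->|/h1 //] /=; split=> //.
    by rewrite a0 add0r nsqN u1 // oner_neq0.
  by rewrite a0 evN add0r opprK u1 // oner_neq0.
- move=> w [Ow aw]; have [k f] := h3 _ Ow; split=> // e.
  rewrite !inE => /or3P[/eqP->|/eqP->|/k //] /=; rewrite aw a0 ?evN !add0r ?opprK ?nsqN !u1 //.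
- move=> phi kphi fphi; have [||w Ow hw] := h4 phi.
  + by move=> e eE; apply: kphi; rewrite !inE eE !orbT.
  + exact: fphi.
  exists w => //; split=> //; rewrite -hw //; apply: nsq_eq0.
  (* By the parallelogram law, adding the two equations gives 2 |phi a|^2 + 2 = 2. *)
  have := kphi (a, u); have := kphi (a, - u); rewrite !inE !eqxx !orbT /=.
  move=> /(_ isT) k1 /(_ isT) k2; move: k1 k2 (u1 w Ow).
  rewrite a0 !hw // !evN !add0r !opprK nsqN (u1 w0) // /nsq !dotE.
  rewrite (dotC (ev w u)); lra.
Qed.

Lemma rig_relations Omega V (s : seq form) u : Omega w0 -> rigged Omega V ->
  {subset s <= V} -> u \in V -> - u \in V ->
  (forall a, a \in s -> ev w0 a = 0) -> (forall w, Omega w -> nsq (ev w u) = 1) ->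
  rigged [set w | Omega w /\ forall a, a \in s -> ev w a = 0] V.
Proof.
move=> O0 rV sV uV NuV s0 u1; elim: s sV s0 => [|a s IH] sV s0.
  suff -> : [set w | Omega w /\ forall a, a \in [::] -> ev w a = 0] = Omega by [].
  by apply/seteqP; split=> w //= [].
have -> : [set w | Omega w /\ forall b, b \in a :: s -> ev w b = 0] =
    [set w | [set w | Omega w /\ forall b, b \in s -> ev w b = 0] w /\ ev w a = 0].
  apply/seteqP; split=> w /= [Ow hw].
    split; last exact/hw/mem_head.
    by split=> // b bs; apply: hw; rewrite inE bs orbT.
  case: Ow => Ow rs; split=> // b.
  by rewrite inE => /orP[/eqP->|/rs].
apply: (@rig_relation _ _ _ u) => //.
- by split=> // b bs; apply: s0; rewrite inE bs orbT.
- apply: IH => b bs; first by apply: sV; rewrite inE bs orbT.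
  by apply: s0; rewrite inE bs orbT.
- exact/sV/mem_head.
- exact/s0/mem_head.
- by move=> w [Ow _]; exact: u1.
Qed.

End Forms.

Lemma set2_eq (T : finType) (a b c d : T) : [set a; b]%SET = [set c; d]%SET ->
  (a = c /\ b = d) \/ (a = d /\ b = c).
Proof.
move=> e.
have ha : a \in [set c; d]%SET by rewrite -e !inE eqxx.
have hb : b \in [set c; d]%SET by rewrite -e !inE eqxx orbT.
have hc : c \in [set a; b]%SET by rewrite e !inE eqxx.
have hd : d \in [set a; b]%SET by rewrite e !inE eqxx orbT.
move: ha hb hc hd; rewrite !inE.
by move=> /orP[]/eqP ha /orP[]/eqP hb /orP[]/eqP hc /orP[]/eqP hd; subst; auto.
Qed.

Section RiggedLinkage.
Variables (R : realType) (n : nat) (J : finType).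
Local Notation form := {ffun J -> R}.
Variables (w0 : J -> 'rV[R]_n) (Omega : set (J -> 'rV[R]_n)) (V : seq form).

Lemma rigged_linkage : rigged w0 Omega V ->
  exists (L : linkage R n) (fm : 'I_(lk_N L) -> form),
    (forall phi, config phi <-> exists2 w, Omega w & forall v, row v phi = ev w (fm v)) /\
    forall a, a \in V -> exists v, fm v = a.
Proof.
move=> [E [F [hE hF hO hphi]]].
(* Without duplicates, vertices and forms in [V] correspond bijectively, so that a configuration can
   be read as a function [psi] of forms. *)
pose s := undup V; pose N := size s; pose fm (v : 'I_N) := nth 0 s v.
have fmV v : fm v \in V by rewrite -mem_undup mem_nth.
have fm_inj : injective fm.
  by move=> u v /eqP; rewrite nth_uniq ?undup_uniq // => /eqP /val_inj.
have idxP a : a \in V -> {v | fm v = a}.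
  rewrite -mem_undup => aV; have iN : (index a s < N)%N by rewrite index_mem.
  by exists (Ordinal iN); rewrite /fm /= nth_index.
pose edges := [set e : {set 'I_N} | [exists u, exists v,
   (e == [set u; v]%SET) && (((fm u, fm v) \in E) || ((fm v, fm u) \in E))]]%SET.
pose d u v := eucl_norm (ev w0 (fm u) - ev w0 (fm v)).
have dC u v : d u v = d v u by apply/eucl_norm_eq; exact: nsqB.
pose len (e : {set 'I_N}) : R :=
  if [pick p : 'I_N * 'I_N | e == [set p.1; p.2]%SET] is Some p then d p.1 p.2 else 0.
have lenE u v : len [set u; v]%SET = d u v.
  rewrite /len; case: pickP => [[u' v'] /= /eqP e|/(_ (u, v))]; last by rewrite eqxx.
  by case: (set2_eq e) => -[-> ->].
have edgeP u v : [set u; v]%SET \in edges ->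
    ((fm u, fm v) \in E) || ((fm v, fm u) \in E).
  rewrite inE => /existsP[u' /existsP[v' /andP[/eqP e h]]].
  by case: (set2_eq e) => -[-> ->] //; rewrite orbC.
have dpos u v : ((fm u, fm v) \in E) || ((fm v, fm u) \in E) -> 0 < d u v.
  have pos a b : (a, b) \in E -> 0 < eucl_norm (ev w0 a - ev w0 b).
    by move=> /hE[_ _ h]; rewrite eucl_norm_nsq sqrtr_gt0 lt_def h nsq_ge0.
  by case/orP => /pos //; rewrite -/(d v u) dC.
have dneq u v : 0 < d u v -> u != v.
  apply: contraTneq => ->; rewrite /d subrr eucl_norm_nsq.
  by rewrite /nsq dot0l sqrtr0 ltxx.
have E2 e : e \in edges -> #|e| = 2%N.
  rewrite inE => /existsP[u /existsP[v /andP[/eqP -> h]]].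
  by rewrite cards2 (dneq _ _ (dpos _ _ h)).
have Epos e : e \in edges -> 0 < len e.
  rewrite inE => /existsP[u /existsP[v /andP[/eqP -> h]]].
  by rewrite lenE; exact: dpos.
pose fixv := [set v : 'I_N | fm v \in F]%SET.
pose L := @Linkage R n N edges len fixv (fun v => ev w0 (fm v)) E2 Epos.
exists L, fm; split; last by move=> a /idxP[v <-]; exists v.
move=> phi; split=> [[/= hfix hlen]|[w Ow hw]].
- pose psi (a : form) : 'rV[R]_n :=
    if [pick v | fm v == a] is Some v then row v phi else 0.
  have psiE v : psi (fm v) = row v phi.
    rewrite /psi; case: pickP => [v' /eqP /fm_inj -> //|/(_ v)]; by rewrite eqxx.
  have [||w Ow hw] := hphi psi.
  + move=> e eE; have [/idxP[u ue] /idxP[v ve] _] := hE _ eE.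
    rewrite -ue -ve !psiE.
    have uvE : (fm u, fm v) \in E by rewrite ue ve -surjective_pairing.
    have uvd : [set u; v]%SET \in edges.
      by rewrite inE; apply/existsP; exists u; apply/existsP; exists v; rewrite eqxx uvE.
    have uv : u != v by apply: dneq; apply: dpos; rewrite uvE.
    have := hlen u v uvd uv; rewrite lenE => /eucl_norm_eq //.
  + move=> a aF; have /idxP[v va] := hF _ aF; rewrite -va psiE.
    by apply: hfix; rewrite inE va.
  exists w => // v; rewrite -psiE; exact/hw/fmV.
- have [k f] := hO _ Ow; split=> /= [v|u v /edgeP uvE uv].
    by rewrite inE hw; exact: f.
  rewrite lenE !hw; apply/eucl_norm_eq.
  by case/orP: uvE => /k //=; rewrite nsqB [in RHS]nsqB.
Qed.

End RiggedLinkage.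

Section UnitVectorSystems.
Variables (R : realType) (n : nat) (K : finType) (Z : K -> {set 'I_n}).
Local Notation J := ('I_n + K)%type.
Local Notation form := {ffun J -> R}.

(* Families of unit vectors, the [k]-th one having zero coordinates on [Z k],
   completed by the standard basis so that affine maps become linear forms. *)
Definition unit_family : set (J -> 'rV[R]_n) := [set w |
  (forall i, w (inl i) = delta_mx 0 i) /\
  (forall k, nsq (w (inr k)) = 1 /\ forall i, i \in Z k -> w (inr k) 0 i = 0)].

Lemma dot_delta (x : 'rV[R]_n) i : dot x (delta_mx 0 i) = x 0 i.
Proof.
rewrite /dot (bigD1 i) //= big1 ?addr0 ?mxE ?eqxx ?mulr1 // => j ji.
by rewrite !mxE (negPf ji) mulr0.
Qed.

Lemma nsq_delta i : nsq (delta_mx 0 i : 'rV[R]_n) = 1.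
Proof. by rewrite /nsq dot_delta mxE !eqxx. Qed.

Lemma unit_family_nsq w j : unit_family w -> nsq (w j) = 1.
Proof. by case: j => [i|k] [h1 h2]; [rewrite h1 nsq_delta|case: (h2 k)]. Qed.

Lemma unit_family_const w0 j : unit_family w0 -> const_len w0 unit_family (delta _ j).
Proof.
move=> u0; split=> [|w uw]; rewrite !ev_delta unit_family_nsq ?oner_neq0 //.
by rewrite unit_family_nsq.
Qed.

Definition basic_forms : seq form := 0 :: [seq delta R j | j <- enum {: J}].

(** Bars to 0 make the vectors unit vectors. For a unit vector u one has |u - e_i|^2 = 2 - 2 u_i, so
    a bar of length sqrt 2 to the fixed vertex e_i makes the i-th coordinate vanish. *)
Lemma rigged_basic w0 : unit_family w0 -> rigged w0 unit_family basic_forms.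
Proof.
move=> u0; have [b0 k0] := u0.
have dV j : delta R j \in basic_forms by rewrite in_cons (map_f (@delta R _)) ?orbT // mem_enum.
have V0 : 0 \in basic_forms by exact: mem_head.
pose E : seq (form * form) := [seq (delta R (inr k), 0) | k <- enum K] ++
  [seq (delta R (inr ki.1), delta R (inl ki.2)) | ki <- enum {: K * 'I_n} & ki.2 \in Z ki.1].
pose F : seq form := 0 :: [seq delta R (inl i) | i <- enum 'I_n].
have dist w k i : unit_family w ->
    nsq (w (inr k) - delta_mx 0 i) = 2 - 2 * w (inr k) 0 i.
  move=> uw; rewrite /nsq !dotE (dotC (delta_mx 0 i)) -/(nsq _) -/(nsq (delta_mx 0 i)).
  by rewrite dot_delta nsq_delta (unit_family_nsq _ uw); ring.
have distE w : unit_family w -> forall k i, i \in Z k -> nsq (w (inr k) - w (inl i)) = 2.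
  by move=> uw k i iZ; case: (uw) => wb wk; rewrite wb dist // (proj2 (wk k) i iZ) mulr0 subr0.
exists E, F; split.
- move=> e; rewrite mem_cat => /orP[/mapP[k _ ->]|/mapP[[k i]]] /=.
    by split=> //; rewrite ev0 subr0 ev_delta unit_family_nsq // oner_neq0.
  rewrite mem_filter /= => /andP[iZ _] ->; split=> //=.
  by rewrite !ev_delta distE // pnatr_eq0.
- by move=> a; rewrite inE => /orP[/eqP-> //|/mapP[i _ ->]].
- move=> w uw; split=> [e|a].
    rewrite mem_cat => /orP[/mapP[k _ ->]|/mapP[[k i]]] /=.
      by rewrite !ev0 !subr0 !ev_delta !unit_family_nsq.
    by rewrite mem_filter /= => /andP[iZ _] -> /=; rewrite !ev_delta !distE.
  rewrite inE => /orP[/eqP->|/mapP[i _ ->]]; first by rewrite !ev0.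
  by rewrite !ev_delta; case: uw => -> _; case: u0 => ->.
- move=> phi kphi fphi; pose w j := phi (delta R j).
  have p0 : phi 0 = 0 by rewrite fphi ?ev0 // inE eqxx.
  have pb i : phi (delta R (inl i)) = delta_mx 0 i.
    by rewrite fphi ?ev_delta // in_cons (map_f (fun i => delta R (inl i))) ?orbT // mem_enum.
  have pn k : nsq (phi (delta R (inr k))) = 1.
    have := kphi (delta R (inr k), 0); rewrite mem_cat (map_f (fun k => (delta R (inr k), 0))) ?mem_enum // => /(_ isT) /=.
    by rewrite p0 ev0 !subr0 ev_delta unit_family_nsq.
  exists w; last first.
    move=> a; rewrite inE => /orP[/eqP->|/mapP[j _ ->]]; first by rewrite p0 ev0.
    by rewrite ev_delta.
  split=> // k; split=> [|i iZ]; first exact: pn.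
  have := kphi (delta R (inr k), delta R (inl i)); rewrite mem_cat.
  rewrite (map_f (fun ki => (delta R (inr ki.1), delta R (inl ki.2))) (x := (k, i))); last first.
    by rewrite mem_filter /= iZ mem_enum.
  rewrite orbT => /(_ isT) /=; rewrite !ev_delta distE // pb.
  rewrite /nsq !dotE (dotC (delta_mx 0 i)) dot_delta.
  rewrite -/(nsq (phi _)) pn -/(nsq (delta_mx 0 i)) nsq_delta /w; lra.
Qed.

Lemma unit_vector_linkage (i0 : 'I_n) w0 (rels outs : seq form) : unit_family w0 ->
  (forall a, a \in rels -> ev w0 a = 0) ->
  exists (L : linkage R n) (fm : 'I_(lk_N L) -> form),
    (forall phi, config phi <-> exists w, [/\ unit_family w,
       forall a, a \in rels -> ev w a = 0 & forall v, row v phi = ev w (fm v)]) /\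
    forall a, a \in outs -> exists v, fm v = a.
Proof.
(* One basis vector and its opposite are the anchors to which all relations are attached. *)
move=> u0 r0; pose e0 : form := delta R (inl i0).
have dV j : delta R j \in basic_forms by rewrite in_cons (map_f (@delta R _)) ?orbT // mem_enum.
have [||V [VV rV sV]] := @rig_forms _ _ _ w0 unit_family _ ([:: e0; - e0] ++ rels ++ outs)
    basic_forms (rigged_basic u0) _ dV.
- by move=> j; exact: unit_family_const.
- exact: mem_head.
have sub a : a \in rels -> a \in V by move=> h; apply: sV; rewrite !mem_cat h orbT.
have := @rig_relations _ _ _ w0 unit_family V rels e0 u0 rV sub.
case=> [|||w uw|E [F hEF]] //.
- by apply: sV; rewrite inE eqxx.
- by apply: sV; rewrite !inE eqxx orbT.
- by rewrite ev_delta unit_family_nsq.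
have [|L [fm [h1 h2]]] := @rigged_linkage R n J w0
    [set w | unit_family w /\ forall a, a \in rels -> ev w a = 0] V.
  by exists E, F.
exists L, fm; split.
  move=> phi; rewrite h1; split=> [[w [uw rw] hw]|[w [uw rw hw]]]; first by exists w.
  by exists w.
by move=> a ao; apply: h2; apply: sV; rewrite !mem_cat ao !orbT.
Qed.

End UnitVectorSystems.

(** * Rhombus gadgets *)

Section Frames.
Variables (R : realType) (n' : nat).
Local Notation n := n'.+2.

(* An orthonormal frame (a, b) of the coordinate plane of e_0 and e_[fr_axis],
   with b = fr_cos e_0 + fr_sin e_[fr_axis] and a = - fr_sin e_0 + fr_cos e_[fr_axis]. *)
Record frame := Frame {
  fr_axis : 'I_n; fr_cos : R; fr_sin : R;
  fr_axis_neq0 : fr_axis != ord0;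
  fr_unit : fr_cos ^+ 2 + fr_sin ^+ 2 = 1 }.

Variable f : frame.
Local Notation c := (fr_cos f).
Local Notation s := (fr_sin f).
Local Notation j := (fr_axis f).

(** This is x a + y b in the frame (a, b); [pv1] and [pv2] are the coordinates along a and b. *)
Definition pv (x y : R) : 'rV[R]_n :=
  (- s * x + c * y) *: delta_mx 0 ord0 + (c * x + s * y) *: delta_mx 0 j.
Definition pv1 (v : 'rV[R]_n) : R := - s * v 0 ord0 + c * v 0 j.
Definition pv2 (v : 'rV[R]_n) : R := c * v 0 ord0 + s * v 0 j.
Definition off_plane : {set 'I_n} := ~: [set ord0; j]%SET.
Definition in_plane (v : 'rV[R]_n) := forall i, i \in off_plane -> v 0 i = 0.

Lemma pv_0 x y : pv x y 0 ord0 = - s * x + c * y.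
Proof.
have h : ord0 != j by rewrite eq_sym fr_axis_neq0.
by rewrite !mxE !eqxx (negPf h) /=; ring.
Qed.

Lemma pv_j x y : pv x y 0 j = c * x + s * y.
Proof. by rewrite !mxE !eqxx (negPf (fr_axis_neq0 f)) /=; ring. Qed.

Lemma pv_in_plane x y : in_plane (pv x y).
Proof.
move=> i; rewrite !inE negb_or => /andP[/negPf i0 /negPf ij].
by rewrite !mxE i0 ij /=; ring.
Qed.

Lemma pv1K x y : pv1 (pv x y) = x.
Proof.
rewrite /pv1 pv_0 pv_j.
have -> : - s * (- s * x + c * y) + c * (c * x + s * y) = (c ^+ 2 + s ^+ 2) * x by ring.
by rewrite fr_unit mul1r.
Qed.

Lemma pv2K x y : pv2 (pv x y) = y.
Proof.
rewrite /pv2 pv_0 pv_j.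
have -> : c * (- s * x + c * y) + s * (c * x + s * y) = (c ^+ 2 + s ^+ 2) * y by ring.
by rewrite fr_unit mul1r.
Qed.

Lemma pv_inj x y x' y' : pv x y = pv x' y' -> x = x' /\ y = y'.
Proof.
move=> e; split; first by rewrite -(pv1K x y) e pv1K.
by rewrite -(pv2K x y) e pv2K.
Qed.

Lemma pvE v : in_plane v -> v = pv (pv1 v) (pv2 v).
Proof.
move=> hv; apply/rowP => i.
have [->|i0] := eqVneq i ord0.
  rewrite pv_0 /pv1 /pv2.
  have -> : - s * (- s * v 0 ord0 + c * v 0 j) + c * (c * v 0 ord0 + s * v 0 j) =
    (c ^+ 2 + s ^+ 2) * v 0 ord0 by ring.
  by rewrite fr_unit mul1r.
have [->|ij] := eqVneq i j.
  rewrite pv_j /pv1 /pv2.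
  have -> : c * (- s * v 0 ord0 + c * v 0 j) + s * (c * v 0 ord0 + s * v 0 j) =
    (c ^+ 2 + s ^+ 2) * v 0 j by ring.
  by rewrite fr_unit mul1r.
by rewrite hv ?pv_in_plane // !inE negb_or i0 ij.
Qed.

Lemma pvD x y x' y' : pv x y + pv x' y' = pv (x + x') (y + y').
Proof. by apply/rowP => i; rewrite !mxE; ring. Qed.

Lemma pvZ k x y : k *: pv x y = pv (k * x) (k * y).
Proof. by apply/rowP => i; rewrite !mxE; ring. Qed.

Lemma pvN x y : - pv x y = pv (- x) (- y).
Proof. by apply/rowP => i; rewrite !mxE; ring. Qed.

Lemma dot_pv x y x' y' : dot (pv x y) (pv x' y') = x * x' + y * y'.
Proof.
have h v : dot v (pv x' y') = (- s * x' + c * y') * v 0 ord0 + (c * x' + s * y') * v 0 j.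
  by rewrite /pv !dotE !dot_delta.
rewrite h pv_0 pv_j.
have -> : (- s * x' + c * y') * (- s * x + c * y) + (c * x' + s * y') * (c * x + s * y) =
  (c ^+ 2 + s ^+ 2) * (x * x' + y * y') by ring.
by rewrite fr_unit mul1r.
Qed.

Lemma nsq_pv x y : nsq (pv x y) = x ^+ 2 + y ^+ 2.
Proof. by rewrite /nsq dot_pv; ring. Qed.

Definition sgnb (b : bool) : R := if b then 1 else -1.

Lemma sgnb_sqr b : sgnb b ^+ 2 = 1.
Proof. by case: b; rewrite /= ?sqrrN expr1n. Qed.

Section Rhombus.
Variables (L t : R).

(* The vertices of a rhombus are 0 + L b, x, L b', y: the role (false, false) is
   the direction b, (false, true) and (true, false) are the directions of
   x - L b and y - L b, and (true, true) is b'. *)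
Definition rhombus (u : bool * bool -> 'rV[R]_n) (x y : 'rV[R]_n) : Prop :=
  [/\ forall r, nsq (u r) = 1, L *: u (false, false) + t *: u (false, true) = x,
      L *: u (false, false) + t *: u (true, false) = y &
      L *: u (true, true) = L *: u (false, false) + t *: (u (false, true) + u (true, false))].

(** Both b and b' are unit vectors, so squared lengths in the closing relation evaluate exactly the
    mixed terms in the expansion of [dot x y]. *)
Lemma rhombus_dot u x y : rhombus u x y -> dot x y = L ^+ 2 - t ^+ 2.
Proof.
case=> u1 <- <- e.
have := congr1 (@nsq _ _) e.
have := u1 (false, false); have := u1 (false, true); have := u1 (true, false).
have := u1 (true, true); rewrite /nsq !dotE.
set b := u (false, false); set p := u (false, true); set q := u (true, false).
rewrite (dotC p b) (dotC q b) (dotC q p).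
set bb := dot b b; set pp := dot p p; set qq := dot q q; set bp := dot b p.
by set bq := dot b q; set pq := dot p q => -> -> -> ->; nra.
Qed.

(** The vertex L b is at distance [t] from x and from y. Only [L ^+ 2 - t ^+ 2] enters, so for two
    rhombi sharing this number the two vertices differ by a vector orthogonal to x and y. *)
Lemma rhombus_side u x y : rhombus u x y ->
  2 * dot (L *: u (false, false)) x = nsq x + (L ^+ 2 - t ^+ 2) /\
  2 * dot (L *: u (false, false)) y = nsq y + (L ^+ 2 - t ^+ 2).
Proof.
case=> u1 <- <- _.
have := u1 (false, false); have := u1 (false, true); have := u1 (true, false).
rewrite /nsq !dotE; set b := u (false, false); set p := u (false, true).
set q := u (true, false); rewrite (dotC p b) (dotC q b).
by move=> -> -> ->; split; ring.
Qed.

(* Rhombi over two parallel points x and y = mu x: b is determined up to the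
   reflection in the line through x. *)
Definition rhombus_height (x1 x2 mu : R) : R :=
  Num.sqrt ((L ^+ 2 - (x1 ^+ 2 + x2 ^+ 2) * (1 + mu) ^+ 2 / 4) / (x1 ^+ 2 + x2 ^+ 2)).

(** The vertex L b is displaced from the midpoint [(1 + mu) / 2] x of the diagonal along the quarter
    turn [(- x2, x1)] of x, by plus or minus the height; division by [L] gives the unit vector. *)
Definition rh1 x1 x2 mu (b : bool) : R :=
  ((1 + mu) / 2 * x1 - sgnb b * rhombus_height x1 x2 mu * x2) / L.
Definition rh2 x1 x2 mu (b : bool) : R :=
  ((1 + mu) / 2 * x2 + sgnb b * rhombus_height x1 x2 mu * x1) / L.

Definition rhombus_sol x1 x2 mu (b : bool) (r : bool * bool) : 'rV[R]_n :=
  let b1 := rh1 x1 x2 mu b in let b2 := rh2 x1 x2 mu b in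
  match r with
  | (false, false) => pv b1 b2
  | (false, true) => pv ((x1 - L * b1) / t) ((x2 - L * b2) / t)
  | (true, false) => pv ((mu * x1 - L * b1) / t) ((mu * x2 - L * b2) / t)
  | (true, true) => pv (((1 + mu) * x1 - L * b1) / L) (((1 + mu) * x2 - L * b2) / L)
  end.

Variables (x1 x2 mu : R).
Hypotheses (L0 : L != 0) (t0 : t != 0) (rho0 : 0 < x1 ^+ 2 + x2 ^+ 2)
  (kappa : mu * (x1 ^+ 2 + x2 ^+ 2) = L ^+ 2 - t ^+ 2)
  (nondeg : 0 < L ^+ 2 - (x1 ^+ 2 + x2 ^+ 2) * (1 + mu) ^+ 2 / 4).

Let g := rhombus_height x1 x2 mu.

Let g_gt0 : 0 < g.
Proof. by rewrite sqrtr_gt0 divr_gt0. Qed.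

Let g_sqr : g ^+ 2 * (x1 ^+ 2 + x2 ^+ 2) = L ^+ 2 - (x1 ^+ 2 + x2 ^+ 2) * (1 + mu) ^+ 2 / 4.
Proof. by rewrite sqr_sqrtr ?divfK ?gt_eqF // ltW // divr_gt0. Qed.

Lemma rhombus_sol_inj b b' : rhombus_sol x1 x2 mu b (false, false) =
  rhombus_sol x1 x2 mu b' (false, false) -> b = b'.
Proof.
move=> /pv_inj[]; rewrite /rh1 /rh2 -/g.
move=> /(mulIf (invr_neq0 L0)) h1 /(mulIf (invr_neq0 L0)) h2.
have e1 : (sgnb b - sgnb b') * (g * x2) = 0 by move: h1; rewrite -!mulrA; lra.
have e2 : (sgnb b - sgnb b') * (g * x1) = 0 by move: h2; rewrite -!mulrA; lra.
have : sgnb b - sgnb b' == 0.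
  move/eqP: e1; rewrite mulf_eq0 => /orP[//|]; move/eqP: e2; rewrite mulf_eq0 => /orP[//|].
  rewrite !mulf_eq0 gt_eqF //= => /eqP x10 /eqP x20.
  by move: rho0; rewrite x10 x20 expr0n /= addr0 ltxx.
by case: b b' {h1 h2 e1 e2} => -[] //=; move=> /eqP; lra.
Qed.

Lemma rhombus_sol_nsq b r : nsq (rhombus_sol x1 x2 mu b r) = 1.
Proof.
pose B1 := (1 + mu) / 2 * x1 - sgnb b * g * x2.
pose B2 := (1 + mu) / 2 * x2 + sgnb b * g * x1.
have LB1 : L * rh1 x1 x2 mu b = B1 by rewrite mulrC divfK.
have LB2 : L * rh2 x1 x2 mu b = B2 by rewrite mulrC divfK.
have BB : B1 ^+ 2 + B2 ^+ 2 = L ^+ 2.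
  have -> : B1 ^+ 2 + B2 ^+ 2 = (x1 ^+ 2 + x2 ^+ 2) * (1 + mu) ^+ 2 / 4 +
    sgnb b ^+ 2 * (g ^+ 2 * (x1 ^+ 2 + x2 ^+ 2)) by rewrite /B1 /B2; field.
  by rewrite sgnb_sqr g_sqr; ring.
have xB : 2 * (x1 * B1 + x2 * B2) = (1 + mu) * (x1 ^+ 2 + x2 ^+ 2).
  by rewrite /B1 /B2; field.
have unit_of (A1 A2 D : R) : D != 0 -> A1 ^+ 2 + A2 ^+ 2 = D ^+ 2 -> (A1 / D) ^+ 2 + (A2 / D) ^+ 2 = 1.
  by move=> D0 h; rewrite !expr_div_n -mulrDl h divff // expf_neq0.
clearbody B1 B2; move: kappa xB BB; set rho := x1 ^+ 2 + x2 ^+ 2 => k xB BB.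
have rhoE : rho = x1 ^+ 2 + x2 ^+ 2 by [].
case: r => -[] [] /=; rewrite nsq_pv ?LB1 ?LB2; last first.
- have -> : rh1 x1 x2 mu b = B1 / L by rewrite -LB1 mulrAC divff ?mul1r.
  have -> : rh2 x1 x2 mu b = B2 / L by rewrite -LB2 mulrAC divff ?mul1r.
  exact: unit_of.
- apply: unit_of => //.
  have -> : (x1 - B1) ^+ 2 + (x2 - B2) ^+ 2 = rho - 2 * (x1 * B1 + x2 * B2) + (B1 ^+ 2 + B2 ^+ 2).
    by rewrite rhoE; ring.
  by rewrite xB BB; move: k; lra.
- apply: unit_of => //.
  have -> : (mu * x1 - B1) ^+ 2 + (mu * x2 - B2) ^+ 2 =
      mu ^+ 2 * rho - mu * (2 * (x1 * B1 + x2 * B2)) + (B1 ^+ 2 + B2 ^+ 2).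
    by rewrite rhoE; ring.
  by rewrite xB BB; move: k; lra.
- apply: unit_of => //.
  have -> : ((1 + mu) * x1 - B1) ^+ 2 + ((1 + mu) * x2 - B2) ^+ 2 =
      (1 + mu) ^+ 2 * rho - (1 + mu) * (2 * (x1 * B1 + x2 * B2)) + (B1 ^+ 2 + B2 ^+ 2).
    by rewrite rhoE; ring.
  by rewrite xB BB; ring.
Qed.

Lemma rhombus_solP b : rhombus (rhombus_sol x1 x2 mu b) (pv x1 x2) (pv (mu * x1) (mu * x2)).
Proof.
split=> [r|||]; first exact: rhombus_sol_nsq.
- by rewrite /= !pvZ pvD; congr pv; field.
- by rewrite /= !pvZ pvD; congr pv; field.
- rewrite /= !pvD !pvZ pvD; congr pv; field; by rewrite L0 t0.
Qed.

Lemma rhombus_complete u : (forall r, in_plane (u r)) ->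
  rhombus u (pv x1 x2) (pv (mu * x1) (mu * x2)) ->
  exists b, forall r, u r = rhombus_sol x1 x2 mu b r.
Proof.
move=> pu hu; have [hx _] := rhombus_side hu.
case: hu => u1 ex ey ee.
have [b1 [b2 uE]] : exists b1 b2, u (false, false) = pv b1 b2.
  by exists (pv1 (u (false, false))), (pv2 (u (false, false))); exact: pvE.
have bb : b1 ^+ 2 + b2 ^+ 2 = 1 by rewrite -nsq_pv -uE u1.
have xb : 2 * (L * b1 * x1 + L * b2 * x2) = (1 + mu) * (x1 ^+ 2 + x2 ^+ 2).
  move: hx; rewrite uE pvZ dot_pv nsq_pv => ->.
  by rewrite -kappa; ring.
move: g_sqr xb (gt_eqF rho0); set rho := x1 ^+ 2 + x2 ^+ 2 => gs xb /negbT rn.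
(* The component of L b along the quarter turn of x, in units of its length; [xb] determines the
   component along x. *)
pose h := (x1 * (L * b2) - x2 * (L * b1)) / rho.
have e1 : L * b1 = (1 + mu) / 2 * x1 - h * x2.
  apply: (mulfI rn); rewrite mulrBr /h.
  have -> : rho * ((x1 * (L * b2) - x2 * (L * b1)) / rho * x2) =
    (x1 * (L * b2) - x2 * (L * b1)) * x2 by field.
  have -> : rho * ((1 + mu) / 2 * x1) = x1 / 2 * ((1 + mu) * rho) by field.
  by rewrite -xb /rho; field.
have e2 : L * b2 = (1 + mu) / 2 * x2 + h * x1.
  apply: (mulfI rn); rewrite mulrDr /h.
  have -> : rho * ((x1 * (L * b2) - x2 * (L * b1)) / rho * x1) =
    (x1 * (L * b2) - x2 * (L * b1)) * x1 by field.
  have -> : rho * ((1 + mu) / 2 * x2) = x2 / 2 * ((1 + mu) * rho) by field.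
  by rewrite -xb /rho; field.
have hg : h ^+ 2 = g ^+ 2.
  apply: (mulIf rn); rewrite gs.
  have -> : L ^+ 2 = (L * b1) ^+ 2 + (L * b2) ^+ 2 by rewrite !exprMn -mulrDr bb mulr1.
  by rewrite e1 e2 /rho; field.
have [b hb] : exists b, h = sgnb b * g.
  move/eqP: hg; rewrite -subr_eq0 subr_sqr mulf_eq0 subr_eq0 addr_eq0.
  by case/orP=> /eqP ->; [exists true|exists false]; rewrite /= ?mul1r ?mulN1r.
have b1E : b1 = rh1 x1 x2 mu b by apply: (mulfI L0); rewrite e1 hb /rh1 mulrCA divff ?mulr1.
have b2E : b2 = rh2 x1 x2 mu b by apply: (mulfI L0); rewrite e2 hb /rh2 mulrCA divff ?mulr1.
have pE : u (false, true) = rhombus_sol x1 x2 mu b (false, true).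
  apply: (scalerI t0); rewrite /= -b1E -b2E pvZ; apply: (addrI (L *: u (false, false))).
  by rewrite ex uE pvZ pvD; congr pv; field.
have qE : u (true, false) = rhombus_sol x1 x2 mu b (true, false).
  apply: (scalerI t0); rewrite /= -b1E -b2E pvZ; apply: (addrI (L *: u (false, false))).
  by rewrite ey uE pvZ pvD; congr pv; field.
exists b => -[[] []] //; last by rewrite uE b1E b2E.
apply: (scalerI L0); rewrite ee pE qE uE /= -b1E -b2E !pvD !pvZ pvD.
congr pv; field; by rewrite L0 t0.
Qed.

End Rhombus.

End Frames.

(** * Straight lines from two rhombi *)

Section LineGadget.
Variables (R : realType) (n' : nat) (f : frame R n').
Local Notation n := n'.+2.

(* Both rhombi have L^2 - t^2 = 5. As the arms differ, so do the two vertices L b,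
   and x and y, being orthogonal to their difference, are parallel even when one
   of the rhombi is degenerate. *)
Definition arm (b : bool) : R := if b then 21 / 4 else 3.
Definition leg (b : bool) : R := if b then 19 / 4 else 2.

Lemma arm_leg b : arm b ^+ 2 - leg b ^+ 2 = 5.
Proof. by case: b; rewrite /arm /leg; field. Qed.

(** For x = 4 a + t b, the parallel vector y = mu x with x . y = 5 has this ratio mu. *)
Definition inv_ratio (t : R) : R := 5 / (16 + t ^+ 2).

Lemma rho_gt0 (t : R) : 0 < 4 ^+ 2 + t ^+ 2.
Proof. by have := sqr_ge0 t; lra. Qed.

Lemma inv_ratioE t : inv_ratio t * (4 ^+ 2 + t ^+ 2) = 5.
Proof.
rewrite /inv_ratio (_ : 4 ^+ 2 = 16); last by ring.
by rewrite divfK // gt_eqF //; have := sqr_ge0 t; lra.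
Qed.

(** With rho = |x|^2, multiplying by rho gives a quadratic polynomial in rho whose roots are the
    squares of arm minus leg and arm plus leg, the extremal lengths of x: 1 and 25 for the first
    rhombus, 1/4 and 100 for the second. Here rho lies between 16 and 25, strictly below 25. *)
Lemma line_nondeg t b : t ^+ 2 < 9 ->
  0 < arm b ^+ 2 - (4 ^+ 2 + t ^+ 2) * (1 + inv_ratio t) ^+ 2 / 4.
Proof.
move=> t9; have r0 := rho_gt0 t; have := inv_ratioE t; have t2 := sqr_ge0 t.
have r1 : 16 <= 4 ^+ 2 + t ^+ 2 by rewrite (_ : 4 ^+ 2 = 16); [lra|ring].
have r2 : 4 ^+ 2 + t ^+ 2 < 25 by rewrite (_ : 4 ^+ 2 = 16); [lra|ring].
set rho := 4 ^+ 2 + t ^+ 2 in r0 r1 r2 *; set m := inv_ratio t => mr.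
rewrite -(pmulr_rgt0 _ r0).
have -> : rho * (arm b ^+ 2 - rho * (1 + m) ^+ 2 / 4) =
  arm b ^+ 2 * rho - (rho + m * rho) ^+ 2 / 4 by field.
rewrite mr; case: b; rewrite /arm.
  have -> : (21 / 4) ^+ 2 * rho - (rho + 5) ^+ 2 / 4 = (rho - 4^-1) * (100 - rho) / 4 by field.
  by rewrite divr_gt0 // mulr_gt0 //; lra.
have -> : 3 ^+ 2 * rho - (rho + 5) ^+ 2 / 4 = (rho - 1) * (25 - rho) / 4 by field.
by rewrite divr_gt0 // mulr_gt0 //; lra.
Qed.

(* Peaucellier: y runs on the circle of diameter 5/4 through 0, hence its
   inverse x runs on a line at distance 4 from 0. *)
Lemma line_gadget (u : bool -> bool * bool -> 'rV[R]_n) (v x y : 'rV[R]_n) :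
  (forall b r, in_plane f (u b r)) -> nsq v = 1 ->
  (forall b, rhombus (arm b) (leg b) (u b) x y) ->
  y = (5 / 8) *: (v + pv f 1 0) ->
  exists t : R, [/\ t ^+ 2 <= 9, x = pv f 4 t & y = pv f (inv_ratio t * 4) (inv_ratio t * t)].
Proof.
move=> pu v1 hu yv.
have uE b r : exists p q, u b r = pv f p q.
  by exists (pv1 f (u b r)), (pv2 f (u b r)); exact: pvE.
have [b1 [b2 ub]] := uE false (false, false); have [p1 [p2 up]] := uE false (false, true).
have [q1 [q2 uq]] := uE false (true, false); have [c1 [c2 uc]] := uE true (false, false).
case: (hu false) => n1 xE yE _.
have [x1 [x2 xP]] : exists x1 x2, x = pv f x1 x2.
  by rewrite -xE ub up !pvZ pvD; do 2 eexists.
have [y1 [y2 yP]] : exists y1 y2, y = pv f y1 y2.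
  by rewrite -yE ub uq !pvZ pvD; do 2 eexists.
have xy5 : x1 * y1 + x2 * y2 = 5.
  by rewrite -(dot_pv f) -xP -yP (rhombus_dot (hu false)) arm_leg.
have [sx sy] := rhombus_side (hu false); have [sx' sy'] := rhombus_side (hu true).
move: sx sy sx' sy'; rewrite !arm_leg ub uc xP yP !pvZ !dot_pv !nsq_pv => sx sy sx' sy'.
have bb : b1 ^+ 2 + b2 ^+ 2 = 1 by rewrite -(nsq_pv f) -ub n1.
have cc : c1 ^+ 2 + c2 ^+ 2 = 1 by rewrite -(nsq_pv f) -uc; case: (hu true).
pose d1 := arm false * b1 - arm true * c1; pose d2 := arm false * b2 - arm true * c2.
have dx : d1 * x1 + d2 * x2 = 0 by rewrite /d1 /d2; lra.
have dy : d1 * y1 + d2 * y2 = 0 by rewrite /d1 /d2; lra.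
have det : x1 * y2 - x2 * y1 = 0.
  have e1 : d1 * (x1 * y2 - x2 * y1) = 0.
    have -> : d1 * (x1 * y2 - x2 * y1) =
      (d1 * x1 + d2 * x2) * y2 - (d1 * y1 + d2 * y2) * x2 by ring.
    by rewrite dx dy; ring.
  have e2 : d2 * (x1 * y2 - x2 * y1) = 0.
    have -> : d2 * (x1 * y2 - x2 * y1) =
      (d1 * y1 + d2 * y2) * x1 - (d1 * x1 + d2 * x2) * y1 by ring.
    by rewrite dx dy; ring.
  move/eqP: e1; rewrite mulf_eq0 => /orP[/eqP d10|/eqP //].
  move/eqP: e2; rewrite mulf_eq0 => /orP[/eqP d20|/eqP //].
  have f1 : arm false * b1 = arm true * c1 by move: d10; rewrite /d1; lra.
  have f2 : arm false * b2 = arm true * c2 by move: d20; rewrite /d2; lra.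
  have : arm false ^+ 2 * (b1 ^+ 2 + b2 ^+ 2) = arm true ^+ 2 * (c1 ^+ 2 + c2 ^+ 2).
    by rewrite !mulrDr -!exprMn f1 f2.
  by rewrite bb cc /arm; lra.
(* Since v is a unit vector, y lies on the circle with centre 5/8 a passing through 0. *)
have yy : y1 ^+ 2 + y2 ^+ 2 = 5 / 4 * y1.
  have vE : v = pv f (8 / 5 * y1 - 1) (8 / 5 * y2).
    have : (8 / 5) *: y = v + pv f 1 0.
      by rewrite yv scalerA (_ : 8 / 5 * (5 / 8) = 1) ?scale1r //; field.
    rewrite yP pvZ => /(congr1 (fun z => z - pv f 1 0)); rewrite addrK => <-.
    by rewrite pvN pvD; congr pv; ring.
  by move: v1; rewrite vE nsq_pv; nra.
have y10 : y1 != 0.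
  apply/eqP => y10; move: yy; rewrite y10 mulr0 expr0n add0r => /eqP.
  rewrite sqrf_eq0 => /eqP y20; move: xy5; rewrite y10 y20; lra.
(* As x and y are parallel, x1 |y|^2 = (x . y) y1, that is, 5/4 x1 y1 = 5 y1. *)
have x14 : x1 = 4.
  have : y1 * (5 - 5 / 4 * x1) = 0.
    have -> : y1 * (5 - 5 / 4 * x1) = 5 * y1 - x1 * (5 / 4 * y1) by ring.
    rewrite -yy -xy5; have -> : (x1 * y1 + x2 * y2) * y1 - x1 * (y1 ^+ 2 + y2 ^+ 2) =
      - y2 * (x1 * y2 - x2 * y1) by ring.
    by rewrite det mulr0.
  by move/eqP; rewrite mulf_eq0 (negPf y10) /= => /eqP; lra.
(* The first rhombus bounds |x| by 3 + 2 = 5, and 25 - 16 = 9. *)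
have x29 : x2 ^+ 2 <= 9.
  have nx : nsq x <= 25.
    rewrite -xE; have := nsq_ge0 (u false (false, false) - u false (false, true)).
    have := n1 (false, false); have := n1 (false, true).
    rewrite /nsq !dotE (dotC (u false (false, true))) /arm /leg.
    by move=> -> ->; lra.
  by move: nx; rewrite xP nsq_pv x14; lra.
exists x2; rewrite x14; split=> //; congr pv.
- apply: (mulIf (lt0r_neq0 (rho_gt0 x2))); rewrite mulrAC inv_ratioE -xy5 x14.
  by move: det; rewrite x14; nra.
- apply: (mulIf (lt0r_neq0 (rho_gt0 x2))); rewrite mulrAC inv_ratioE -xy5 x14.
  by move: det; rewrite x14; nra.
Qed.

End LineGadget.

(** * Lines coupled by inversions and linear relations *)

Section LineSystem.
Variables (R : realType) (n' : nat) (I Q : finType) (fr : I -> frame R n').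
Local Notation n := n'.+2.
Variables (qx qy : Q -> I) (kap : R) (lins : seq ({ffun I -> R} * 'rV[R]_n)).
Hypotheses (kap_bound : 0 < kap < 16)
  (qx_axis : forall q, fr_cos (fr (qx q)) = 1) (qy_axis : forall q, fr_cos (fr (qy q)) = 1).

(** A line uses two rhombi of four unit vectors each and one unit vector driving the circle; an
    inversion uses one rhombus. *)
Definition unit_index : Type := (I * bool * (bool * bool) + I + Q * (bool * bool))%type.
HB.instance Definition _ := Finite.on unit_index.
Local Notation K := unit_index.
Local Notation J := ('I_n + K)%type.
Local Notation form := {ffun J -> R}.

Definition unit_frame (k : K) : frame R n' :=
  match k with
  | inl (inl (i, _, _)) => fr i
  | inl (inr i) => fr i
  | inr (q, _) => fr (qx q)
  end.

Definition unit_zeros (k : K) : {set 'I_n} := off_plane (unit_frame k).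

Definition line_unit i b r : J := inr (inl (inl (i, b, r))).
Definition circle_unit i : J := inr (inl (inr i)).
Definition inv_unit q r : J := inr (inr (q, r)).

Definition normal_form i : form :=
  - fr_sin (fr i) *: delta R (inl ord0) + fr_cos (fr i) *: delta R (inl (fr_axis (fr i))).
Definition side_form (L t : R) (u : bool * bool -> J) r : form :=
  L *: delta R (u (false, false)) + t *: delta R (u r).
Definition closing_form (L t : R) (u : bool * bool -> J) : form :=
  L *: delta R (u (true, true)) - (L *: delta R (u (false, false)) +
    t *: (delta R (u (false, true)) + delta R (u (true, false)))).
Definition x_form i := side_form (arm R false) (leg R false) (line_unit i false) (false, true).
Definition y_form i := side_form (arm R false) (leg R false) (line_unit i false) (true, false).
(** Removing the foot 4 a leaves t b, on the parallel line through 0, so that values of different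
    lines can be added and inverted. *)
Definition line_form i : form := x_form i - 4 *: normal_form i.

Definition rhombus_rels (L t : R) (u : bool * bool -> J) (x y : form) : seq form :=
  [:: side_form L t u (false, true) - x; side_form L t u (true, false) - y;
      closing_form L t u].

Definition line_rels i : seq form :=
  rhombus_rels (arm R false) (leg R false) (line_unit i false) (x_form i) (y_form i) ++
  rhombus_rels (arm R true) (leg R true) (line_unit i true) (x_form i) (y_form i) ++
  [:: y_form i - (5 / 8) *: (delta R (circle_unit i) + normal_form i)].

(** With arm 4, the rhombus then imposes the product [kap] on two points of one line through 0. *)
Definition inv_leg : R := Num.sqrt (16 - kap).

Definition inv_rels q : seq form :=
  rhombus_rels 4 inv_leg (inv_unit q) (line_form (qx q)) (line_form (qy q)).

Definition lin_form (l : {ffun I -> R} * 'rV[R]_n) : form :=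
  \sum_i l.1 i *: line_form i - \sum_k l.2 0 k *: delta R (inl k).

Definition system_rels : seq form :=
  flatten [seq line_rels i | i <- enum I] ++ flatten [seq inv_rels q | q <- enum Q] ++
  [seq lin_form l | l <- lins].

Lemma mem_cat3 (T : eqType) (a : T) (s1 s2 s3 : seq T) :
  (a \in s1 ++ s2 ++ s3) = [|| a \in s1, a \in s2 | a \in s3].
Proof. by rewrite !mem_cat. Qed.

Lemma mem_line_rels a i : (a \in line_rels i) =
  [|| a \in rhombus_rels (arm R false) (leg R false) (line_unit i false) (x_form i) (y_form i),
      a \in rhombus_rels (arm R true) (leg R true) (line_unit i true) (x_form i) (y_form i) |
      a \in [:: y_form i - (5 / 8) *: (delta R (circle_unit i) + normal_form i)]].
Proof. exact: mem_cat3. Qed.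

Lemma mem_system_rels a : (a \in system_rels) =
  [|| a \in flatten [seq line_rels i | i <- enum I],
      a \in flatten [seq inv_rels q | q <- enum Q] | a \in [seq lin_form l | l <- lins]].
Proof. exact: mem_cat3. Qed.

Lemma rhombus_relsP (w : J -> 'rV[R]_n) L t u x y : (forall r, nsq (w (u r)) = 1) ->
  (forall a, a \in rhombus_rels L t u x y -> ev w a = 0) <->
  rhombus L t (w \o u) (ev w x) (ev w y).
Proof.
move=> u1; split=> [h|[_ e1 e2 e3] a].
  have h1 := h _ (mem_head _ _).
  have h2 : ev w (side_form L t u (true, false) - y) = 0 by apply: h; rewrite !inE eqxx orbT.
  have h3 : ev w (closing_form L t u) = 0 by apply: h; rewrite !inE eqxx !orbT.
  move: h1 h2 h3; rewrite !evE => /subr0_eq h1 /subr0_eq h2 /subr0_eq h3.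
  by split.
rewrite !inE => /or3P[] /eqP->; rewrite !evE; apply/eqP; rewrite subr_eq0; apply/eqP.
- exact: e1.
- exact: e2.
- exact: e3.
Qed.

Lemma ev_side (w : J -> 'rV[R]_n) L t u r :
  ev w (side_form L t u r) = L *: w (u (false, false)) + t *: w (u r).
Proof. by rewrite /side_form evD !evZ !ev_delta. Qed.

Lemma ev_x_form (w : J -> 'rV[R]_n) i : ev w (x_form i) =
  arm R false *: w (line_unit i false (false, false)) +
  leg R false *: w (line_unit i false (false, true)).
Proof. exact: ev_side. Qed.

Lemma ev_y_form (w : J -> 'rV[R]_n) i : ev w (y_form i) =
  arm R false *: w (line_unit i false (false, false)) +
  leg R false *: w (line_unit i false (true, false)).
Proof. exact: ev_side. Qed.

Lemma ev_line_form (w : J -> 'rV[R]_n) i :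
  ev w (line_form i) = ev w (x_form i) - 4 *: ev w (normal_form i).
Proof. by rewrite /line_form evD evN evZ. Qed.

Lemma ev_normal w i : unit_family unit_zeros w -> ev w (normal_form i) = pv (fr i) 1 0.
Proof. by case=> wb _; rewrite !evE !wb /pv !mulr1 !mulr0 !addr0. Qed.

#[local] Opaque x_form y_form normal_form line_form side_form.

Lemma unit_family_in_plane w k : unit_family unit_zeros w -> in_plane (unit_frame k) (w (inr k)).
Proof. by case=> _ /(_ k) [_ h] i /h. Qed.

Definition system_holds (w : J -> 'rV[R]_n) : Prop := [/\
  forall i b, rhombus (arm R b) (leg R b) (w \o line_unit i b) (ev w (x_form i)) (ev w (y_form i)),
  forall i, ev w (y_form i) = (5 / 8) *: (w (circle_unit i) + pv (fr i) 1 0),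
  forall q, rhombus 4 inv_leg (w \o inv_unit q) (ev w (line_form (qx q))) (ev w (line_form (qy q))) &
  forall l, l \in lins -> \sum_i l.1 i *: ev w (line_form i) = l.2].

Lemma row_basis (v : 'rV[R]_n) : \sum_k v 0 k *: delta_mx 0 k = v.
Proof. by rewrite -row_sum_delta. Qed.

Lemma system_relsP w : unit_family unit_zeros w ->
  (forall a, a \in system_rels -> ev w a = 0) <-> system_holds w.
Proof.
move=> uw; have w1 j : nsq (w j) = 1 by exact: unit_family_nsq uw.
have evlin l : ev w (lin_form l) = \sum_i l.1 i *: ev w (line_form i) - l.2.
  rewrite evD evN !ev_sum; congr (_ - _); first by apply: eq_bigr => i _; rewrite evZ.
  rewrite -[RHS]row_basis; apply: eq_bigr => k _.
  by rewrite evZ ev_delta; case: uw => ->.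
split=> [h|[h1 h2 h3 h4] a].
  have hl i a : a \in line_rels i -> ev w a = 0.
    move=> ai; apply: h; rewrite mem_system_rels; apply/or3P; apply: Or31.
    by apply/flattenP; exists (line_rels i) => //; rewrite map_f ?mem_enum.
  have hq q a : a \in inv_rels q -> ev w a = 0.
    move=> aq; apply: h; rewrite mem_system_rels; apply/or3P; apply: Or32.
    by apply/flattenP; exists (inv_rels q) => //; rewrite map_f ?mem_enum.
  split=> [i b|i|q|l ll].
  - apply/rhombus_relsP => // a ab; apply: (hl i); rewrite mem_line_rels.
    by apply/or3P; case: b ab => ab; [apply: Or32|apply: Or31].
  - have : ev w (y_form i - (5 / 8) *: (delta R (circle_unit i) + normal_form i)) = 0.
      by apply: (hl i); rewrite mem_line_rels; apply/or3P; apply: Or33; exact: mem_head.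
    by rewrite evD evN evZ evD ev_delta ev_normal // => /subr0_eq.
  - by apply/rhombus_relsP => // a; exact: hq.
  - have : ev w (lin_form l) = 0 by apply: h; rewrite mem_system_rels; apply/or3P; apply: Or33; exact: map_f.
    by rewrite evlin => /subr0_eq.
rewrite mem_system_rels => /or3P[/flattenP[s /mapP[i _ ->]]|/flattenP[s /mapP[q _ ->]]|/mapP[l ll ->]].
- rewrite mem_line_rels => /or3P[ai|ai|].
  + by have /rhombus_relsP := h1 i false; apply.
  + by have /rhombus_relsP := h1 i true; apply.
  + rewrite inE => /eqP->; rewrite evD evN evZ evD ev_delta ev_normal // h2 subrr //.
- by have /rhombus_relsP := h3 q; apply.
- by rewrite evlin h4 // subrr.
Qed.

Lemma inv_leg_sqr : inv_leg ^+ 2 = 16 - kap.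
Proof. by case/andP: kap_bound => _ h; rewrite sqr_sqrtr // subr_ge0 ltW. Qed.

Lemma inv_leg_gt0 : 0 < inv_leg.
Proof. by case/andP: kap_bound => _ h; rewrite sqrtr_gt0 subr_gt0. Qed.

Lemma pv_e0 (f : frame R n') y : fr_cos f = 1 -> pv f 0 y = y *: delta_mx 0 ord0.
Proof.
move=> c1; have s0 : fr_sin f = 0.
  by apply/eqP; rewrite -sqrf_eq0; apply/eqP; have := fr_unit f; rewrite c1 expr1n; lra.
by rewrite /pv c1 s0 mulr0 mul1r add0r mulr0 mul0r addr0 scale0r addr0.
Qed.

(** The gadgets by themselves only give [t i ^+ 2 <= 9]. Strictness keeps the rhombi nondegenerate;
    it is obtained later from the scaling of the variables. *)
Definition good_values (t : I -> R) : Prop := [/\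
  forall i, t i ^+ 2 < 9, forall q, t (qx q) * t (qy q) = kap &
  forall l, l \in lins -> \sum_i l.1 i *: pv (fr i) 0 (t i) = l.2].

Definition system_sol (t : I -> R) (c : I * bool -> bool) (d : Q -> bool) (j : J) : 'rV[R]_n :=
  match j with
  | inl k => delta_mx 0 k
  | inr (inl (inl (i, b, r))) =>
      rhombus_sol (fr i) (arm R b) (leg R b) 4 (t i) (inv_ratio (t i)) (c (i, b)) r
  | inr (inl (inr i)) =>
      pv (fr i) (8 / 5 * (inv_ratio (t i) * 4) - 1) (8 / 5 * (inv_ratio (t i) * t i))
  | inr (inr (q, r)) =>
      rhombus_sol (fr (qx q)) 4 inv_leg 0 (t (qx q)) (t (qy q) / t (qx q)) (d q) r
  end.

Lemma arm_neq0 b : arm R b != 0. Proof. by case: b; rewrite /arm lt0r_neq0 //; lra. Qed.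
Lemma leg_neq0 b : leg R b != 0. Proof. by case: b; rewrite /leg lt0r_neq0 //; lra. Qed.

Section GoodValues.
Variable t : I -> R.
Hypothesis gt : good_values t.

Lemma inv_qx_neq0 q : t (qx q) != 0.
Proof.
case: gt => _ /(_ q) h _; apply/eqP => t0; move: h; rewrite t0 mul0r.
by case/andP: kap_bound; lra.
Qed.

Lemma inv_rho_gt0 q : 0 < 0 ^+ 2 + t (qx q) ^+ 2.
Proof. by rewrite expr0n add0r lt_def sqr_ge0 sqrf_eq0 inv_qx_neq0. Qed.

Lemma inv_kappa q :
  t (qy q) / t (qx q) * (0 ^+ 2 + t (qx q) ^+ 2) = 4 ^+ 2 - inv_leg ^+ 2.
Proof.
have h := inv_qx_neq0 q; case: gt => _ /(_ q) k _; rewrite inv_leg_sqr expr0n add0r.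
have -> : t (qy q) / t (qx q) * t (qx q) ^+ 2 = t (qx q) * t (qy q) by field.
by rewrite k; ring.
Qed.

Lemma inv_nondeg q :
  0 < 4 ^+ 2 - (0 ^+ 2 + t (qx q) ^+ 2) * (1 + t (qy q) / t (qx q)) ^+ 2 / 4.
Proof.
have h := inv_qx_neq0 q; case: gt => h9 _ _; rewrite expr0n add0r.
(* Both values are below 3 in absolute value, so the midpoint of the diagonal is closer to 0 than
   the arm length 4. *)
have -> : 4 ^+ 2 - t (qx q) ^+ 2 * (1 + t (qy q) / t (qx q)) ^+ 2 / 4 =
  16 - (t (qx q) + t (qy q)) ^+ 2 / 4 by field.
have := h9 (qx q); have := h9 (qy q); have := sqr_ge0 (t (qx q) - t (qy q)); nra.
Qed.

Lemma line_rhombus i b c : rhombus (arm R b) (leg R b)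
  (rhombus_sol (fr i) (arm R b) (leg R b) 4 (t i) (inv_ratio (t i)) c)
  (pv (fr i) 4 (t i)) (pv (fr i) (inv_ratio (t i) * 4) (inv_ratio (t i) * t i)).
Proof.
apply: rhombus_solP; [exact: arm_neq0|exact: leg_neq0|exact: rho_gt0| |].
  by rewrite arm_leg inv_ratioE.
by apply: line_nondeg; case: gt.
Qed.

Lemma inv_rhombus q c : rhombus 4 inv_leg
  (rhombus_sol (fr (qx q)) 4 inv_leg 0 (t (qx q)) (t (qy q) / t (qx q)) c)
  (pv (fr (qx q)) 0 (t (qx q))) (pv (fr (qy q)) 0 (t (qy q))).
Proof.
have -> : pv (fr (qy q)) 0 (t (qy q)) =
    pv (fr (qx q)) (t (qy q) / t (qx q) * 0) (t (qy q) / t (qx q) * t (qx q)).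
  by rewrite mulr0 divfK ?inv_qx_neq0 // !pv_e0.
apply: rhombus_solP.
- by rewrite pnatr_eq0.
- by rewrite gt_eqF // inv_leg_gt0.
- exact: inv_rho_gt0.
- exact: inv_kappa.
- exact: inv_nondeg.
Qed.

Lemma rhombus_eq (L s : R) u x y x' y' : rhombus L s u x y -> x = x' -> y = y' ->
  rhombus L s (u : _ -> 'rV[R]_n) x' y'.
Proof. by move=> h <- <-. Qed.

Lemma system_sol_in_plane c d k : in_plane (unit_frame k) (system_sol t c d (inr k)).
Proof.
by case: k => [[[[i b] [[] []]]|i]|[q [[] []]]] /=; exact: pv_in_plane.
Qed.

Lemma system_sol_unit c d : unit_family unit_zeros (system_sol t c d).
Proof.
split=> // k; split; last exact: system_sol_in_plane.
case: k => [[[[i b] r]|i]|[q r]] /=.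
- by case: (line_rhombus i b (c (i, b))).
- rewrite nsq_pv; have := inv_ratioE (t i); set m := inv_ratio (t i) => m5.
  have -> : (8 / 5 * (m * 4) - 1) ^+ 2 + (8 / 5 * (m * t i)) ^+ 2 =
    64 / 25 * m * (m * (4 ^+ 2 + t i ^+ 2)) - 64 / 5 * m + 1 by field.
  by rewrite m5; field.
- by case: (inv_rhombus q (d q)).
Qed.

Lemma system_sol_x c d i : ev (system_sol t c d) (x_form i) = pv (fr i) 4 (t i).
Proof. by rewrite ev_x_form; case: (line_rhombus i false (c (i, false))). Qed.

Lemma system_sol_y c d i : ev (system_sol t c d) (y_form i) =
  pv (fr i) (inv_ratio (t i) * 4) (inv_ratio (t i) * t i).
Proof. by rewrite ev_y_form; case: (line_rhombus i false (c (i, false))). Qed.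

Lemma system_sol_line c d i : ev (system_sol t c d) (line_form i) = pv (fr i) 0 (t i).
Proof.
rewrite ev_line_form system_sol_x ev_normal; last exact: system_sol_unit.
by rewrite pvZ pvN pvD; congr pv; ring.
Qed.

Lemma system_sol_rels c d a : a \in system_rels -> ev (system_sol t c d) a = 0.
Proof.
apply: (proj2 (system_relsP (system_sol_unit c d))); split=> [i b|i|q|l ll].
- exact: (rhombus_eq (line_rhombus i b (c (i, b))) (esym (system_sol_x c d i))
    (esym (system_sol_y c d i))).
- have -> : system_sol t c d (circle_unit i) =
    pv (fr i) (8 / 5 * (inv_ratio (t i) * 4) - 1) (8 / 5 * (inv_ratio (t i) * t i)) by [].
  rewrite system_sol_y; move: (inv_ratio (t i)) (t i) => m x.
  rewrite pvD pvZ addrNK addr0.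
  by congr pv; field.
- exact: (rhombus_eq (inv_rhombus q (d q)) (esym (system_sol_line c d (qx q)))
    (esym (system_sol_line c d (qy q)))).
- by under eq_bigr do rewrite system_sol_line; case: gt => _ _; apply.
Qed.

Lemma system_sol_inj c d c' d' : (forall j, system_sol t c d j = system_sol t c' d' j) ->
  c =1 c' /\ d =1 d'.
Proof.
move=> e; split=> [[i b]|q].
  have t9 : t i ^+ 2 < 9 by case: gt.
  exact: (rhombus_sol_inj (arm_neq0 b) (rho_gt0 (t i)) (line_nondeg b t9)
    (e (line_unit i b (false, false)))).
have L0 : 4 != 0 :> R by rewrite pnatr_eq0.
exact: (rhombus_sol_inj L0 (inv_rho_gt0 q) (inv_nondeg q) (e (inv_unit q (false, false)))).
Qed.

End GoodValues.

(** An arbitrary configuration yields only the closed bound on [t]. Completeness of the list of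
    branches is conditional on good values, which the arithmetic of the relations supplies
    afterwards. *)
Lemma system_sound w : unit_family unit_zeros w ->
  (forall a, a \in system_rels -> ev w a = 0) ->
  exists t : I -> R, [/\ forall i, ev w (line_form i) = pv (fr i) 0 (t i),
    forall i, t i ^+ 2 <= 9, forall q, t (qx q) * t (qy q) = kap,
    forall l, l \in lins -> \sum_i l.1 i *: pv (fr i) 0 (t i) = l.2 &
    good_values t -> exists c d, forall j, w j = system_sol t c d j].
Proof.
move=> uw /(system_relsP uw)[h1 h2 h3 h4].
have planar k : in_plane (unit_frame k) (w (inr k)) by exact: unit_family_in_plane.
have w1 j : nsq (w j) = 1 by exact: unit_family_nsq uw.
have /choice[t ht] i : exists t : R, [/\ t ^+ 2 <= 9, ev w (x_form i) = pv (fr i) 4 t &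
    ev w (y_form i) = pv (fr i) (inv_ratio t * 4) (inv_ratio t * t)].
  have p1 b r : in_plane (fr i) (w (line_unit i b r)).
    exact: planar (inl (inl (i, b, r))).
  exact: (line_gadget p1 (w1 (circle_unit i)) (fun b => h1 i b) (h2 i)).
have hl i : ev w (line_form i) = pv (fr i) 0 (t i).
  have [_ hx _] := ht i; have hn := ev_normal i uw.
  apply: etrans (ev_line_form w i) _.
  apply: etrans (congr2 (fun a b => a - 4 *: b) hx hn) _.
  rewrite pvZ pvN pvD.
  by congr pv; ring.
have hk q : t (qx q) * t (qy q) = kap.
  have := rhombus_dot (h3 q); rewrite !hl !pv_e0 // dotZl dotZr.
  rewrite -/(nsq (delta_mx 0 ord0)) nsq_delta inv_leg_sqr mulr1 => ->; ring.
exists t; split=> //.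
- by move=> i; case: (ht i).
- by move=> l /h4; under eq_bigr do rewrite hl.
move=> g.
have /choice[c hc] (ib : I * bool) : exists b, forall r, w (line_unit ib.1 ib.2 r) =
    rhombus_sol (fr ib.1) (arm R ib.2) (leg R ib.2) 4 (t ib.1) (inv_ratio (t ib.1)) b r.
  case: ib => i b /=.
  apply: (@rhombus_complete _ _ _ _ _ 4 (t i) (inv_ratio (t i)) (arm_neq0 b) (leg_neq0 b)
    (rho_gt0 _) _ _ (w \o line_unit i b)).
  - by rewrite arm_leg inv_ratioE.
  - by apply: line_nondeg; case: g.
  - by move=> r; exact: planar (inl (inl (i, b, r))).
  - by apply: rhombus_eq (h1 i b) _ _; case: (ht i).
have /choice[d hd] q : exists b, forall r, w (inv_unit q r) =
    rhombus_sol (fr (qx q)) 4 inv_leg 0 (t (qx q)) (t (qy q) / t (qx q)) b r.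
  have L0 : 4 != 0 :> R by rewrite pnatr_eq0.
  have l0 : inv_leg != 0 by rewrite gt_eqF // inv_leg_gt0.
  apply: (@rhombus_complete _ _ _ _ _ 0 (t (qx q)) (t (qy q) / t (qx q)) L0 l0
    (inv_rho_gt0 g q) (inv_kappa g q) (inv_nondeg g q) (w \o inv_unit q)).
  - by move=> r; exact: planar (inr (q, r)).
  - apply: rhombus_eq (h3 q) _ _; rewrite !hl //.
    by rewrite mulr0 divfK ?inv_qx_neq0 // !pv_e0.
exists c, d => -[k|[[[[i b] r]|i]|[q r]]] /=.
- by case: uw.
- exact: (hc (i, b)).
- have : (8 / 5) *: ev w (y_form i) = w (circle_unit i) + pv (fr i) 1 0.
    by rewrite h2 scalerA (_ : 8 / 5 * (5 / 8) = 1) ?scale1r //; field.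
  move=> /(congr1 (fun z => z - pv (fr i) 1 0)); rewrite addrK /circle_unit => <-.
  case: (ht i) => _ _ ->; rewrite pvZ pvN pvD; congr pv; ring.
- exact: hd.
Qed.

End LineSystem.

(** * Arithmetic by inversions *)

Section Arithmetic.
Variables (R : realType) (D : nat) (Y : set 'rV[R]_D).
Variable A : ('rV[R]_D -> R) -> Prop.
Hypotheses (A_cst : forall k, A (fun=> k)) (A_coord : forall i, A (fun y => y 0 i))
  (A_add : forall g h, A g -> A h -> A (fun y => g y + h y))
  (A_mul : forall g h, A g -> A h -> A (fun y => g y * h y))
  (A_inv : forall g, A g -> (forall y, Y y -> g y != 0) -> A (fun y => (g y)^-1)).
Hypothesis coord_bounded : forall i, exists K, forall y, Y y -> `|y 0 i| <= K.

Definition bounded_on (g : 'rV[R]_D -> R) := exists K, forall y, Y y -> `|g y| <= K.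
(** [A] will be analyticity along the given sections; the bound on [Y] serves to rescale variables
    into the range of the gadgets. *)
Definition admissible g := bounded_on g /\ A g.

Lemma admissible_cst k : admissible (fun=> k).
Proof. by split=> //; exists `|k|. Qed.

Lemma admissible_coord i : admissible (fun y => y 0 i).
Proof. by split=> //; exact: coord_bounded. Qed.

Lemma admissibleD g h : admissible g -> admissible h -> admissible (fun y => g y + h y).
Proof.
move=> [[K gK] ag] [[K' hK] ah]; split; last exact: A_add.
by exists (K + K') => y Yy; apply: le_trans (ler_normD _ _) _; rewrite lerD ?gK ?hK.
Qed.

Lemma admissibleM g h : admissible g -> admissible h -> admissible (fun y => g y * h y).
Proof.
move=> [[K gK] ag] [[K' hK] ah]; split; last exact: A_mul.
by exists (K * K') => y Yy; rewrite normrM ler_pM ?gK ?hK.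
Qed.

Definition lincomb (l : seq (R * nat)) (t : nat -> R) : R := \sum_(x <- l) x.1 * t x.2.

Lemma eq_lincomb l t t' : (forall x, x \in l -> t x.2 = t' x.2) -> lincomb l t = lincomb l t'.
Proof. by move=> e; rewrite /lincomb big_seq [RHS]big_seq; apply: eq_bigr => x /e ->. Qed.

Lemma admissible_lincomb l (T : nat -> 'rV[R]_D -> R) : (forall i, admissible (T i)) ->
  admissible (fun y => lincomb l (T ^~ y)).
Proof.
move=> aT; elim: l => [|x l IH].
  by under eq_fun do rewrite /lincomb big_nil; exact: admissible_cst.
under eq_fun do rewrite /lincomb big_cons.
by apply: admissibleD => //; apply: admissibleM => //; exact: admissible_cst.
Qed.

Implicit Types (CL : seq (seq (R * nat) * R)) (CI : seq (nat * nat)) (M : nat)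
  (T : nat -> 'rV[R]_D -> R).

Definition solves CL CI (t : nat -> R) : Prop :=
  (forall x, x \in CL -> lincomb x.1 t = x.2) /\ (forall p, p \in CI -> t p.1 * t p.2 = 1).

Definition head_of (t : nat -> R) : 'rV[R]_D := \row_i t i.

(* Linear and inversion constraints in the variables t_0, ..., t_(M-1), the
   first D of which are free; the others are the functions T of these. *)
Record arith M CL CI T : Prop := Arith {
  ar_dim : (D <= M)%N;
  ar_lin : forall x, x \in CL -> forall z, z \in x.1 -> (z.2 < M)%N;
  ar_inv : forall p, p \in CI -> (p.1 < M)%N /\ (p.2 < M)%N;
  ar_coord : forall (i : 'I_D) y, T i y = y 0 i;
  ar_sound : forall t, solves CL CI t -> forall i, (i < M)%N -> t i = T i (head_of t);
  ar_compl : forall y, Y y -> solves CL CI (T ^~ y);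
  ar_adm : forall i, admissible (T i) }.

Lemma arith0 : exists T, arith D [::] [::] T.
Proof.
exists (fun i y => if insub i is Some j then y 0 j else 0); split=> //.
- by move=> i y; rewrite valK.
- by move=> t _ i iD; rewrite insubT mxE.
- by move=> i; case: insub => [j|]; [exact: admissible_coord|exact: admissible_cst].
Qed.

Definition extends M CL CI T M' CL' CI' T' := [/\ (M <= M')%N,
  forall i y, (i < M)%N -> T' i y = T i y & forall t, solves CL' CI' t -> solves CL CI t].

Lemma extends_trans M CL CI T M' CL' CI' T' M'' CL'' CI'' T'' :
  extends M CL CI T M' CL' CI' T' -> extends M' CL' CI' T' M'' CL'' CI'' T'' ->
  extends M CL CI T M'' CL'' CI'' T''.
Proof.
move=> [h1 e1 s1] [h2 e2 s2]; split=> [|i y iM|t /s2 /s1 //]; first exact: leq_trans h2.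
by rewrite e2 ?e1 // (leq_trans iM).
Qed.

Definition newvar M T g : nat -> 'rV[R]_D -> R := fun i => if i == M then g else T i.

Lemma newvar_old M T g i y : (i < M)%N -> newvar M T g i y = T i y.
Proof. by move=> iM; rewrite /newvar ltn_eqF. Qed.

Lemma newvar_new M T g y : newvar M T g M y = g y.
Proof. by rewrite /newvar eqxx. Qed.

Lemma newvar_admissible M T g i : (forall i, admissible (T i)) -> admissible g ->
  admissible (newvar M T g i).
Proof. by rewrite /newvar; case: eqP. Qed.

Lemma solves_newvar M CL CI T g y : arith M CL CI T -> Y y ->
  solves CL CI (newvar M T g ^~ y).
Proof.
move=> ar Yy; have [h1 h2] := ar_compl ar Yy; split=> [x xC|p pC].
  rewrite -(h1 x xC); apply: eq_lincomb => z zx; rewrite newvar_old //.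
  exact: (ar_lin ar xC zx).
by have [p1 p2] := ar_inv ar pC; rewrite !newvar_old // h2.
Qed.

Lemma arith_lin M CL CI T l c : arith M CL CI T -> (forall z, z \in l -> z.2 < M)%N ->
  exists CL' T', [/\ arith M.+1 CL' CI T', extends M CL CI T M.+1 CL' CI T' &
    forall y, T' M y = lincomb l (T ^~ y) + c].
Proof.
move=> ar lM; pose g y := lincomb l (T ^~ y) + c.
exists ((((-1), M) :: l, - c) :: CL), (newvar M T g); split; last 2 first.
- split=> // [i y|t [h1 h2]]; first exact: newvar_old.
  by split=> // x xC; apply: h1; rewrite inE xC orbT.
- by move=> y; rewrite newvar_new.
have lE y : lincomb l (newvar M T g ^~ y) = lincomb l (T ^~ y).
  by apply: eq_lincomb => z zl; rewrite newvar_old // lM.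
split.
- exact: leqW (ar_dim ar).
- move=> x; rewrite inE => /orP[/eqP-> z|xC z zx].
    by rewrite inE => /orP[/eqP->|/lM] //=; exact: leqW.
  exact/leqW/(ar_lin ar xC zx).
- by move=> p /(ar_inv ar)[p1 p2]; split; exact: leqW.
- by move=> i y; rewrite newvar_old ?(ar_coord ar) // (leq_trans (ltn_ord i)) ?(ar_dim ar).
- move=> t [h1 h2].
  have st : solves CL CI t by split=> // x xC; apply: h1; rewrite inE xC orbT.
  have old := ar_sound ar st.
  move=> i; rewrite ltnS leq_eqVlt => /orP[/eqP->|iM]; last by rewrite newvar_old // old.
  rewrite newvar_new /g.
  have := h1 _ (mem_head _ _); rewrite /lincomb big_cons /= -/(lincomb l t).
  have -> : lincomb l t = lincomb l (T ^~ (head_of t)).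
    by apply: eq_lincomb => z /lM /old.
  by rewrite /lincomb; lra.
- move=> y Yy; have [h1 h2] := solves_newvar g ar Yy; split=> // x.
  rewrite inE => /orP[/eqP-> /=|/h1 //].
  have := lE y; rewrite /lincomb big_cons /= newvar_new => ->; rewrite /g /lincomb; ring.
- move=> i; apply: newvar_admissible; first exact: (ar_adm ar).
  apply: admissibleD; last exact: admissible_cst.
  by apply: admissible_lincomb; exact: (ar_adm ar).
Qed.

(** A solution [t] may not come from a point of [Y], so [ginv] asks that the new variable be a
    function of the free ones for every solution. The recorded [t i != 0] justifies later
    cancellations outside [Y]. *)
Lemma arith_inv M CL CI T i g : arith M CL CI T -> (i < M)%N ->
  (forall y, Y y -> T i y * g y = 1) ->
  (forall t x, solves CL CI t -> t i * x = 1 -> x = g (head_of t)) -> admissible g ->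
  exists CI' T', [/\ arith M.+1 CL CI' T', extends M CL CI T M.+1 CL CI' T', forall y, T' M y = g y &
    forall t, solves CL CI' t -> t i != 0].
Proof.
move=> ar iM gT ginv ag; exists ((i, M) :: CI), (newvar M T g); split; last 3 first.
- split=> // [j y|t [h1 h2]]; first exact: newvar_old.
  by split=> // p pC; apply: h2; rewrite inE pC orbT.
- by move=> y; rewrite newvar_new.
- move=> t [_ h]; apply/eqP => t0; have := h _ (mem_head _ _).
  by rewrite /= t0 mul0r => /esym/eqP; rewrite oner_eq0.
split.
- exact: leqW (ar_dim ar).
- by move=> x xC z zx; exact/leqW/(ar_lin ar xC zx).
- move=> p; rewrite inE => /orP[/eqP-> /=|/(ar_inv ar)[p1 p2]]; last by split; exact: leqW.
  by split=> //; exact: leqW.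
- by move=> j y; rewrite newvar_old ?(ar_coord ar) // (leq_trans (ltn_ord j)) ?(ar_dim ar).
- move=> t [h1 h2].
  have st : solves CL CI t by split=> // p pC; apply: h2; rewrite inE pC orbT.
  have old := ar_sound ar st.
  move=> j; rewrite ltnS leq_eqVlt => /orP[/eqP->|jM]; last by rewrite newvar_old // old.
  rewrite newvar_new; apply: ginv => //; exact: (h2 _ (mem_head _ _)).
- move=> y Yy; have [h1 h2] := solves_newvar g ar Yy; split=> // p.
  rewrite inE => /orP[/eqP-> /=|/h2 //].
  by rewrite newvar_new newvar_old // gT.
- move=> j; apply: newvar_admissible => //; exact: (ar_adm ar).
Qed.

(** Quantifying over the system to be extended lets definitions be chained without merging two
    systems. *)
Definition definable g := forall M CL CI T, arith M CL CI T ->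
  exists M' CL' CI' T' k, [/\ arith M' CL' CI' T', extends M CL CI T M' CL' CI' T', (k < M')%N &
    forall y, T' k y = g y].

Lemma definable_cst c : definable (fun=> c).
Proof.
move=> M CL CI T ar; have [//|CL' [T' [ar' e h]]] := @arith_lin _ _ _ _ [::] c ar.
exists M.+1, CL', CI, T', M; split=> // y.
by rewrite h /lincomb big_nil add0r.
Qed.

Lemma definable_coord i : definable (fun y => y 0 i).
Proof.
move=> M CL CI T ar; exists M, CL, CI, T, (nat_of_ord i); split=> //.
- by rewrite (leq_trans (ltn_ord i)) ?(ar_dim ar).
- by move=> y; rewrite (ar_coord ar).
Qed.

Lemma eq_definable g h : g =1 h -> definable g -> definable h.
Proof. by move=> /funext ->. Qed.

Lemma definable_lin g h a b : definable g -> definable h ->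
  definable (fun y => a * g y + b * h y).
Proof.
move=> dg dh M CL CI T ar.
have [M1 [CL1 [CI1 [T1 [k1 [ar1 e1 k1M h1]]]]]] := dg _ _ _ _ ar.
have [M2 [CL2 [CI2 [T2 [k2 [ar2 e2 k2M h2]]]]]] := dh _ _ _ _ ar1.
have k1M2 : (k1 < M2)%N by apply: leq_trans k1M _; case: e2.
have [|CL' [T' [ar' e3 h3]]] := @arith_lin _ _ _ _ [:: (a, k1); (b, k2)] 0 ar2.
  by move=> z; rewrite !inE => /orP[]/eqP->.
exists M2.+1, CL', CI2, T', M2; split=> //.
  exact: extends_trans e1 (extends_trans e2 e3).
move=> y; rewrite h3 /lincomb !big_cons big_nil /= h2 !addr0.
by case: e2 => _ -> // _; rewrite ?h1.
Qed.

(* With p = 1 / (1 - z) and q = 1 / (1 + z), the inverse of p + q is (1 - z^2) / 2. *)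
Lemma definable_sqr_small z : definable z -> admissible z ->
  (forall y, Y y -> `|z y| <= 2^-1) -> definable (fun y => z y ^+ 2).
Proof.
move=> dz az zs M CL CI T ar.
have [M1 [CL1 [CI1 [T1 [k1 [ar1 e1 k1M h1]]]]]] := dz _ _ _ _ ar.
have zb y : Y y -> -2^-1 <= z y <= 2^-1 by move=> /zs; rewrite ler_norml.
have am : admissible (fun y => 1 + -1 * z y).
  by apply: admissibleD; [exact: admissible_cst|apply: admissibleM => //; exact: admissible_cst].
have ap : admissible (fun y => 1 + z y).
  by apply: admissibleD => //; exact: admissible_cst.
have small (u : 'rV[R]_D -> R) : admissible u -> (forall y, Y y -> 2^-1 <= u y) ->
    admissible (fun y => (u y)^-1).
  move=> [_ au] ub; split; last first.
    by apply: A_inv => // y /ub; apply: contraTneq => ->; rewrite -ltNge invr_gt0.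
  exists 2 => y /ub uy; have u0 : 0 < u y by apply: lt_le_trans uy; rewrite invr_gt0.
  by rewrite normfV gtr0_norm // -[2]invrK lef_pV2 // posrE invr_gt0.
have [|CL2 [T2 [ar2 e2 h2]]] := @arith_lin _ _ _ _ [:: (-1, k1)] 1 ar1.
  by move=> x; rewrite inE => /eqP->.
have [_ x2 _] := e2.
have h2' y : T2 M1 y = 1 - z y.
  by rewrite h2 /lincomb big_seq1 /= h1; ring.
have k1T2 y : T2 k1 y = z y by rewrite x2.
have [||||CI3 [T3 [ar3 e3 h3 n3]]] := @arith_inv _ _ _ _ M1 (fun y => (1 + -1 * z y)^-1) ar2.
- exact: ltnSn.
- move=> y /zb zy; rewrite h2' mulN1r divff //; apply/eqP; lra.
- move=> t x st tx; have := ar_sound ar2 st (ltnSn M1); rewrite h2' => tE.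
  rewrite mulN1r -tE; have t0 : t M1 != 0.
    by apply/eqP => t0; move: tx; rewrite t0 mul0r => /esym/eqP; rewrite oner_eq0.
  by apply: (mulfI t0); rewrite tx divff.
- by apply: small => // y /zb; lra.
have [_ x3 _] := e3.
have T3k y : T3 k1 y = z y by rewrite x3 ?k1T2 //; lia.
have [|CL4 [T4 [ar4 e4 h4]]] := @arith_lin _ _ _ _ [:: (1, k1)] 1 ar3.
  by move=> x; rewrite inE => /eqP-> /=; lia.
have [_ x4 _] := e4.
have h4' y : T4 M1.+2 y = 1 + z y.
  by rewrite h4 /lincomb big_seq1 /= T3k; ring.
have T4p y : T4 M1.+1 y = (1 - z y)^-1 by rewrite x4 ?h3 ?mulN1r //; lia.
have T4m y : T4 M1 y = 1 - z y.
  by rewrite x4 ?x3 ?h2' //; lia.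

have [||||CI5 [T5 [ar5 e5 h5 n5]]] := @arith_inv _ _ _ _ M1.+2 (fun y => (1 + z y)^-1) ar4.
- exact: ltnSn.
- move=> y /zb zy; rewrite h4' divff //; apply/eqP; lra.
- move=> t x st tx; have := ar_sound ar4 st (ltnSn M1.+2); rewrite h4' => tE.
  rewrite -tE; have t0 : t M1.+2 != 0.
    by apply/eqP => t0; move: tx; rewrite t0 mul0r => /esym/eqP; rewrite oner_eq0.
  by apply: (mulfI t0); rewrite tx divff.
- by apply: small => // y /zb; lra.
have [_ x5 _] := e5.
have T5q y : T5 M1.+3 y = (1 + z y)^-1 by rewrite h5.
have T5p y : T5 M1.+1 y = (1 - z y)^-1 by rewrite x5 ?T4p //; lia.
have T5u y : T5 M1.+2 y = 1 + z y by rewrite x5 ?h4' //; lia.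
have T5m y : T5 M1 y = 1 - z y by rewrite x5 ?T4m //; lia.
have [|CL6 [T6 [ar6 e6 h6]]] := @arith_lin _ _ _ _ [:: (1, M1.+1); (1, M1.+3)] 0 ar5.
  by move=> x; rewrite !inE => /orP[] /eqP-> /=; lia.
have [_ x6 _] := e6.
have h6' y : T6 M1.+4 y = (1 - z y)^-1 + (1 + z y)^-1.
  by rewrite h6 /lincomb !big_cons big_nil /= T5p T5q; ring.
have [||||CI7 [T7 [ar7 e7 h7 n7]]] :=
    @arith_inv _ _ _ _ M1.+4 (fun y => 2^-1 * (1 + -1 * (z y * z y))) ar6.
- exact: ltnSn.
- move=> y /zb zy; rewrite h6'; field; apply/andP; split; apply/eqP; lra.
(* The bound on [z] is known only on [Y]. For a general solution, the two inversions already present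
   force 1 - z and 1 + z to be nonzero. *)
- move=> t x st tx; have tE := ar_sound ar6 st (ltnSn M1.+4); rewrite h6' in tE.
  have st5 : solves CL4 CI5 t by case: e6 => _ _; apply.
  have st4 : solves CL4 CI3 t by case: e5 => _ _; apply.
  have st3 : solves CL2 CI3 t by case: e4 => _ _; apply.
  have t1 : t M1 = 1 - z (head_of t).
    by rewrite (ar_sound ar6 st) ?x6 ?T5m //; lia.
  have t2 : t M1.+2 = 1 + z (head_of t).
    by rewrite (ar_sound ar6 st) ?x6 ?T5u //; lia.
  move: (n3 _ st3) (n5 _ st5); rewrite t1 t2 => z1 z2.
  have tn : t M1.+4 != 0.
    by apply/eqP => t0; move: tx; rewrite t0 mul0r => /esym/eqP; rewrite oner_eq0.
  apply: (mulfI tn); rewrite tx tE; field; by rewrite z1 z2.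
- apply: admissibleM; first exact: admissible_cst.
  apply: admissibleD; first exact: admissible_cst.
  by apply: admissibleM; [exact: admissible_cst|exact: admissibleM].
(* z^2 is recovered as 1 - 2 ((1 - z^2) / 2). *)
have [|CL8 [T8 [ar8 e8 h8]]] := @arith_lin _ _ _ _ [:: (-2, M1.+4.+1)] 1 ar7.
  by move=> x; rewrite inE => /eqP->.
exists M1.+4.+3, CL8, CI7, T8, M1.+4.+2; split=> //.
- apply: extends_trans e1 (extends_trans e2 (extends_trans e3 (extends_trans e4
    (extends_trans e5 (extends_trans e6 (extends_trans e7 e8)))))).
- move=> y; rewrite h8 /lincomb big_seq1 /= h7; by field.
Qed.

(** Polarization: 4 g h = (g + h)^2 - (g - h)^2. Boundedness allows a division by [K'] before
    squaring, to reach the range of [definable_sqr_small]. *)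
Lemma definable_mul g h : definable g -> admissible g -> definable h -> admissible h ->
  definable (fun y => g y * h y).
Proof.
move=> dg ag dh ah.
have sq (a b : R) : definable (fun y => (a * g y + b * h y) ^+ 2).
  have du := definable_lin a b dg dh.
  have au : admissible (fun y => a * g y + b * h y).
    by apply: admissibleD; apply: admissibleM => //; exact: admissible_cst.
  have [[K uK] _] := au.
  pose K' := 2 * (`|K| + 1); have K0 : 0 < K' by rewrite mulr_gt0 // ltr_wpDl.
  have dz : definable (fun y => K'^-1 * (a * g y + b * h y)).
    apply: eq_definable (definable_lin K'^-1 0 du du) => y; ring.
  have az : admissible (fun y => K'^-1 * (a * g y + b * h y)).
    by apply: admissibleM => //; exact: admissible_cst.
  have zs y : Y y -> `|K'^-1 * (a * g y + b * h y)| <= 2^-1.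
    move=> /uK uy; rewrite normrM (gtr0_norm (_ : 0 < K'^-1)) ?invr_gt0 //.
    rewrite ler_pdivrMl //; apply: le_trans uy _.
    by rewrite /K' mulrAC divff ?mul1r ?pnatr_eq0 //; have := ler_norm K; lra.
  have ds := definable_sqr_small dz az zs.
  apply: eq_definable (definable_lin (K' ^+ 2) 0 ds ds) => y.
  field; by rewrite gt_eqF.
apply: eq_definable (definable_lin 4^-1 (- 4^-1) (sq 1 1) (sq 1 (-1))) => y.
by field.
Qed.

Definition good g := definable g /\ admissible g.

Lemma good_cst k : good (fun=> k).
Proof. by split; [exact: definable_cst|exact: admissible_cst]. Qed.

Lemma goodD g h : good g -> good h -> good (fun y => g y + h y).
Proof.
move=> [dg ag] [dh ah]; split; last exact: admissibleD.
by apply: eq_definable (definable_lin 1 1 dg dh) => y; rewrite !mul1r.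
Qed.

Lemma goodM g h : good g -> good h -> good (fun y => g y * h y).
Proof. by move=> [dg ag] [dh ah]; split; [exact: definable_mul|exact: admissibleM]. Qed.

Lemma good_coord i : good (fun y => y 0 i).
Proof. by split; [exact: definable_coord|exact: admissible_coord]. Qed.

Lemma good_meval (P : mpoly.mpoly D R) : good (fun y => mpoly.meval (fun i => y 0 i) P).
Proof.
under eq_fun do rewrite mpoly.mevalE.
elim: (mpoly.msupp P) => [|m s IH].
  by under eq_fun do rewrite big_nil; exact: good_cst.
under eq_fun do rewrite big_cons; apply: goodD => //.
apply: goodM; first exact: good_cst.
elim: (index_enum 'I_D) => [|i r IHr].
  by under eq_fun do rewrite big_nil; exact: good_cst.
under eq_fun do rewrite big_cons; apply: goodM => //.
elim: (mpoly.fun_of_multinom m i) => [|k IHk].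
  by under eq_fun do rewrite expr0; exact: good_cst.
by under eq_fun do rewrite exprS; apply: goodM => //; exact: good_coord.
Qed.

Lemma arith_define (I : eqType) (g : I -> 'rV[R]_D -> R) (s : seq I) :
  (forall i, definable (g i)) -> exists M CL CI T, arith M CL CI T /\
    forall i, i \in s -> exists2 k, (k < M)%N & forall y, T k y = g i y.
Proof.
move=> dg; elim: s => [|i s [M [CL [CI [T [ar h]]]]]].
  by have [T ar] := arith0; exists D, [::], [::], T.
have [M' [CL' [CI' [T' [k [ar' [MM e _] kM hk]]]]]] := dg i _ _ _ _ ar.
exists M', CL', CI', T'; split=> // j; rewrite inE => /orP[/eqP->|/h [k' kM' hk']].
  by exists k.
by exists k' => [|y]; [exact: leq_trans kM' MM|rewrite e // hk'].
Qed.

Lemma arith_system (I J : finType) (Ps : I -> mpoly.mpoly D R) (Qs : J -> mpoly.mpoly D R) :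
  (forall y, Y y <-> forall i, mpoly.meval (fun t => y 0 t) (Ps i) = 0) ->
  exists M CL CI T, [/\ arith M CL CI T, forall t, solves CL CI t -> Y (head_of t) &
    forall j, exists2 k, (k < M)%N & forall y, T k y = mpoly.meval (fun t => y 0 t) (Qs j)].
Proof.
move=> hY; pose P (ij : I + J) := match ij with inl i => Ps i | inr j => Qs j end.
have [M [CL [CI [T [ar h]]]]] := @arith_define _
  (fun ij y => mpoly.meval (fun t => y 0 t) (P ij)) (enum {: I + J})
  (fun ij => (good_meval (P ij)).1).
have /choice[ix hix] i : exists k, (k < M)%N /\
    forall y, T k y = mpoly.meval (fun t => y 0 t) (Ps i).
  by have [|k kM hk] := h (inl i); [rewrite mem_enum|exists k].
(* The equations of [Y] are imposed last, as linear constraints on the variables carrying the values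
   of the polynomials. *)
pose CL' := [seq ([:: (1, ix i)], 0 : R) | i <- enum I] ++ CL.
have weaker t : solves CL' CI t -> solves CL CI t.
  by move=> [h1 h2]; split=> // x xC; apply: h1; rewrite mem_cat xC orbT.
exists M, CL', CI, T; split.
- split; try by case: ar.
  + move=> x; rewrite mem_cat => /orP[/mapP[i _ ->] z|/(ar_lin ar) //].
    by rewrite inE => /eqP-> /=; case: (hix i).
  + by move=> t /weaker /(ar_sound ar).
  + move=> y Yy; have [h1 h2] := ar_compl ar Yy; split=> // x.
    rewrite mem_cat => /orP[/mapP[i _ ->]|/h1 //] /=.
    rewrite /lincomb big_seq1 mul1r /=; case: (hix i) => _ ->.
    by move/hY: Yy; exact.
- move=> t st; apply/hY => i; have [kM <-] := hix i.
  rewrite -(ar_sound ar (weaker _ st)) //; case: st => h1 _.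
  have := h1 ([:: (1, ix i)], 0); rewrite mem_cat map_f ?mem_enum // => /(_ isT).
  by rewrite /lincomb big_seq1 /= mul1r.
- by move=> j; apply: (h (inr j)); rewrite mem_enum.
Qed.

End Arithmetic.

(** * From algebraic sets to linkages *)

Section Universality.
Variables (R : realType) (n' D : nat) (Y : set 'rV[R]_D).
Local Notation n := n'.+2.
Variable A : ('rV[R]_D -> R) -> Prop.
Hypotheses (A_cst : forall k, A (fun=> k)) (A_coord : forall i, A (fun y => y 0 i))
  (A_add : forall g h, A g -> A h -> A (fun y => g y + h y))
  (A_mul : forall g h, A g -> A h -> A (fun y => g y * h y))
  (A_inv : forall g, A g -> (forall y, Y y -> g y != 0) -> A (fun y => (g y)^-1))
  (A_sqrt : forall g, A g -> (forall y, Y y -> 0 < g y) -> A (fun y => Num.sqrt (g y))).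
Implicit Types g h : 'rV[R]_D -> R.

Lemma A_opp g : A g -> A (fun y => - g y).
Proof. by move=> ag; under eq_fun do rewrite -mulN1r; exact: A_mul. Qed.

Lemma A_sub g h : A g -> A h -> A (fun y => g y - h y).
Proof. by move=> ag ah; apply: A_add => //; exact: A_opp. Qed.

Lemma A_div g h : A g -> A h -> (forall y, Y y -> h y != 0) -> A (fun y => g y / h y).
Proof. by move=> ag ah h0; apply: A_mul => //; exact: A_inv. Qed.

Lemma A_sqr g : A g -> A (fun y => g y ^+ 2).
Proof. by move=> ag; under eq_fun do rewrite expr2; exact: A_mul. Qed.

Lemma A_sum (I : Type) (s : seq I) (F : I -> 'rV[R]_D -> R) :
  (forall i, A (F i)) -> A (fun y => \sum_(i <- s) F i y).
Proof.
move=> aF; elim: s => [|i s IH].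
  by under eq_fun do rewrite big_nil; exact: A_cst.
by under eq_fun do rewrite big_cons; exact: A_add.
Qed.

Lemma A_pv (f : frame R n') g h i j : A g -> A h -> A (fun y => pv f (g y) (h y) i j).
Proof.
move=> ag ah; under eq_fun do rewrite !mxE.
by apply: A_add; apply: A_mul => //; apply: A_add; apply: A_mul.
Qed.

Lemma A_rhombus_sol (f : frame R n') (L t : R) (x1 x2 mu : 'rV[R]_D -> R) b r i j :
  L != 0 -> t != 0 -> A x1 -> A x2 -> A mu ->
  (forall y, Y y -> 0 < x1 y ^+ 2 + x2 y ^+ 2) ->
  (forall y, Y y -> 0 < L ^+ 2 - (x1 y ^+ 2 + x2 y ^+ 2) * (1 + mu y) ^+ 2 / 4) ->
  A (fun y => rhombus_sol f L t (x1 y) (x2 y) (mu y) b r i j).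
Proof.
move=> L0 t0 a1 a2 am rho0 nd.
have arho : A (fun y => x1 y ^+ 2 + x2 y ^+ 2) by apply: A_add; exact: A_sqr.
have a1m : A (fun y => 1 + mu y) by exact: A_add.
have ah : A (fun y => rhombus_height L (x1 y) (x2 y) (mu y)).
  apply: A_sqrt => [|y Yy]; last by rewrite divr_gt0 ?nd ?rho0.
  apply: A_div => // [|y Yy]; last by rewrite gt_eqF ?rho0.
  apply: A_sub => //; apply: A_mul => //; apply: A_mul => //; exact: A_sqr.
have ash (x : 'rV[R]_D -> R) : A x ->
    A (fun y => sgnb R b * rhombus_height L (x1 y) (x2 y) (mu y) * x y).
  by move=> ax; apply: A_mul => //; exact: A_mul.
have ahalf (x : 'rV[R]_D -> R) : A x -> A (fun y => (1 + mu y) / 2 * x y).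
  by move=> ax; apply: A_mul => //; exact: A_mul.
have b1 : A (fun y => rh1 L (x1 y) (x2 y) (mu y) b).
  by apply: A_mul => //; apply: A_sub; [exact: ahalf|exact: ash].
have b2 : A (fun y => rh2 L (x1 y) (x2 y) (mu y) b).
  by apply: A_mul => //; apply: A_add; [exact: ahalf|exact: ash].
have aL h : A h -> A (fun y => L * h y) by exact: A_mul.
case: r => -[] [] /=; apply: A_pv => //; apply: A_mul => //; apply: A_sub; try exact: aL;
  by [|exact: A_mul].
Qed.

Section SystemSol.
Variables (I Q : finType) (fr : I -> frame R n') (qx qy : Q -> I) (kap : R).
Variables (lins : seq ({ffun I -> R} * 'rV[R]_n)) (t : 'rV[R]_D -> I -> R).
Hypotheses (kap_bound : 0 < kap < 16).
Hypotheses (t_good : forall y, Y y -> good_values fr qx qy kap lins (t y))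
  (A_t : forall i, A (fun y => t y i)).

Lemma A_inv_ratio i : A (fun y => inv_ratio (t y i)).
Proof.
apply: A_div => // [|y _]; first by apply: A_add => //; exact: A_sqr.
by rewrite gt_eqF //; have := sqr_ge0 (t y i); lra.
Qed.

Lemma A_system_sol c d j (a : 'I_1) b : A (fun y => system_sol fr qx qy kap (t y) c d j a b).
Proof.
have am := A_inv_ratio.
case: j => [k|[[[[i bb] r]|i]|[q r]]] /=; first exact: A_cst.
- apply: A_rhombus_sol => //; [exact: arm_neq0|exact: leg_neq0| |].
  + by move=> y _; exact: rho_gt0.
  + by move=> y Yy; apply: line_nondeg; case: (t_good Yy).
- apply: A_pv; first by apply: A_sub => //; apply: A_mul => //; exact: A_mul.
  by apply: A_mul => //; exact: A_mul.
- apply: A_rhombus_sol => //.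
  + by rewrite gt_eqF //; exact: inv_leg_gt0.
  + by apply: A_div => // y Yy; apply: (inv_qx_neq0 kap_bound (t_good Yy)).
  + by move=> y Yy; apply: (inv_rho_gt0 kap_bound (t_good Yy)).
  + by move=> y Yy; apply: (inv_nondeg kap_bound (t_good Yy)).
Qed.

End SystemSol.

End Universality.

Section AxisFrames.
Variables (R : realType) (n' : nat).

Definition half_sqrt : R := Num.sqrt 2^-1.

Lemma half_sqrt_sqr : half_sqrt ^+ 2 = 2^-1.
Proof. by rewrite sqr_sqrtr // invr_ge0. Qed.

Lemma half_sqrt_gt0 : 0 < half_sqrt.
Proof. by rewrite sqrtr_gt0 invr_gt0. Qed.

Lemma lift0_neq0 (j : 'I_n'.+1) : lift ord0 j != ord0 :> 'I_n'.+2.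
Proof. by rewrite eq_sym neq_lift. Qed.

Lemma unit10 : 1 ^+ 2 + 0 ^+ 2 = 1 :> R. Proof. by ring. Qed.
Lemma unit01 : 0 ^+ 2 + 1 ^+ 2 = 1 :> R. Proof. by ring. Qed.
Lemma unit_half : half_sqrt ^+ 2 + half_sqrt ^+ 2 = 1 :> R.
Proof. by rewrite half_sqrt_sqr; field. Qed.

(** The line of a frame is directed by its second vector b, which is e_0 here, another basis vector
    for [frame_axis], and the diagonal of these two for [frame_diag]. *)
Definition frame_main : frame R n' := Frame (lift0_neq0 ord0) unit10.
Definition frame_axis (j : 'I_n'.+1) : frame R n' := Frame (lift0_neq0 j) unit01.
Definition frame_diag (j : 'I_n'.+1) : frame R n' := Frame (lift0_neq0 j) unit_half.

Lemma pv_main x : pv frame_main 0 x = x *: delta_mx 0 ord0.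
Proof. exact: pv_e0. Qed.

Lemma pv_axis j x : pv (frame_axis j) 0 x = x *: delta_mx 0 (lift ord0 j).
Proof. by rewrite /pv /= !(mulr0, mul0r, add0r, mul1r, scale0r). Qed.

Lemma pv_diag j x : pv (frame_diag j) 0 x =
  (half_sqrt * x) *: (delta_mx 0 ord0 + delta_mx 0 (lift ord0 j)).
Proof. by rewrite /pv /= !(mulr0, add0r) scalerDr. Qed.

End AxisFrames.

(** * The linkage of an arithmetic system *)

Section Construction.
Variables (R : realType) (n' D r M : nat) (Y : set 'rV[R]_D).
Local Notation n := n'.+2.
Variable A : ('rV[R]_D -> R) -> Prop.
Hypotheses (A_cst : forall k, A (fun=> k))
  (A_add : forall g h, A g -> A h -> A (fun y => g y + h y))
  (A_mul : forall g h, A g -> A h -> A (fun y => g y * h y))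
  (A_inv : forall g, A g -> (forall y, Y y -> g y != 0) -> A (fun y => (g y)^-1))
  (A_sqrt : forall g, A g -> (forall y, Y y -> 0 < g y) -> A (fun y => Num.sqrt (g y))).
Variables (CL : seq (seq (R * nat) * R)) (CI : seq (nat * nat)) (T : nat -> 'rV[R]_D -> R).
Hypotheses (ar : arith Y A M CL CI T) (sol_Y : forall t, solves CL CI t -> Y (head_of D t)).
Variables (pos : 'I_r -> 'I_n -> 'I_M) (y0 : 'rV[R]_D) (Yy0 : Y y0).

(** Each variable has a line along e_0. Each marked vertex has, for every other coordinate, a line
    along that axis and a diagonal line coupling it with a variable. *)
Definition line_index : Type := ('I_M + 'I_r * 'I_n'.+1 + 'I_r * 'I_n'.+1)%type.
HB.instance Definition _ := Finite.on line_index.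
Local Notation I := line_index.
Definition inv_index : Type := 'I_(size CI).
HB.instance Definition _ := Finite.on inv_index.
Local Notation Q := inv_index.

Definition var_line (a : 'I_M) : I := inl (inl a).
Definition axis_line v j : I := inl (inr (v, j)).
Definition diag_line v j : I := inr (v, j).

Definition line_frame (i : I) : frame R n' :=
  match i with
  | inl (inl _) => frame_main R n'
  | inl (inr vj) => frame_axis R vj.2
  | inr vj => frame_diag R vj.2
  end.

Variables (qx qy : Q -> 'I_M).
Hypotheses (qxE : forall q : Q, nat_of_ord (qx q) = (nth (0%N, 0%N) CI q).1)
  (qyE : forall q : Q, nat_of_ord (qy q) = (nth (0%N, 0%N) CI q).2).
Variable d : R.
Hypotheses (d_gt0 : 0 < d) (d_le1 : d <= 1)
  (T_small : forall y (a : 'I_M), Y y -> `|d * T a y| <= 1).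

Definition line_coef (l : seq (R * nat)) : {ffun I -> R} :=
  \sum_(x <- l) if insub x.2 is Some a then x.1 *: delta R (var_line a) else 0.

(** A diagonal vector has equal components on e_0 and on the other axis, so this vanishing relation
    copies the value of a variable to that axis. *)
Definition transfer_coef v j : {ffun I -> R} :=
  delta R (var_line (pos v (lift ord0 j))) + delta R (axis_line v j) - delta R (diag_line v j).

Definition lin_system : seq ({ffun I -> R} * 'rV[R]_n) :=
  [seq (line_coef x.1, (d * x.2) *: delta_mx 0 ord0) | x <- CL] ++
  [seq (transfer_coef vj.1 vj.2, 0) | vj <- enum {: 'I_r * 'I_n'.+1}].

Definition line_value (y : 'rV[R]_D) (i : I) : R :=
  match i with
  | inl (inl a) => d * T a y
  | inl (inr vj) => d * T (pos vj.1 (lift ord0 vj.2)) y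
  | inr vj => d * T (pos vj.1 (lift ord0 vj.2)) y / half_sqrt R
  end.

Lemma sum_line_coef l (t : I -> R) : (forall z, z \in l -> z.2 < M)%N ->
  \sum_i line_coef l i *: pv (line_frame i) 0 (t i) =
  lincomb l (fun k => if insub k is Some a then t (var_line a) else 0) *: delta_mx 0 ord0.
Proof.
move=> lM; rewrite -[LHS]/(ev (fun i => pv (line_frame i) 0 (t i)) (line_coef l)).
rewrite ev_sum /lincomb scaler_suml; apply: eq_bigr => x _.
case: insubP => [a _ _|_]; last by rewrite ev0 mulr0 scale0r.
by rewrite evZ ev_delta pv_main scalerA.
Qed.

Lemma sum_transfer v j (t : I -> R) :
  \sum_i transfer_coef v j i *: pv (line_frame i) 0 (t i) =
  t (var_line (pos v (lift ord0 j))) *: delta_mx 0 ord0 +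
  t (axis_line v j) *: delta_mx 0 (lift ord0 j) -
  (half_sqrt R * t (diag_line v j)) *: (delta_mx 0 ord0 + delta_mx 0 (lift ord0 j)).
Proof.
rewrite -[LHS]/(ev (fun i => pv (line_frame i) 0 (t i)) (transfer_coef v j)).
by rewrite evD evN evD !ev_delta pv_main pv_axis pv_diag.
Qed.

(** A variable is represented by [d] times its value, so that a product equal to 1 becomes
    [d ^+ 2]. *)
Definition kappa : R := d ^+ 2.

Lemma kappa_bound : 0 < kappa < 16.
Proof.
by rewrite exprn_gt0 //= (@le_lt_trans _ _ 1) ?ltr1n // exprn_ile1 // ltW.
Qed.

Lemma half_sqrt_neq0 : half_sqrt R != 0.
Proof. by rewrite gt_eqF // half_sqrt_gt0. Qed.

Lemma line_value_good y : Y y ->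
  good_values line_frame (var_line \o qx) (var_line \o qy) kappa lin_system (line_value y).
Proof.
move=> Yy; have small a : (d * T (nat_of_ord (a : 'I_M)) y) ^+ 2 <= 1.
  by rewrite -real_normK ?num_real // expr_le1 // T_small.
have [sL sI] := ar_compl ar Yy; split.
- case=> [[a|vj]|vj] /=; try by apply: le_lt_trans (small _) _; rewrite ltr1n.
  (* A diagonal line carries sqrt 2 times the scaled value, so its square is at most 2. *)
  rewrite expr_div_n half_sqrt_sqr invrK.
  apply: (@le_lt_trans _ _ (1 * 2)); last by rewrite mul1r ltr_nat.
  by rewrite ler_wpM2r.
- move=> q /=; rewrite qxE qyE mulrACA sI ?mulr1 ?expr2 //.
  by apply: mem_nth; exact: (ltn_ord (q : 'I__)).
- move=> l; rewrite mem_cat => /orP[/mapP[x xC ->]|/mapP[[v j] _ ->]] /=.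
    rewrite sum_line_coef; last exact: (ar_lin ar xC).
    congr (_ *: _); rewrite -(sL x xC) /lincomb mulr_sumr big_seq [RHS]big_seq.
    apply: eq_bigr => z zx; have zM := ar_lin ar xC zx.
    by rewrite insubT /= mulrCA.
  rewrite sum_transfer /= mulrCA divff ?half_sqrt_neq0 // mulr1 scalerDr subrr //.
Qed.

Lemma line_value_inj y y' : (forall i, line_value y i = line_value y' i) -> y = y'.
Proof.
move=> e; apply/rowP => j; rewrite -!(ar_coord ar).
have jM : (j < M)%N := leq_trans (ltn_ord j) (ar_dim ar).
have := e (var_line (Ordinal jM)) => /=; apply: mulfI; by rewrite gt_eqF.
Qed.

Let K := unit_index I Q.
Let J := ('I_n + K)%type.
Let Sol y c dd : J -> 'rV[R]_n :=
  system_sol line_frame (var_line \o qx) (var_line \o qy) kappa (line_value y) c dd.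
Let lform i : {ffun J -> R} := line_form Q line_frame i.

Definition point_form v : {ffun J -> R} :=
  d^-1 *: (lform (var_line (pos v ord0)) + \sum_j lform (axis_line v j)).

Definition branches : Type := ({ffun I * bool -> bool} * {ffun Q -> bool})%type.
HB.instance Definition _ := Finite.on branches.

Let axis_main (q : Q) : fr_cos (line_frame ((var_line \o qx) q)) = 1. Proof. by []. Qed.
Let axis_main' (q : Q) : fr_cos (line_frame ((var_line \o qy) q)) = 1. Proof. by []. Qed.

Lemma ev_point v y c dd : Y y -> ev (Sol y c dd) (point_form v) = \row_j T (pos v j) y.
Proof.
move=> Yy; have g := line_value_good Yy.
have lineE i : ev (Sol y c dd) (lform i) = pv (line_frame i) 0 (line_value y i).
  exact: (system_sol_line kappa_bound axis_main axis_main' g c dd i).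
rewrite evZ evD ev_sum lineE pv_main scalerDr scaler_sumr.
have -> : \sum_j d^-1 *: ev (Sol y c dd) (lform (axis_line v j)) =
    \sum_j T (pos v (lift ord0 j)) y *: delta_mx 0 (lift ord0 j).
  apply: eq_bigr => j _; rewrite lineE pv_axis scalerA /= mulrA mulVf ?mul1r //.
  by rewrite gt_eqF.
rewrite scalerA /= mulrA mulVf ?gt_eqF // mul1r.
rewrite -(big_ord_recl _ (fun j => T (pos v j) y *: delta_mx 0 j)).
rewrite [RHS]row_sum_delta; apply: eq_bigr => j _; by rewrite mxE.
Qed.

Lemma sound w : unit_family (unit_zeros line_frame (var_line \o qx)) w ->
  (forall a, a \in system_rels line_frame (var_line \o qx) (var_line \o qy) kappa lin_system ->
    ev w a = 0) ->
  exists y (b : branches), Y y /\ forall j, w j = Sol y b.1 b.2 j.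
Proof.
move=> uw rw.
have [t [_ _ tI tL tgood]] := system_sound kappa_bound axis_main axis_main' uw rw.
(* Undo the scaling. Indices outside the range get 0; the constraints do not mention them. *)
pose s (k : nat) : R := if insub k is Some a then d^-1 * t (var_line a) else 0.
have sE (a : 'I_M) : d * s a = t (var_line a).
  by rewrite /s valK mulrA divff ?mul1r // gt_eqF.
have st : solves CL CI s.
  split=> [x xC|p pC].
    have := tL (line_coef x.1, (d * x.2) *: delta_mx 0 ord0).
    rewrite mem_cat (map_f (fun x => (line_coef x.1, (d * x.2) *: delta_mx 0 ord0))) //.
    move=> /(_ isT); rewrite sum_line_coef; last exact: (ar_lin ar xC).
    move=> /(congr1 (fun z : 'rV[R]_n => d^-1 * z 0 ord0)).
    rewrite !mxE !eqxx !mulr1 mulrA mulVf ?gt_eqF // mul1r => <-.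
    rewrite /lincomb mulr_sumr big_seq [RHS]big_seq; apply: eq_bigr => z zx.
    have zM := ar_lin ar xC zx.
    by rewrite /s insubT /= mulrCA.
  have qlt : (index p CI < size CI)%N by rewrite index_mem.
  pose q : Q := Ordinal qlt.
  have pE : p = nth (0%N, 0%N) CI q by rewrite /= nth_index.
  have := tI q => /=; rewrite -!sE mulrACA -expr2 /kappa => h.
  have d2 : d ^+ 2 != 0 by rewrite expf_neq0 // gt_eqF.
  by apply: (mulfI d2); rewrite mulr1 pE -qxE -qyE h.
pose y := head_of D s; have Yy : Y y by exact: sol_Y.
have sT (a : 'I_M) : s a = T a y by rewrite (ar_sound ar st).
have tE i : t i = line_value y i.
  have transfer v j : t (axis_line v j) = t (var_line (pos v (lift ord0 j))) /\
      half_sqrt R * t (diag_line v j) = t (var_line (pos v (lift ord0 j))).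
    have := tL (transfer_coef v j, 0); rewrite mem_cat.
    rewrite (map_f (fun vj => (transfer_coef vj.1 vj.2, 0)) (x := (v, j))) ?mem_enum // orbT.
    move=> /(_ isT); rewrite sum_transfer => h.
    have h0 := congr1 (fun z : 'rV[R]_n => z 0 ord0) h.
    have h1 := congr1 (fun z : 'rV[R]_n => z 0 (lift ord0 j)) h.
    move: h0 h1; rewrite !mxE !eqxx (negPf (lift0_neq0 j)).
    have -> : (ord0 == lift ord0 j :> 'I_n) = false by rewrite eq_sym (negPf (lift0_neq0 j)).
    by rewrite /=; lra.
  case: i => [[a|[v j]]|[v j]] /=.
  - by rewrite -sT sE.
  - by rewrite -sT sE; case: (transfer v j).
  - rewrite -sT sE; case: (transfer v j) => _ <-.
    by rewrite mulrAC divff ?mul1r // half_sqrt_neq0.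
have tE' : t = line_value y by apply/funext.
(* The values are now those of a point of [Y], hence good, and the classification of branches
   applies. *)
rewrite tE' in tgood; have [c [dd hw]] := tgood (line_value_good Yy).
exists y, (finfun c, finfun dd); split=> // j; rewrite hw /= /Sol.
congr (system_sol _ _ _ _ _ _ _ _); apply/funext => z; by rewrite ffunE.
Qed.

Lemma A_line_value i : A (fun y => line_value y i).
Proof.
have aT a : A (T a) by case: (ar_adm ar a).
by case: i => [[a|vj]|vj] /=; do ?apply: A_mul.
Qed.

Lemma universality : exists (L : linkage R n) (wv : 'I_r -> 'I_(lk_N L))
    (S : 'rV[R]_D -> branches -> 'M[R]_(lk_N L, n)), [/\
  forall phi, config phi <-> exists y b, Y y /\ phi = S y b,
  forall y b v, Y y -> row (wv v) (S y b) = \row_j T (pos v j) y,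
  forall y b y' b', Y y -> Y y' -> S y b = S y' b' -> y = y' /\ b = b' &
  forall b i j, A (fun y => S y b i j)].
Proof.
pose b0 : branches := ([ffun=> true], [ffun=> true]).
pose Z := unit_zeros line_frame (var_line \o qx).
pose rels := system_rels line_frame (var_line \o qx) (var_line \o qy) kappa lin_system.
(* All unit vectors are made vertices, so that a configuration determines its branches and [S] is
   injective. *)
pose outs : seq {ffun J -> R} :=
  [seq point_form v | v <- enum 'I_r] ++ [seq delta R j | j <- enum {: J}].
have fam y (b : branches) : Y y -> unit_family Z (Sol y b.1 b.2).
  by move=> Yy; apply: (system_sol_unit kappa_bound axis_main axis_main' (line_value_good Yy)).
have relsS y (b : branches) : Y y -> forall a, a \in rels -> ev (Sol y b.1 b.2) a = 0.
  move=> Yy a.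
  exact: (system_sol_rels kappa_bound axis_main axis_main' (line_value_good Yy) b.1 b.2).
have [L [fm [hL ho]]] := @unit_vector_linkage R n K Z ord0 (Sol y0 b0.1 b0.2) rels outs
  (fam _ _ Yy0) (relsS _ _ Yy0).
have /choice[wv hwv] v : exists u, fm u = point_form v.
  by apply: ho; rewrite mem_cat (map_f point_form) ?mem_enum.
have dfm j : exists u, fm u = delta R j.
  by apply: ho; rewrite mem_cat (map_f (@delta R J)) ?orbT // mem_enum.
pose S y (b : branches) : 'M[R]_(lk_N L, n) := \matrix_u ev (Sol y b.1 b.2) (fm u).
have rowS y b u : row u (S y b) = ev (Sol y b.1 b.2) (fm u) by rewrite rowK.
exists L, wv, S; split.
- move=> phi; rewrite hL; split=> [[w [uw rw hphi]]|[y [b [Yy ->]]]].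
    have [y [b [Yy hw]]] := sound uw rw; exists y, b; split=> //.
    apply/row_matrixP => u; rewrite rowS hphi; congr (ev _ _); exact/funext.
  by exists (Sol y b.1 b.2); split; [exact: fam|exact: relsS|move=> v; exact: rowS].
- by move=> y b v Yy; rewrite rowS hwv ev_point.
- move=> y b y' b' Yy Yy' e.
  have eS j : Sol y b.1 b.2 j = Sol y' b'.1 b'.2 j.
    by have [u hu] := dfm j; rewrite -!(ev_delta _ j) -hu -!rowS e.
  have yy : y = y'.
    apply: line_value_inj => i.
    have h1 := system_sol_line kappa_bound axis_main axis_main' (line_value_good Yy) b.1 b.2 i.
    have h2 := system_sol_line kappa_bound axis_main axis_main' (line_value_good Yy') b'.1 b'.2 i.
    have := etrans (esym h1) (etrans (congr1 (fun w => ev w (lform i)) (funext eS)) h2).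
    by move=> /pv_inj[].
  split=> //; subst y'.
  have [e1 e2] := system_sol_inj kappa_bound (line_value_good Yy) eS.
  case: b b' {e eS} e1 e2 => [c1 d1] [c2 d2] /= e1 e2.
  by congr (_, _); apply/ffunP.
- move=> b i j; under eq_fun do rewrite mxE /ev summxE.
  apply: A_sum => // k; under eq_fun do rewrite mxE; apply: A_mul => //.
  apply: (A_system_sol A_cst A_add A_mul A_inv A_sqrt kappa_bound) => //.
  + exact: line_value_good.
  + exact: A_line_value.
Qed.

End Construction.

Lemma compact_coord_bounded (R : realType) (a b : nat) (Y : set 'M[R]_(a, b)) i j :
  compact Y -> exists K, forall y, Y y -> `|y i j| <= K.
Proof.
move=> cY; have cf : compact ((fun y : 'M[R]_(a, b) => y i j) @` Y).
  apply: continuous_compact => //; apply: continuous_subspaceT => y.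
  exact/analytic_continuous/analytic_coord.
have [M [_ hM]] := compact_bounded cf.
by exists (M + 1) => y Yy; apply: hM; [rewrite ltrDl|exists y].
Qed.

Lemma analytic_restr_vproj (R : realType) (n N k : nat) (S : set 'M[R]_(N, n)) (w : 'I_k -> 'I_N) :
  analytic_restr S (vproj w).
Proof.
apply/analytic_restrP => i j; apply: (@analytic_on_eq _ _ _ _ (fun x => x (w i) j)).
  by move=> x _; rewrite mxE.
exact: analytic_on_coord.
Qed.

(** * A linkage without configurations *)

Section EmptyLinkage.
Variables (R : realType) (n : nat).

Definition impossible_edges : {set {set 'I_2}} := [set [set: 'I_2]%SET]%SET.

Lemma impossible_edges2 e : e \in impossible_edges -> #|e| = 2%N.
Proof. by rewrite inE => /eqP->; rewrite cardsT card_ord. Qed.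

Definition impossible_linkage : linkage R n :=
  @Linkage R n 2 impossible_edges (fun=> 1) [set: 'I_2]%SET (fun=> 0) impossible_edges2
    (fun _ _ => ltr01).

Lemma impossible_config phi : ~ config (L := impossible_linkage) phi.
Proof.
move=> [/= hfix hlen].
have e01 : [set (ord0 : 'I_2); ord_max]%SET \in impossible_edges.
  by rewrite inE; apply/eqP/setP => i; rewrite !inE; case: i => -[|[|]].
have := hlen ord0 ord_max e01 isT; rewrite !hfix ?inE // subrr eucl_norm_nsq /nsq dot0l sqrtr0.
by move/esym/eqP; rewrite oner_eq0.
Qed.

End EmptyLinkage.

Lemma functional_of_algebraic (R : realType) (n' k m : nat) (X : set 'M[R]_(k, n'.+2))
    (f : 'M[R]_(k, n'.+2) -> 'M[R]_(m, n'.+2)) (U : set 'M[R]_(k, n'.+2))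
    (D : nat) (Y : set 'rV[R]_D) (q : 'rV[R]_D -> 'M[R]_(k, n'.+2))
    (p : 'rV[R]_D -> 'M[R]_(m, n'.+2)) (e : nat) (sigma : 'M[R]_(k, n'.+2) -> 'I_e -> 'rV[R]_D) :
  U `<=` X -> compact Y -> real_algebraic Y -> poly_map_on Y q -> poly_map_on Y p ->
  (forall y, Y y -> p y = f (q y)) -> q @` Y = X ->
  (forall x c, U x -> q (sigma x c) = x) ->
  analytic_iso_prod U sigma (Y `&` q @^-1` U) ->
  exists L : linkage R n'.+2, functional_for L X f U.
Proof.
move=> UX cY [r0 [Ps YE]] [Pq qE] [Pp pE] pf qX qs [an_s [sS [t1 [t2 [_ [_ [h1 h2]]]]]]].
(* The bar lengths are read off at a point of [Y], so the empty case needs a linkage of its own. *)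
have [[y0 Yy0]|nY] := pselect (exists y, Y y); last first.
  have X0 x : ~ X x by rewrite -qX => -[y Yy _]; apply: nY; exists y.
  exists (impossible_linkage R n'.+2), (fun=> ord0), (fun=> ord0); split.
    apply/seteqP; split=> [x [phi /impossible_config //]|x /X0 //].
  split=> [phi /impossible_config //|].
  exists 1%N, (fun _ _ => 0); split; last by move=> x c /UX /X0.
  apply: (@iso_from_sections _ _ _ _ _ _ _ _ _ (vproj (fun=> ord0)) ord0).
  - move=> c; apply/analytic_restrP => i j.
    by apply: (@analytic_on_eq _ _ _ _ (fun=> 0)) => [x _|]; [rewrite mxE|exact: analytic_on_cst].
  - by move=> x c /UX /X0.
  - exact: analytic_restr_vproj.
  - by move=> x c /UX /X0.
  - by move=> x c c' /UX /X0.
  - by move=> y [/impossible_config].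
(* Testing analyticity along the sections makes the coordinates qualify by the hypothesis on
   [sigma], and closure under arithmetic replaces the composition of analytic maps. *)
pose A (g : 'rV[R]_D -> R) := forall c, analytic_on U (fun u => g (sigma u c)).
have sY u c : U u -> Y (sigma u c) by move=> Uu; case: (sS u c Uu).
have A_cst z : A (fun=> z) by move=> c; exact: analytic_on_cst.
have A_coord i : A (fun y => y 0 i).
  by move=> c; have /analytic_restrP := an_s c; exact.
have A_add g h : A g -> A h -> A (fun y => g y + h y).
  by move=> ag ah c; exact: analytic_onD (ag c) (ah c).
have A_mul g h : A g -> A h -> A (fun y => g y * h y).
  by move=> ag ah c; exact: analytic_onM (ag c) (ah c).
have A_inv g : A g -> (forall y, Y y -> g y != 0) -> A (fun y => (g y)^-1).
  by move=> ag g0 c; apply: (analytic_onV (ag c)) => u Uu; apply: g0; exact: sY.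
have A_sqrt g : A g -> (forall y, Y y -> 0 < g y) -> A (fun y => Num.sqrt (g y)).
  by move=> ag g0 c; apply: (analytic_on_sqrt (ag c)) => u Uu; apply: g0; exact: sY.
have bd (i : 'I_D) : exists K, forall y, Y y -> `|y 0 i| <= K by exact: compact_coord_bounded.
pose Qs (vj : 'I_(k + m) * 'I_n'.+2) :=
  match fintype.split vj.1 with inl i => Pq i vj.2 | inr i => Pp i vj.2 end.
have hY y : Y y <-> forall i, mpoly.meval (fun t => y 0 t) (Ps i) = 0 by rewrite YE.
have [M [CL [CI [T [ar sY' hQ]]]]] :=
  arith_system A_cst A_coord A_add A_mul A_inv bd Qs hY.
have /choice[pos hpos] (vj : 'I_(k + m) * 'I_n'.+2) : exists a : 'I_M,
    forall y, T a y = mpoly.meval (fun t => y 0 t) (Qs vj).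
  by have [a aM ha] := hQ vj; exists (Ordinal aM).
have inCI (i : 'I_(size CI)) : nth (0%N, 0%N) CI i \in CI by exact: mem_nth.
have /choice[qx hqx] (i : 'I_(size CI)) : exists a : 'I_M, nat_of_ord a = (nth (0%N, 0%N) CI i).1.
  by exists (Ordinal (proj1 (ar_inv ar (inCI i)))).
have /choice[qy hqy] (i : 'I_(size CI)) : exists a : 'I_M, nat_of_ord a = (nth (0%N, 0%N) CI i).2.
  by exists (Ordinal (proj2 (ar_inv ar (inCI i)))).
have /choice[K hK] (a : 'I_M) : exists K, forall y, Y y -> `|T a y| <= K.
  by case: (ar_adm ar a).
(* A common bound for all variables on [Y], at least 1; its inverse is the scale [d]. *)
pose S := 1 + \sum_a `|K a|; have S1 : 1 <= S by rewrite lerDl sumr_ge0.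
have S0 : 0 < S by exact: lt_le_trans S1.
have d1 : S^-1 <= 1 by rewrite invf_le1.
have small y (a : 'I_M) : Y y -> `|S^-1 * T a y| <= 1.
  move=> Yy; rewrite normrM gtr0_norm ?invr_gt0 // ler_pdivrMl // mulr1.
  apply: le_trans (hK a y Yy) _; apply: le_trans (ler_norm _) _.
  by rewrite /S (bigD1 a) //= addrCA lerDl addr_ge0 // sumr_ge0.
have d0 : 0 < S^-1 by rewrite invr_gt0.
have [L [wv [sol [L1 L2 L3 L4]]]] :=
  universality A_cst A_add A_mul A_inv A_sqrt ar sY' (fun v j => pos (v, j)) Yy0 hqx hqy d0 d1 small.
have Lq y b : Y y -> vproj (fun i => wv (lshift m i)) (sol y b) = q y.
  move=> Yy; apply/matrixP => i j; rewrite mxE qE //.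
  have := congr1 (fun x : 'rV_n'.+2 => x 0 j) (L2 y b (lshift m i) Yy); rewrite !mxE => ->.
  by rewrite hpos /Qs /= -[lshift m i]/(unsplit (inl i)) unsplitK.
have Lp y b : Y y -> vproj (fun i => wv (rshift k i)) (sol y b) = p y.
  move=> Yy; apply/matrixP => i j; rewrite mxE pE //.
  have := congr1 (fun x : 'rV_n'.+2 => x 0 j) (L2 y b (rshift k i) Yy); rewrite !mxE => ->.
  by rewrite hpos /Qs /= -[rshift k i]/(unsplit (inr i)) unsplitK.
pose B : finType := ('I_e * branches n' (k + m) M CI)%type.
pose b0 : branches n' (k + m) M CI := ([ffun=> true], [ffun=> true]).
exists L, (fun i => wv (lshift m i)), (fun i => wv (rshift k i)); split.
  apply/seteqP; split=> [x [phi /L1[y [b [Yy ->]]] <-]|x].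
    by rewrite Lq // -qX; exists y.
  rewrite -qX => -[y Yy <-]; exists (sol y b0); last exact: Lq.
  by apply/L1; exists y, b0.
split=> [phi /L1[y [b [Yy ->]]]|]; first by rewrite Lq // Lp // pf.
exists #|B|, (fun u (z : 'I_#|B|) => sol (sigma u (enum_val z).1) (enum_val z).2).
have proj u c : U u -> vproj (fun i => wv (lshift m i))
    (sol (sigma u (enum_val (c : 'I_#|B|)).1) (enum_val c).2) = u.
  by move=> Uu; rewrite Lq ?qs //; exact: sY.
(* The new sections are indexed by a given section and a branch. The default index exists because
   the total map [t2] has a value at 0. *)
split=> //; apply: (@iso_from_sections _ _ _ _ _ _ _ _ _
    (vproj (fun i => wv (lshift m i))) (enum_rank (t2 0, b0))).
- move=> c; apply/analytic_restrP => i j.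
  exact: L4.
- move=> u c Uu; split; last by rewrite /preimage /= proj.
  by apply/L1; exists (sigma u (enum_val c).1), (enum_val c).2; split=> //; exact: sY.
- exact: analytic_restr_vproj.
- exact: proj.
- move=> u c c' Uu /L3[]; [exact: sY|exact: sY|] => e1 e2.
  apply: enum_val_inj; apply: injective_projections => //.
  have [_ <-] := h2 u (enum_val c).1 Uu; have [_ <-] := h2 u (enum_val c').1 Uu.
  by rewrite e1.
- move=> phi [/L1[y [b [Yy ->]]]]; rewrite /preimage /= Lq // => Uq; split=> //.
  have [Ut ts] := h1 y (conj Yy Uq).
  exists (enum_rank (t2 y, b)); rewrite enum_rankK /=.
  have qt : q y = t1 y by rewrite -{1}ts qs.
  by rewrite qt ts.
Qed.

(** * From linkages to algebraic sets *)

Section Polynomials.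
Variables (R : realType) (D : nat).
Implicit Types (g h : 'rV[R]_D -> R).

Definition is_poly g := exists P : mpoly.mpoly D R, forall y : 'rV[R]_D,
  mpoly.meval (fun t => y 0 t) P = g y.

Lemma is_poly_cst k : is_poly (fun=> k).
Proof. by exists (mpoly.mpolyC D k) => y; rewrite mpoly.mevalC. Qed.

Lemma is_poly_coord i : is_poly (fun y => y 0 i).
Proof. by exists (mpoly.mpolyX R (mpoly.mnm1 i)) => y; rewrite mpoly.mevalXU. Qed.

Lemma is_polyD g h : is_poly g -> is_poly h -> is_poly (fun y => g y + h y).
Proof.
move=> [P hP] [Q hQ]; eexists => y; rewrite -hP -hQ; exact: mpoly.mevalD.
Qed.

Lemma is_polyM g h : is_poly g -> is_poly h -> is_poly (fun y => g y * h y).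
Proof.
move=> [P hP] [Q hQ]; eexists => y; rewrite -hP -hQ; exact: mpoly.mevalM.
Qed.

Lemma is_polyB g h : is_poly g -> is_poly h -> is_poly (fun y => g y - h y).
Proof.
move=> pg ph; under eq_fun do rewrite -mulN1r.
by apply: is_polyD => //; apply: is_polyM => //; exact: is_poly_cst.
Qed.

Lemma is_poly_sum (I : Type) (s : seq I) (F : I -> 'rV[R]_D -> R) :
  (forall i, is_poly (F i)) -> is_poly (fun y => \sum_(i <- s) F i y).
Proof.
move=> pF; elim: s => [|i s IH].
  by under eq_fun do rewrite big_nil; exact: is_poly_cst.
by under eq_fun do rewrite big_cons; exact: is_polyD.
Qed.

Lemma is_poly_if (b : bool) g h : is_poly g -> is_poly h ->
  is_poly (fun y => if b then g y else h y).
Proof. by case: b. Qed.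

Lemma is_poly_analytic g y : is_poly g -> analytic_at g y.
Proof.
move=> [P hP]; have -> : g = fun y => mpoly.meval (fun t => y 0 t) P by apply/funext.
under eq_fun do rewrite mpoly.mevalE.
elim: (mpoly.msupp P) => [|m s IH].
  by under eq_fun do rewrite big_nil; exact: analytic_cst.
under eq_fun do rewrite big_cons; apply: analyticD => //.
apply: analyticM; first exact: analytic_cst.
elim: (index_enum 'I_D) => [|i r IHr].
  by under eq_fun do rewrite big_nil; exact: analytic_cst.
under eq_fun do rewrite big_cons; apply: analyticM => //.
elim: (mpoly.fun_of_multinom m i) => [|k IHk].
  by under eq_fun do rewrite expr0; exact: analytic_cst.
by under eq_fun do rewrite exprS; apply: analyticM => //; exact: analytic_coord.
Qed.

Lemma real_algebraic_family (I : finType) (F : I -> 'rV[R]_D -> R) :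
  (forall i, is_poly (F i)) -> real_algebraic [set y | forall i, F i y = 0].
Proof.
move=> /choice[P hP]; exists #|I|, (fun k => P (enum_val k)).
apply/seteqP; split=> y /= h k; first by rewrite hP h.
by rewrite -hP -(enum_rankK k) h.
Qed.

Lemma compact_poly_zeros (I : finType) (F : I -> 'rV[R]_D -> R) :
  (forall i, is_poly (F i)) ->
  (forall j, exists K, forall y, (forall i, F i y = 0) -> `|y 0 j| <= K) ->
  compact [set y | forall i, F i y = 0].
Proof.
move=> pF /choice[K hK].
have cK : compact [set v : 'rV[R]_D | forall j, v ord0 j \in `[(- K j), (K j)]].
  apply: (@rV_compact _ _ (fun j => `[(- K j), (K j)]%classic)) => j.
  exact: segment_compact.
apply: subclosed_compact cK _ => [|y hy j]; last first.
  by rewrite in_itv /= -ler_norml hK.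
have -> : [set y : 'rV[R]_D | forall i, F i y = 0] =
    \bigcap_(i in [set: I]) ~` ([set: 'rV[R]_D] `&` F i @^-1` [set x | x != 0]).
  apply/seteqP; split=> y /= h i; first by move=> _ [_ /=]; rewrite h eqxx.
  have [//|h0] := eqVneq (F i y) 0.
  by case: (h i Logic.I).
apply: closed_bigI => i _; apply: open_closedC.
apply: open_analytic_preimage; [exact: openT|exact: open_neq|].
by move=> y _; exact: is_poly_analytic.
Qed.

End Polynomials.

(** * Components of a linkage and their pinning *)

Section LinkageComponents.
Variables (R : realType) (n : nat) (L : linkage R n) (k : nat) (w : 'I_k -> 'I_(lk_N L)).
Local Notation N := (lk_N L).

Definition adj : rel 'I_N := [rel x y | ([set x; y]%SET \in lk_E L) && (x != y)].
Definition anchored (x : 'I_N) : bool :=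
  [exists z, connect adj x z && ((z \in lk_fix L) || (z \in codom w))].
Local Notation rep x := (fingraph.root adj x).

Lemma adj_sym : connect_sym adj.
Proof.
by apply: sym_connect_sym => x y; rewrite /adj /= finset.setUC eq_sym.
Qed.

Lemma anchored_connect x y : connect adj x y -> anchored x = anchored y.
Proof.
move=> xy; apply/existsP/existsP => -[z /andP[h1 h2]]; exists z; rewrite h2 andbT.
  by apply: connect_trans h1; rewrite adj_sym.
exact: connect_trans h1.
Qed.

Lemma anchored_fix x : x \in lk_fix L -> anchored x.
Proof. by move=> h; apply/existsP; exists x; rewrite connect0 h. Qed.

Lemma anchored_input i : anchored (w i).
Proof. by apply/existsP; exists (w i); rewrite connect0 codom_f orbT. Qed.

Lemma coord_le_norm (x : 'rV[R]_n) j : `|x 0 j| <= eucl_norm x.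
Proof.
rewrite eucl_norm_nsq -sqrtr_sqr ler_wsqrtr // /nsq /dot (bigD1 j) //= expr2 lerDl.
by apply: sumr_ge0 => i _; rewrite -expr2 sqr_ge0.
Qed.

Lemma adj_dist phi x y : config phi -> adj x y ->
  eucl_norm (row x phi - row y phi) = @lk_len _ _ L [set x; y]%SET.
Proof. by move=> [_ h] /andP[h1 h2]; exact: h. Qed.

Lemma connect_bounded x y : connect adj x y ->
  exists B, forall phi, config phi -> forall j, `|phi x j - phi y j| <= B.
Proof.
move=> /connectP[p]; elim: p x => [|z p IH] x /= => [_ ->|/andP[xz pz] yE].
  by exists 0 => phi _ j; rewrite subrr normr0.
have [B hB] := IH z pz yE; exists (@lk_len _ _ L [set x; z]%SET + B) => phi cphi j.
have -> : phi x j - phi y j = (phi x j - phi z j) + (phi z j - phi y j) by ring.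
apply: le_trans (ler_normD _ _) _; apply: lerD; last exact: hB.
by rewrite -(adj_dist cphi xz); apply: le_trans (coord_le_norm _ j); rewrite !mxE.
Qed.

(* Pinning one vertex of each component without fixed or input vertices makes the
   configuration space compact without changing its image under the input map. *)
Definition pinned (phi : 'M[R]_(N, n)) : Prop :=
  config phi /\ forall x, ~~ anchored x -> rep x = x -> row x phi = 0.

(** Bars along a path bound the distance from [x] to a fixed vertex, to an input vertex, whose
    positions lie in the compact [X], or to the pinned root of its component. *)
Lemma pinned_bounded X x j : compact X -> vproj w @` @config _ _ L = X ->
  exists K, forall phi, pinned phi -> `|phi x j| <= K.
Proof.
move=> cX wX.
have near z B : (forall phi, pinned phi -> `|phi z j| <= B) -> connect adj x z ->
    exists K, forall phi, pinned phi -> `|phi x j| <= K.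
  move=> hB /connect_bounded[B' hB']; exists (B' + B) => phi pphi.
  have -> : phi x j = (phi x j - phi z j) + phi z j by ring.
  apply: le_trans (ler_normD _ _) _; apply: lerD; last exact: hB.
  by apply: hB'; case: pphi.
have [/existsP[z /andP[xz /orP[zf|/codomP[i zi]]]]|nx] := boolP (anchored x).
- apply: (near z `|@lk_mu _ _ L z 0 j|) => // phi [[hf _] _].
  by rewrite -(hf z zf) mxE.
- have [K hK] := compact_coord_bounded i j cX.
  apply: (near z K) => // phi [cphi _]; rewrite zi.
  have := hK (vproj w phi); rewrite mxE; apply.
  by rewrite -wX; exists phi.
- apply: (near (rep x) 0); last exact: connect_root.
  move=> phi [_ hp].
  have r0 : row (rep x) phi = 0.
    by apply: hp; [rewrite -(anchored_connect (connect_root _ x))|exact: root_root adj_sym _].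
  by have := congr1 (fun v : 'rV[R]_n => v 0 j) r0; rewrite !mxE => ->; rewrite normr0.
Qed.

Definition pin (phi : 'M[R]_(N, n)) : 'M[R]_(N, n) :=
  \matrix_(x, j) (phi x j - (if anchored x then 0 else phi (rep x) j)).

Lemma row_pin phi x : row x (pin phi) =
  row x phi - (if anchored x then 0 else row (rep x) phi).
Proof. by apply/rowP => j; rewrite mxE mxE [RHS]mxE; case: ifP => _; rewrite !mxE. Qed.

(** Bars see only differences of positions, so components without fixed or input vertices can be
    translated independently. *)
Lemma config_translate phi (v : 'I_N -> 'rV[R]_n) (psi : 'M[R]_(N, n)) :
  (forall x, row x psi = row x phi + v x) -> (forall x, anchored x -> v x = 0) ->
  (forall x y, adj x y -> v x = v y) -> config phi -> config psi.
Proof.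
move=> hpsi va vadj [hf he]; split=> [x xf|x y xy nxy].
  by rewrite hpsi va ?addr0 ?hf // anchored_fix.
have vxy : v x = v y by apply: vadj; rewrite /adj /= xy nxy.
have -> : row x psi - row y psi = row x phi - row y phi.
  by rewrite (hpsi x) (hpsi y) vxy opprD addrACA subrr addr0.
exact: he.
Qed.

Lemma pin_pinned phi : config phi -> pinned (pin phi).
Proof.
move=> cphi; split.
  apply: (@config_translate phi (fun x => - (if anchored x then 0 else row (rep x) phi))) => //.
  - exact: row_pin.
  - by move=> x ->; rewrite oppr0.
  - move=> x y xy; rewrite (anchored_connect (connect1 xy)).
    case: ifP => // _; congr (- row _ _).
    by apply/eqP; rewrite (root_connect adj_sym) connect1.
move=> x /negPf nx rx; rewrite row_pin nx rx; exact: subrr.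
Qed.

Lemma vproj_pin phi : vproj w (pin phi) = vproj w phi.
Proof. by apply/matrixP => i j; rewrite !mxE anchored_input subr0. Qed.

End LinkageComponents.

Lemma algebraic_of_functional (R : realType) (n' k m : nat) (X : set 'M[R]_(k, n'.+1))
    (f : 'M[R]_(k, n'.+1) -> 'M[R]_(m, n'.+1)) (U : set 'M[R]_(k, n'.+1))
    (L : linkage R n'.+1) :
  compact X -> functional_for L X f U ->
  exists (D : nat) (Y : set 'rV[R]_D)
      (q : 'rV[R]_D -> 'M[R]_(k, n'.+1)) (p : 'rV[R]_D -> 'M[R]_(m, n'.+1))
      (e : nat) (sigma : 'M[R]_(k, n'.+1) -> 'I_e -> 'rV[R]_D),
   [/\ compact Y, real_algebraic Y, poly_map_on Y q & poly_map_on Y p] /\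
   [/\ (forall y, Y y -> p y = f (q y)), q @` Y = X,
       (forall x c, U x -> q (sigma x c) = x) &
       analytic_iso_prod U sigma (Y `&` q @^-1` U)].
Proof.
set n := n'.+1; move=> cX [w [v [wX [vf [e [sigma [[an_s [sS [t1 [t2 [_ [_ [h1 h2]]]]]]] ws]]]]]]].
pose N := lk_N L; pose D := (N * n)%N.
pose idx : Type := ('I_N * 'I_n + 'I_N * 'I_N + 'I_N * 'I_n)%type.
pose co (x : 'I_N) (j : 'I_n) (y : 'rV[R]_D) : R := y 0 (mxvec_index x j).
pose F (i : ('I_N * 'I_n + 'I_N * 'I_N + 'I_N * 'I_n)%type) (y : 'rV[R]_D) : R := match i with
  | inl (inl (x, j)) => if x \in lk_fix L then co x j y - @lk_mu _ _ L x 0 j else 0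
  | inl (inr (x, z)) => if adj x z then
      \sum_j (co x j y - co z j y) * (co x j y - co z j y) - @lk_len _ _ L [set x; z]%SET ^+ 2 else 0
  | inr (x, j) => if ~~ anchored w x && (fingraph.root (@adj _ _ L) x == x) then co x j y else 0
  end.
have pco x j : is_poly (co x j) by exact: is_poly_coord.
have pF i : is_poly (F i).
  case: i => [[[x j]|[x z]]|[x j]]; apply: is_poly_if; try exact: is_poly_cst.
  - by apply: is_polyB; [exact: pco|exact: is_poly_cst].
  - apply: is_polyB; last exact: is_poly_cst.
    by apply: is_poly_sum => j; apply: is_polyM; exact: is_polyB.
  - exact: pco.
have vecE x j (y : 'rV[R]_D) : (vec_mx y : 'M[R]_(N, n)) x j = co x j y by rewrite mxE.
have YE y : (forall i, F i y = 0) <-> pinned w (vec_mx y : 'M[R]_(N, n)).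
  split=> [h|[[hf he] hp] [[[x j]|[x z]]|[x j]] /=].
  - split; first split.
    + move=> x xf; apply/rowP => j; rewrite mxE vecE.
      by have := h (inl (inl (x, j))); rewrite /= xf => /subr0_eq.
    + move=> x z xz nxz; have := h (inl (inr (x, z))).
      have -> : F (inl (inr (x, z))) y = \sum_j (co x j y - co z j y) * (co x j y - co z j y) -
          @lk_len _ _ L [set x; z]%SET ^+ 2 by rewrite /F /adj /= xz nxz.
      (* The polynomials prescribe squared lengths; positivity of the lengths recovers the
         distances. *)
      move=> /subr0_eq hl; have l0 := lk_len_pos xz.
      have -> : @lk_len _ _ L [set x; z]%SET = Num.sqrt (@lk_len _ _ L [set x; z]%SET ^+ 2).
        by rewrite sqrtr_sqr gtr0_norm.
      rewrite eucl_norm_nsq -hl; congr Num.sqrt.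
      by apply: eq_bigr => j _; rewrite !mxE.
    + move=> x nx rx; apply/rowP => j; rewrite !mxE.
      by have := h (inr (x, j)); rewrite /= nx rx eqxx.
  - case: ifP => // /hf /(congr1 (fun u : 'rV[R]_n => u 0 j)).
    by rewrite mxE vecE => ->; rewrite subrr.
  - case: ifP => // /andP[xz nxz]; have := he _ _ xz nxz; rewrite eucl_norm_nsq => <-.
    rewrite sqr_sqrtr ?nsq_ge0 //; apply/eqP; rewrite subr_eq0; apply/eqP.
    by apply: eq_bigr => j _; rewrite !mxE.
  - case: ifP => // /andP[nx /eqP rx].
    by have := congr1 (fun u : 'rV[R]_n => u 0 j) (hp x nx rx); rewrite !mxE.
pose Y := [set y | forall i, F i y = 0].
pose q (y : 'rV[R]_D) := vproj w (vec_mx y : 'M[R]_(N, n)).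
pose p (y : 'rV[R]_D) := vproj v (vec_mx y : 'M[R]_(N, n)).
pose sg x c : 'rV[R]_D := mxvec (sigma x c).
have poly_proj (k' : nat) (u : 'I_k' -> 'I_N) :
    poly_map_on Y (fun y => vproj u (vec_mx y : 'M[R]_(N, n))).
  exists (fun i j => mpoly.mpolyX R (mpoly.mnm1 (mxvec_index (u i) j))) => y _ i j.
  by rewrite mpoly.mevalXU !mxE.
have conf y : Y y -> config (vec_mx y : 'M[R]_(N, n)) by move=> /YE[].
have qs x c : U x -> q (sg x c) = x by move=> Ux; rewrite /q /sg mxvecK ws.
(* The values of [sigma] lie in [Y] only if they are pinned; this holds because over [U] no vertex
   is left to pin. *)
have all_anchored x : U x -> forall z, anchored w z.
  move=> Ux z; have [//|nz] := boolP (anchored w z); exfalso.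
  pose c0 := t2 0; have [cs _] := sS x c0 Ux.
  (* Translating the free vertices by 0, ..., e times a basis vector gives e + 1 distinct
     configurations over the same [x], too many for a fibre covered by [e] sections. *)
  pose tr (i : nat) (y : 'I_N) : 'rV[R]_n := if anchored w y then 0 else i%:R *: delta_mx 0 ord0.
  pose ph (i : nat) : 'M[R]_(N, n) := \matrix_y (row y (sigma x c0) + tr i y).
  have rowph i y : row y (ph i) = row y (sigma x c0) + tr i y by rewrite rowK.
  have cph i : config (ph i).
    apply: (@config_translate _ _ _ _ w (sigma x c0) (tr i)) => //.
    - by move=> y ay; rewrite /tr ay.
    - by move=> y y' yy; rewrite /tr (anchored_connect w (connect1 yy)).
  have wph i : vproj w (ph i) = x.
    rewrite -[RHS](ws x c0 Ux); apply/matrixP => a j.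
    rewrite !mxE /tr anchored_input !mxE addr0 //.
  have sph i : sigma x (t2 (ph i)) = ph i.
    have [Ut st] := h1 (ph i) (conj (cph i) (eq_ind_r U Ux (wph i))).
    have tx : t1 (ph i) = x by rewrite -(ws _ (t2 (ph i)) Ut) st wph.
    by rewrite -[RHS]st tx.
  have inj : injective (fun i : 'I_e.+1 => t2 (ph i)).
    move=> i i' /(congr1 (sigma x)); rewrite !sph => eph; apply: val_inj.
    have := congr1 (fun M : 'M[R]_(N, n) => row z M 0 ord0) eph.
    rewrite !rowph /tr (negPf nz) !mxE !eqxx !mulr1 => /addrI /eqP.
    by rewrite eqr_nat => /eqP.
  by have := leq_card _ inj; rewrite !card_ord ltnn.
exists D, Y, q, p, e, sg; split; split.
- apply: compact_poly_zeros => // t; case/mxvec_indexP: t => x j.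
  have [K hK] := pinned_bounded x j cX wX.
  by exists K => y /YE /hK; rewrite vecE.
- exact: real_algebraic_family.
- exact: poly_proj.
- exact: poly_proj.
- by move=> y /conf cy; exact: vf.
- apply/seteqP; split=> [x [y /conf cy <-]|x].
    by rewrite -wX; exists (vec_mx y).
  rewrite -wX => -[phi cphi <-]; exists (mxvec (pin w phi)).
    by apply/YE; rewrite mxvecK; exact: pin_pinned.
  by rewrite /q mxvecK vproj_pin.
- exact: qs.
- apply: (@iso_from_sections _ _ _ _ _ _ _ _ _ q (t2 0)) => //.
  + move=> c; apply/analytic_restrP => i t; case/mxvec_indexP: t => x j.
    have /analytic_restrP/(_ x j) := an_s c; apply: analytic_on_eq => u _.
    by rewrite (ord1 i) /sg mxvecE.
  + move=> x c Ux; split; last by rewrite /preimage /= qs.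
    apply/YE; rewrite /sg mxvecK; split; first by case: (sS x c Ux).
    by move=> z; rewrite (all_anchored x Ux z).
  + apply/analytic_restrP => i j; apply: (@analytic_on_eq _ _ _ _ (fun y => y 0 (mxvec_index (w i) j))).
      by move=> y _; rewrite !mxE.
    exact: analytic_on_coord.
  + move=> x c c' Ux /(congr1 (fun y : 'rV[R]_D => vec_mx y : 'M[R]_(N, n))).
    rewrite /sg !mxvecK => ss; have [_ <-] := h2 x c Ux; have [_ <-] := h2 x c' Ux.
    by rewrite ss.
  + move=> y [Yy Uq]; split=> //.
    have [Ut st] := h1 (vec_mx y) (conj (conf y Yy) Uq).
    have tx : t1 (vec_mx y) = q y by rewrite -(ws _ (t2 (vec_mx y)) Ut) st.
    exists (t2 (vec_mx y)); rewrite -tx /sg st; exact: vec_mxK.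
Qed.

Theorem theorem6p2 (R : realType) (n k m : nat) (X : set 'M[R]_(k,n))
  (f : 'M[R]_(k,n) -> 'M[R]_(m,n)) (U : set 'M[R]_(k,n)) :
  (2 <= n)%N -> compact X -> U `<=` X ->
  (exists L : linkage R n, functional_for L X f U) <->
  (exists (D : nat) (Y : set 'rV[R]_D)
          (q : 'rV[R]_D -> 'M[R]_(k,n)) (p : 'rV[R]_D -> 'M[R]_(m,n))
          (e : nat) (sigma : 'M[R]_(k,n) -> 'I_e -> 'rV[R]_D),
     [/\ compact Y, real_algebraic Y, poly_map_on Y q & poly_map_on Y p] /\
     [/\ (forall y, Y y -> p y = f (q y)),
         q @` Y = X,
         (forall x c, U x -> q (sigma x c) = x) &
         analytic_iso_prod U sigma (Y `&` q @^-1` U)]).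
Proof.
case: n X f U => [|[|n']] X f U // _ cX UX; split=> [[L fL]|].
  exact: algebraic_of_functional cX fL.
move=> [D [Y [q [p [e [sigma [[cY aY qY pY] [pf qX qs iso]]]]]]]].
exact: functional_of_algebraic UX cY aY qY pY pf qX qs iso.
Qed.
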